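(* Let $0<\alpha<1$ and let $\{B(t): t\in[0,1]\}$ be a fractional Brownian motion of Hurst index $\alpha$. Let $D\subset[0,1]$ be a (deterministic) set such that $\dim_{MA} D\le \alpha$. Then $$\mathbb{P}\big(\dim_H B(A)=(1/\alpha)\dim_H A \text{ for all } A\subset D\big)=1,$$ $$\mathbb{P}\big(\dim_P B(A)=(1/\alpha)\dim_P A \text{ for all } A\subset D\big)=1.$$
   Context: Fractional Brownian motion of Hurst index $\alpha\in(0,1)$: a Gaussian process $B$ with stationary increments such that $B(0)=0$, $t^{-\alpha}B(t)$ is standard normal for every $t>0$, and almost surely $t\mapsto B(t)$ is continuous; it is real-valued, with covariance $\mathbb{E}(B(t)B(s))=\frac12(|t|^{2\alpha}+|s|^{2\alpha}-|t-s|^{2\alpha})$. $B(A)=\{B(t):t\in A\}$. A statement $\mathbb{P}(\cdots)=1$ means that the property in parentheses holds almost surely (with an exceptional null event not depending on $A$). $\dim_H$ is Hausdorff dimension and $\dim_P$ is packing dimension, $\dim_P X=\inf\{\sup_i\overline{\dim}_M X_i: X=\bigcup_{i=1}^\infty X_i\}$, where $\overline{\dim}_M$ is the upper Minkowski dimension. Modified Assouad dimension: let $X$ be a totally bounded metric space, let $B(x,r)$ denote the closed ball of radius $r$ around $x$, and for $A\subset X$ let $N_r(A)$ be the smallest number of closed balls of diameter $r$ required to cover $A$. For $0<\varepsilon<1$ put $$\dim_A^{\varepsilon}X=\inf\{\gamma:\exists\, C<\infty \text{ such that for all } 0<r\le r^{1-\varepsilon}\le R \text{ we have } \sup\{N_r(B(x,R)):x\in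 X\}\le C(R/r)^{\gamma}\},$$ $$\dim_{MA}^{\varepsilon}X=\inf\Big\{\sup_i\dim_A^{\varepsilon}X_i: X=\bigcup_{i=1}^\infty X_i\Big\},\qquad \dim_{MA}X=\sup_{0<\varepsilon<1}\dim_{MA}^{\varepsilon}X=\lim_{\varepsilon\to0+}\dim_{MA}^{\varepsilon}X.$$ Subsets of $\mathbb{R}$ carry the Euclidean metric. *)

(* Defs.v *)
From HB Require Import structures.
From mathcomp Require Import all_boot all_order all_algebra.
From mathcomp Require Import all_classical all_reals all_analysis.

Set Implicit Arguments.
Unset Strict Implicit.
Unset Printing Implicit Defensive.

Import Order.TTheory GRing.Theory Num.Theory.
Import numFieldNormedType.Exports.

Local Open Scope classical_set_scope.
Local Open Scope ring_scope.

(* All dimensions live in \bar R.  A subset X of a metric space T is regarded  *)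
(* as a metric space with the restricted metric: balls are traces on X of the  *)
(* balls of T, and their centres are points of X.                              *)

Definition cball (R : realType) (T : metricType R) (x : T) (r : R) : set T :=
  [set y | mdist x y <= r].

(* Balls of diameter r are those of radius r / 2.  The value is +oo when A has *)
(* no finite cover of this kind.                                               *)
Definition covering_number (R : realType) (T : metricType R)
    (X : set T) (r : R) (A : set T) : \bar R :=
  ereal_inf [set n%:R%:E | n in [set n : nat |
    exists c : 'I_n -> T, (forall i, X (c i)) /\
      A `<=` [set y | exists i, cball (c i) (r / 2) y]]].

(* The constraint r <= r ^ (1 - eps) forces r <= 1.                            *)
Definition assouad_dim_eps (R : realType) (T : metricType R)
    (eps : R) (X : set T) : \bar R :=
  ereal_inf [set g%:E | g in [set g : R | exists C : R, forall r rho : R,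
    0 < r -> r <= r `^ (1 - eps) -> r `^ (1 - eps) <= rho ->
    (ereal_sup [set covering_number X r (X `&` cball x rho) | x in X]
       <= (C * (rho / r) `^ g)%:E)%E]].

Definition mod_assouad_dim_eps (R : realType) (T : metricType R)
    (eps : R) (X : set T) : \bar R :=
  ereal_inf [set ereal_sup (range (fun i => assouad_dim_eps eps (F i))) |
    F in [set F : nat -> set T | X = \bigcup_i F i]].

Definition mod_assouad_dim (R : realType) (T : metricType R)
    (X : set T) : \bar R :=
  ereal_sup [set mod_assouad_dim_eps eps X | eps in [set eps : R | 0 < eps < 1]].

(* limsup, as r tends to 0 from the right, of log N_r(X) / log (1 / r).        *)
Definition upper_minkowski_dim (R : realType) (T : metricType R)
    (X : set T) : \bar R :=
  limf_esup (fun r : R => (lne (covering_number X r X) * ((ln r^-1)^-1)%:E)%E)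
    0^'+.

Definition packing_dim (R : realType) (T : metricType R)
    (X : set T) : \bar R :=
  ereal_inf [set ereal_sup (range (fun i => upper_minkowski_dim (F i))) |
    F in [set F : nat -> set T | X = \bigcup_i F i]].

(* diam set0 is -oo, so empty sets are always admitted in a delta-cover.       *)
Definition diam (R : realType) (T : metricType R) (A : set T) : \bar R :=
  ereal_sup [set (mdist x y)%:E | x in A & y in A].

(* Empty pieces of a cover do not contribute, even for s = 0.                  *)
Definition hausdorff_pre (R : realType) (T : metricType R)
    (s delta : R) (A : set T) : \bar R :=
  ereal_inf [set (\sum_(0 <= i <oo | F i != set0) poweR (diam (F i)) s)%E |
    F in [set F : nat -> set T |
      A `<=` \bigcup_i F i /\ forall i, (diam (F i) <= delta%:E)%E]].

Definition hausdorff_measure (R : realType) (T : metricType R)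
    (s : R) (A : set T) : \bar R :=
  ereal_sup [set hausdorff_pre s delta A | delta in [set delta : R | 0 < delta]].

Definition hausdorff_dim (R : realType) (T : metricType R)
    (A : set T) : \bar R :=
  ereal_inf [set s%:E | s in [set s : R |
    0 <= s /\ hausdorff_measure s A = 0%E]].

(* normal_prob m 0 is not a point mass, so degenerate normal laws are listed   *)
(* separately.                                                                 *)
Definition is_gaussian (d : measure_display) (T : measurableType d)
    (R : realType) (P : probability T R) (X : T -> R) : Prop :=
  exists m : R,
    (forall A : set R, measurable A -> pushforward P X A = \d_m A) \/
    (exists2 s : R, 0 < s &
      forall A : set R, measurable A -> pushforward P X A = normal_prob m s A).

Definition gaussian_process (d : measure_display) (T : measurableType d)
    (R : realType) (P : probability T R) (I : set R) (B : R -> T -> R) : Prop :=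
  forall (n : nat) (t c : 'I_n -> R), (forall i, I (t i)) ->
    is_gaussian P (fun w => \sum_(i < n) c i * B (t i) w).

(* The joint law of the increments from h does not depend on h.                *)
Definition stationary_increments (d : measure_display) (T : measurableType d)
    (R : realType) (P : probability T R) (I : set R) (B : R -> T -> R) : Prop :=
  forall (n : nat) (t : 'I_n -> R) (h k : R), I h -> I k ->
    (forall i, I (h + t i)) -> (forall i, I (k + t i)) ->
    forall A : set (n.-tuple R), measurable A ->
      P [set w | A [tuple B (h + t i) w - B h w | i < n]] =
      P [set w | A [tuple B (k + t i) w - B k w | i < n]].

(* Only the values B t with 0 <= t <= 1 matter.  The covariance formula        *)
(* follows from the other clauses.                                             *)
Record fractional_brownian_motion01 (d : measure_display)
    (T : measurableType d) (R : realType) (P : probability T R)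
    (alpha : R) (B : R -> {RV P >-> R}) : Prop := {
  fbm_gaussian : gaussian_process P `[0, 1] B ;
  fbm_stationary : stationary_increments P `[0, 1] B ;
  fbm_start : {ae P, forall w, B 0 w = 0} ;
  fbm_normal : forall t : R, 0 < t <= 1 ->
    forall A : set R, measurable A ->
      pushforward P (fun w => t `^ (- alpha) * B t w) A = normal_prob 0 1 A ;
  fbm_covariance : forall s t : R, 0 <= s <= 1 -> 0 <= t <= 1 ->
    expectation P (fun w => B t w * B s w) =
      (2^-1 * (`|t| `^ (2 * alpha) + `|s| `^ (2 * alpha)
               - `|t - s| `^ (2 * alpha)))%:E ;
  fbm_continuous :
    {ae P, forall w, {within `[0, 1], continuous (fun t => B t w)}}
}.
Arguments fractional_brownian_motion01 {d T R} P alpha B.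

(* Main.v *)
Require Import Defs.
From HB Require Import structures.
From mathcomp Require Import all_boot all_order all_algebra.
From mathcomp Require Import all_classical all_reals all_analysis.
From mathcomp Require Import measurable_realfun.
From mathcomp Require Import ring lra zify.

Set Implicit Arguments.
Unset Strict Implicit.
Unset Printing Implicit Defensive.

Import Order.TTheory GRing.Theory Num.Theory.
Import numFieldNormedType.Exports.

Local Open Scope classical_set_scope.
Local Open Scope ring_scope.

(** The inequalities [dim B(A) <= dim A / alpha] hold for all [A], because
    almost every path is Hölder continuous with every exponent below [alpha]
    ([fbm_holder_ae]).  The reverse inequalities fail for general [A] when the
    exceptional event may not depend on [A], since [A] could be chosen as a
    level set of the path.  They hold inside [D] because the fibres of the path
    over [D] are uniformly thin: for every [eta > 0], [D] is a countable union
    of pieces [E] such that the part of [E] that the path maps into an interval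
    of length about [2 ^ (- n * alpha)] is covered by [C * 2 ^ (eta * n)] dyadic
    intervals of length [2 ^ (- n)], for all large [n] and for all target
    intervals at once ([sparse_fibres],
    [fbm_sparse_fibres_ae]).  This property of the single set [E] is inherited
    by its subsets, so one almost sure event serves all [A].  Pulling back a
    cover of [B(A)] through the fibres costs a factor [2 ^ (eta * n)] per
    element, and [eta] is arbitrary; this gives the reverse inequalities for
    Hausdorff dimension ([hausdorff_null_fibres]) and, piece by piece, for
    packing dimension ([upper_minkowski_fibres]).

    The thinness of the fibres is a moment estimate.  For cells
    [k_1 > ... > k_p] of length [1 / m], the values [B(k_i / m)] fall together
    into a window of size [1 / M] with probability at most the product of
    [C / (M * ((k_i - k_(i+1)) / m) ^ alpha)], where [k_(p+1) = 0].  Instead of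
    densities the proof uses Fejér kernels, which dominate a multiple of the
    indicator of a window and are finite sums of cosines; every term of the
    expansion is a characteristic function, that is [exp (- variance / 2)].
    The variance of a linear combination of the [B t] is, by the Mandelbrot-van
    Ness representation, a normalised integral of the square of a combination
    of explicit kernels ([mvn_covariance]).  The integral over the slab between
    two consecutive times involves only the later ones, and it is at least a
    constant times the square of the newest coefficient, in the averaged sense
    of [mvn_energy_parallelogram].  Hence the sums of cosines can be evaluated
    one slab at a time ([mvn_energy_sum], [fbm_joint_fejer]).

    Summing these products over chains of cells that meet [E] requires
    [sum (k - k') ^ (- alpha) <= C * 2 ^ (delta' * n)] over the cells [k'] to
    the left of a given cell [k].  That is where the hypothesis on [D] enters:
    a piece with [dim_A ^ delta E < alpha + delta] meets at most
    [C * (L * 2 ^ (n * delta)) ^ (alpha + delta)] of the [L] cells next to a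
    given one, for every [L] ([assouad_hit_count], [hit_weight_sum]).  A moment
    of order at least [4 / delta] then beats the number of windows, and the
    Borel-Cantelli lemma concludes ([fbm_count_bound], [fbm_count_ae]). *)

(** * Integrals against densities and of derivatives *)

Import HBNNSimple.

Lemma ge0_integral_density (R : realType) (nu : {measure set R -> \bar R})
    (f : R -> R) (h : R -> \bar R) :
  measurable_fun setT f -> (forall x, 0 <= f x) ->
  (forall A : set R, measurable A ->
     nu A = (\int[lebesgue_measure]_(x in A) (f x)%:E)%E) ->
  measurable_fun setT h -> (forall x, 0 <= h x)%E ->
  (\int[nu]_x h x = \int[lebesgue_measure]_x (h x * (f x)%:E))%E.
Proof.
move=> mf f0 nuE mh h0.
have mE (g : R -> R) : measurable_fun setT g -> measurable_fun setT (fun x => (g x)%:E).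
  by move=> ?; exact/measurable_EFinP.
have mEf : measurable_fun setT (fun x => (f x)%:E) by exact: mE.
have simple (g : {nnsfun R >-> R}) :
    (\int[nu]_x (g x)%:E = \int[lebesgue_measure]_x ((g x)%:E * (f x)%:E))%E.
  under [LHS]eq_integral do rewrite fimfunE -fsumEFin//.
  rewrite [LHS]ge0_integral_fsum//; last 2 first.
    - by move=> r; apply: mE; exact: measurableT_comp.
    - by move=> n x _; rewrite EFinM nnfun_muleindic_ge0.
  under [RHS]eq_integral.
    move=> x xD; rewrite fimfunE -fsumEFin// muleC ge0_mule_fsumr; last first.
      by move=> r; rewrite EFinM nnfun_muleindic_ge0.
    over.
  rewrite [RHS]ge0_integral_fsum//; last 2 first.
    - move=> r; apply: emeasurable_funM; first exact: mE.
      by apply: mE; do 2 apply/measurableT_comp => //.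
    - move=> n x _; rewrite mule_ge0//; first by rewrite lee_fin.
      by rewrite EFinM nnfun_muleindic_ge0.
  apply: eq_fsbigr => r _.
  rewrite integralZl_indic_nnsfun//=.
  have [->|r0] := eqVneq (g @^-1` [set r]) set0.
    rewrite indic0 integral0 mule0; under eq_integral do rewrite /= mulr0 mule0.
    by rewrite integral0.
  have {}r0 : 0 <= r by move/set0P : r0 => [x /= <-].
  under [RHS]eq_integral do rewrite EFinM muleCA.
  rewrite ge0_integralZl//=; last 2 first.
    - apply: emeasurable_funM; first exact: mE.
      by apply: mE; exact: measurable_indic.
    - by move=> x _; rewrite mule_ge0// lee_fin.
  congr (_ * _)%E.
  rewrite integral_indic// setIT nuE// [LHS]integral_mkcond/=.
  apply: eq_integral => x _; rewrite patchE indicE.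
  by case: ifPn; rewrite ?mule1 ?mule0.
pose f_ := nnsfun_approx measurableT mh.
transitivity (lim (\int[nu]_x (f_ n x)%:E @[n --> \oo])%E).
  rewrite -monotone_convergence//=.
  - apply: eq_integral => ? /[!inE] xD; apply/esym/cvg_lim => //=.
    exact: cvg_nnsfun_approx.
  - by move=> n; exact: mE.
  - by move=> n ? _; rewrite lee_fin.
  - by move=> ? _ ? ? mn; rewrite lee_fin; exact/lefP/nd_nnsfun_approx.
under eq_fun do rewrite simple.
rewrite -monotone_convergence//=.
- apply: eq_integral => x _; apply/cvg_lim => //=.
  apply: cvgeZr => //.
  by apply: cvg_nnsfun_approx => //.
- move=> n; apply: emeasurable_funM; exact: mE.
- by move=> n ? _; rewrite mule_ge0// lee_fin.
- move=> x _ m n mn; rewrite lee_wpmul2r ?lee_fin//.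
  by have /lefP/(_ x) := nd_nnsfun_approx measurableT mh mn.
Qed.

(** The integrals over [[- n, n]] are [G n - G (- n)], and they converge to the
    integral over the line by dominated convergence. *)
Lemma integral_derivative0 (R : realType) (G g : R -> R) :
  (forall x : R, is_derive x (1 : R) G (g x)) -> continuous g ->
  lebesgue_measure.-integrable [set: R] (EFin \o g) ->
  G n%:R @[n --> \oo] --> 0 -> G (- n%:R) @[n --> \oo] --> 0 ->
  (\int[lebesgue_measure]_x (g x)%:E = 0)%E.
Proof.
move=> dG cg ig Gp Gn.
pose I (n : nat) : set R := `[- n%:R, n%:R]%classic.
have H1 : (\int[lebesgue_measure]_x ((EFin \o g) \_ (I n)) x)%E @[n --> \oo] -->
    (\int[lebesgue_measure]_x (g x)%:E)%E.
  have ig' : lebesgue_measure.-integrable [set: R] (fun x => `|g x|%:E).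
    exact: integrable_abse ig.
  have mg (n : nat) : measurable_fun [set: measurableTypeR R] ((EFin \o g) \_ (I n)).
    have mg : measurable_fun [set: measurableTypeR R] (EFin \o g) by case/integrableP : ig.
    apply/(measurable_restrictT _ _).1; first exact: measurable_itv.
    exact: (measurable_funS measurableT _ mg).
  have cvI x : (EFin \o g) \_ (I n) x @[n --> \oo] --> (g x)%:E.
    apply: cvg_near_cst; near=> n.
    rewrite patchE mem_set//; rewrite /I /= in_itv/= -ler_norml.
    near: n; exact: nbhs_infty_ger.
  have dom : forall (n : nat) (x : R), [set: R] x ->
      (`|((EFin \o g) \_ (I n)) x| <= `|g x|%:E)%E.
    move=> n x _; rewrite patchE; case: ifPn => // _.
    by rewrite abse0 lee_fin.
  have fing : forall x : R, [set: R] x -> `|g x|%:E \is a fin_num by [].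
  exact: (dominated_cvg measurableT mg (fun x _ => cvI x) fing ig' dom).
apply: (cvg_unique _ H1) => //.
have -> : (fun n => \int[lebesgue_measure]_x ((EFin \o g) \_ (I n)) x)%E =
   (fun n : nat => (G n%:R - G (- n%:R))%:E).
  apply/funext => n; rewrite -integral_mkcond /I.
  case: n => [|n].
    rewrite oppr0 subrr set_itv1 integral_set1//.
  rewrite (@continuous_FTC2 _ g G) ?EFinB//.
  - by rewrite gtrN// ltr0n.
  - exact: continuous_subspaceT.
  - have dd x : derivable G x 1 by have [] := dG x.
    split => //.
    + apply: cvg_at_right_filter; apply: differentiable_continuous.
      exact/derivable1_diffP.
    + apply: cvg_at_left_filter; apply: differentiable_continuous.
      exact/derivable1_diffP.
  - by move=> x _; rewrite derive1E; apply: derive_val.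
apply: cvg_EFin; first exact: nearW.
rewrite /comp/=.
by rewrite -[X in _ --> X]subr0; exact: cvgB.
Unshelve. all: by end_near. Qed.

(** * Moments of normal laws *)

Lemma normal_pdfEpos (R : realType) (m s x : R) : 0 < s ->
  normal_pdf m s x = normal_peak s * expR (- (x - m) ^+ 2 / (s ^+ 2 *+ 2)).
Proof. by move=> s0; rewrite normal_pdfE// gt_eqF. Qed.

(** Doubling the standard deviation absorbs a quadratic factor, so functions of
    quadratic growth are integrable against the normal density. *)
Lemma normal_pdf_dominated (R : realType) (m s : R) : 0 < s ->
  exists2 C : R, 0 <= C &
   forall x, (1 + (x - m) ^+ 2) * normal_pdf m s x <= C * normal_pdf m (2 * s) x.
Proof.
move=> s0; have s20 : 0 < 2 * s by rewrite mulr_gt0.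
have p0 : 0 < normal_peak (2 * s) by apply: normal_peak_gt0; rewrite gt_eqF.
have ss : 0 < s ^+ 2 by rewrite exprn_gt0.
exists ((1 + (s ^+ 2) *+ 4) * normal_peak s / normal_peak (2 * s)).
  by rewrite divr_ge0 ?normal_peak_ge0// mulr_ge0 ?normal_peak_ge0// addr_ge0// mulrn_wge0// ltW.
move=> x; rewrite !normal_pdfEpos//.
set y := (x - m) ^+ 2.
have y0 : 0 <= y by exact: sqr_ge0.
rewrite [leRHS]mulrA divfK ?gt_eqF// mulrCA (mulrC _ (normal_peak s)) -mulrA.
rewrite ler_wpM2l ?normal_peak_ge0//.
have -> : - y / (s ^+ 2 *+ 2) = - y / ((2 * s) ^+ 2 *+ 2) + - (y * 3 / (s ^+ 2 *+ 8)).
  by field; rewrite gt_eqF.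
rewrite expRD mulrCA [leRHS]mulrC ler_wpM2l ?expR_ge0//.
rewrite expRN ler_pdivrMr ?expR_gt0//.
have := expR_ge1Dx (y * 3 / (s ^+ 2 *+ 8)).
set e := expR _ => he.
apply: (@le_trans _ _ ((1 + s ^+ 2 *+ 4) * (1 + y * 3 / (s ^+ 2 *+ 8)))); last first.
  by rewrite ler_wpM2l// ltW// addr_gt0// ?mulrn_wgt0.
have -> : (1 + s ^+ 2 *+ 4) * (1 + y * 3 / (s ^+ 2 *+ 8)) =
   1 + s ^+ 2 *+ 4 + y * 3 / (s ^+ 2 *+ 8) + y * (3 / 2).
  by field; rewrite gt_eqF.
have : 0 <= y * 3 / (s ^+ 2 *+ 8).
  by apply: divr_ge0; [exact: mulr_ge0 | exact/ltW/mulrn_wgt0].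
lra.
Qed.

Lemma integrableM_normal_pdf (R : realType) (m s K : R) (h : R -> R) : 0 < s ->
  measurable_fun setT h ->
  (forall x, `|h x| <= K * (1 + (x - m) ^+ 2)) ->
  lebesgue_measure.-integrable [set: measurableTypeR R]
    (EFin \o (fun x => h x * normal_pdf m s x)).
Proof.
move=> s0 mh hK.
have [C C0 HC] := normal_pdf_dominated m s0.
have iC : lebesgue_measure.-integrable [set: measurableTypeR R]
    (fun x => (K * C)%:E * (normal_pdf m (2 * s) x)%:E)%E.
  apply: integrableZl => //; exact: integrable_normal_pdf.
apply: (le_integrable measurableT _ _ iC) => //.
  apply/measurable_EFinP; apply: measurable_funM; first exact: mh.
  exact: measurable_normal_pdf.
move=> x _.
rewrite -EFinM !abse_EFin lee_fin [leRHS]ger0_norm; last first.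
  rewrite mulr_ge0 ?normal_pdf_ge0// mulr_ge0//.
  have := le_trans (normr_ge0 _) (hK m).
  by rewrite subrr expr0n addr0 mulr1.
rewrite normrM [X in _ * X]ger0_norm ?normal_pdf_ge0//.
apply: (@le_trans _ _ (K * (1 + (x - m) ^+ 2) * normal_pdf m s x)).
  by rewrite ler_wpM2r ?normal_pdf_ge0.
rewrite -!mulrA ler_wpM2l//.
have := le_trans (normr_ge0 _) (hK m).
by rewrite subrr expr0n addr0 mulr1.
Qed.

Lemma normal_pdf_cvg0 (R : realType) (m s : R) (u : nat -> R) : 0 < s ->
  u n @[n --> \oo] --> +oo \/ u n @[n --> \oo] --> -oo ->
  normal_pdf m s (u n) @[n --> \oo] --> 0.
Proof.
move=> s0 uoo.
have ss : 0 < s ^+ 2 *+ 2 by rewrite mulrn_wgt0// exprn_gt0.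
have H : (u n - m) ^+ 2 @[n --> \oo] --> +oo.
  case: uoo => uoo.
    apply: (cvg_comp (fun n => u n - m) (fun x => x ^+ 2)); last exact: cvgr_expr2.
    by apply: (cvg_comp u (fun x => x - m) uoo); exact: cvg_addrr.
  under eq_fun do rewrite -sqrrN.
  apply: (cvg_comp (fun n => - (u n - m)) (fun x => x ^+ 2)); last exact: cvgr_expr2.
  apply/cvgNry.
  by apply: (cvg_comp u (fun x => x - m) uoo); exact: cvg_addrr_Ny.
have {}H : expR (- ((u n - m) ^+ 2 / (s ^+ 2 *+ 2))) @[n --> \oo] --> 0.
  apply: (cvg_comp (fun n => (u n - m) ^+ 2 / (s ^+ 2 *+ 2)) (fun x => expR (- x))).
    apply: (cvg_comp _ (fun x => x / (s ^+ 2 *+ 2)) H).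
    by apply: gt0_cvgMly; [rewrite invr_gt0|exact: cvg_id].
  exact: cvgr_expR.
have -> : (fun n => normal_pdf m s (u n)) =
    (fun n => normal_peak s * expR (- ((u n - m) ^+ 2 / (s ^+ 2 *+ 2)))).
  by apply/funext => n; rewrite normal_pdfEpos// mulNr.
have {}H := cvgM (cvg_cst (normal_peak s)) H; rewrite mulr0 in H; exact: H.
Qed.

Lemma cvg0_mul_normal_pdf (R : realType) (m s K : R) (h : R -> R) (u : nat -> R) : 0 < s ->
  (forall x, `|h x| <= K * (1 + (x - m) ^+ 2)) ->
  u n @[n --> \oo] --> +oo \/ u n @[n --> \oo] --> -oo ->
  h (u n) * normal_pdf m s (u n) @[n --> \oo] --> 0.
Proof.
move=> s0 hK uoo.
have [C C0 HC] := normal_pdf_dominated m s0.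
have K0 : 0 <= K.
  have := le_trans (normr_ge0 _) (hK m).
  by rewrite subrr expr0n addr0 mulr1.
have H : K * C * normal_pdf m (2 * s) (u n) @[n --> \oo] --> 0.
  have s20 : 0 < 2 * s by rewrite mulr_gt0.
  have H := cvgM (cvg_cst (K * C)) (normal_pdf_cvg0 m s20 uoo).
  by rewrite mulr0 in H; exact: H.
apply: norm_cvg0.
apply: (squeeze_cvgr _ (cvg_cst 0) H) => //.
apply: nearW => n; rewrite normr_ge0/= normrM [X in _ * X]ger0_norm ?normal_pdf_ge0//.
apply: (@le_trans _ _ (K * (1 + (u n - m) ^+ 2) * normal_pdf m s (u n))).
  by rewrite ler_wpM2r ?normal_pdf_ge0.
by rewrite -!mulrA ler_wpM2l.
Qed.

Lemma is_derive_normal_pdf (R : realType) (m s x : R) : 0 < s ->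
  is_derive x (1 : R) (normal_pdf m s) (- ((x - m) / s ^+ 2) * normal_pdf m s x).
Proof.
move=> s0; rewrite normal_pdfE ?gt_eqF//.
apply: is_derive_eq.
rewrite /normal_fun/=.
rewrite /GRing.scale/=.
by field; rewrite gt_eqF.
Qed.

(** The primitive [H * normal_pdf] vanishes at infinity: this one statement
    gives the mean, the variance and the differential equation of the
    characteristic function. *)
Lemma integralM_normal_pdf_eq0 (R : realType) (m s K : R) (H h : R -> R) : 0 < s ->
  (forall x : R, is_derive x (1 : R) (fun x => H x * normal_pdf m s x)
     (h x * normal_pdf m s x)) ->
  continuous h ->
  (forall x, `|H x| <= K * (1 + (x - m) ^+ 2)) ->
  (forall x, `|h x| <= K * (1 + (x - m) ^+ 2)) ->
  (\int[lebesgue_measure]_x (h x * normal_pdf m s x)%:E = 0)%E.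
Proof.
move=> s0 dH ch HK hK.
apply: (integral_derivative0 dH).
- move=> x; apply: cvgM; first exact: ch.
  by apply: continuous_normal_pdf; rewrite gt_eqF.
- apply: integrableM_normal_pdf hK => //.
  exact: continuous_measurable_fun.
- by apply: cvg0_mul_normal_pdf HK _ => //; left; exact: cvgr_idn.
- apply: cvg0_mul_normal_pdf HK _ => //; right.
  by apply/cvgNrNy; exact: cvgr_idn.
Qed.

Lemma ler_norm_1Dsqr (R : realType) (y : R) : `|y| <= 1 + y ^+ 2.
Proof. by rewrite -(real_normK (num_real y)); have := normr_ge0 y; nra. Qed.

Lemma normal_mean (R : realType) (m s : R) : 0 < s ->
  (\int[lebesgue_measure]_x ((x - m) * normal_pdf m s x)%:E = 0)%E.
Proof.
move=> s0.
apply: (@integralM_normal_pdf_eq0 _ _ _ (1 + s ^+ 2) (fun _ => - s ^+ 2)) => //.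
- move=> x; have d := is_derive_normal_pdf m x s0.
  apply: is_derive_eq; rewrite /GRing.scale/= /cst.
  by field; rewrite gt_eqF.
- by move=> x; apply: cvgB; [exact: cvg_id|exact: cvg_cst].
- move=> x; have := sqr_ge0 s; have := sqr_ge0 (x - m) => h1 h2.
  by rewrite normrN ger0_norm//; nra.
- move=> x; apply: (le_trans (ler_norm_1Dsqr _)).
  have := sqr_ge0 s; have := sqr_ge0 (x - m); nra.
Qed.

Lemma normal_variance (R : realType) (m s : R) : 0 < s ->
  (\int[lebesgue_measure]_x (((x - m) ^+ 2 - s ^+ 2) * normal_pdf m s x)%:E = 0)%E.
Proof.
move=> s0.
apply: (@integralM_normal_pdf_eq0 _ _ _ (1 + s ^+ 2) (fun x => - s ^+ 2 * (x - m))) => //.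
- move=> x; have d := is_derive_normal_pdf m x s0.
  apply: is_derive_eq; rewrite /GRing.scale/= /cst.
  by field; rewrite gt_eqF.
- move=> x; apply: cvgB; last exact: cvg_cst.
  apply: (cvg_comp (fun x => x - m) (fun z => z ^+ 2)).
    by apply: cvgB; [exact: cvg_id|exact: cvg_cst].
  exact: exprn_continuous.
- move=> x; have h1 := sqr_ge0 s; have h2 := sqr_ge0 (x - m).
  rewrite normrM normrN (ger0_norm h1); have := ler_wpM2l h1 (ler_norm_1Dsqr (x - m)); nra.
- move=> x; apply: (le_trans (ler_normB _ _)); rewrite !ger0_norm ?sqr_ge0//.
  have := sqr_ge0 s; have := sqr_ge0 (x - m); nra.
Qed.

(** * The characteristic function of a normal law *)

Lemma is_derive_affine (R : realType) (a b c x : R) :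
  is_derive x (1 : R) (fun x => a * (x - b) + c) a.
Proof. by apply: is_derive_eq; rewrite /GRing.scale/=; ring. Qed.

Lemma continuous_affine (R : realType) (a b c : R) :
  continuous (fun x : R => a * (x - b) + c).
Proof.
move=> x; apply: cvgD; last exact: cvg_cst.
by apply: cvgM; [exact: cvg_cst|apply: cvgB; [exact: cvg_id|exact: cvg_cst]].
Qed.

Lemma primitive_growth_le (R : realType) (k b y t S : R) : 0 <= k -> 0 <= b -> 0 <= y ->
  0 <= t -> S <= 1 -> t * k * S <= k * (1 + t * (1 + b)) * (1 + y).
Proof.
move=> k0 b0 y0 t0 S1; rewrite (_ : t * k * S = k * (t * S)); last by ring.
rewrite -mulrA; apply: ler_wpM2l => //.
have tS : t * S <= t by rewrite ler_piMr.
have := mulr_ge0 t0 b0; have := mulr_ge0 t0 y0; have := mulr_ge0 (mulr_ge0 t0 b0) y0; nra.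
Qed.

Lemma integrand_growth_le (R : realType) (b y z t S C : R) : 0 <= b -> 0 <= y -> 0 <= z -> z <= 1 + y ->
  0 <= t -> S <= 1 -> C <= 1 -> t * b * C + z * S <= (1 + t * (1 + b)) * (1 + y).
Proof.
move=> b0 y0 z0 zy t0 S1 C1.
apply: (@le_trans _ _ (t * b + (1 + y))).
  apply: lerD; first by rewrite ler_piMr// mulr_ge0.
  by apply: le_trans zy; rewrite ler_piMr.
have := mulr_ge0 t0 b0; have := mulr_ge0 t0 y0; have := mulr_ge0 (mulr_ge0 t0 b0) y0; nra.
Qed.

(** The integrand is the [x]-derivative of
    [s ^ 2 * k * sin (a * (x - m) + c) * normal_pdf m s x], with [k] the
    exponential.  It is also the [a]-derivative of
    [k * cos (a * (x - m) + c) * normal_pdf m s x], whose integral is therefore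
    constant in [a]. *)
Lemma normal_charfun_derive (R : realType) (m s c a : R) : 0 < s ->
  (\int[lebesgue_measure]_x ((expR (s ^+ 2 * a ^+ 2 / 2) *
     (s ^+ 2 * a * cos (a * (x - m) + c) - (x - m) * sin (a * (x - m) + c)))
     * normal_pdf m s x)%:E = 0)%E.
Proof.
move=> s0.
set k := expR (s ^+ 2 * a ^+ 2 / 2).
have k0 : 0 <= k by exact: expR_ge0.
pose l x := a * (x - m) + c.
have cl : continuous l by exact: continuous_affine.
apply: (@integralM_normal_pdf_eq0 _ _ _ (k * (1 + s ^+ 2 * (1 + `|a|)))
  (fun x => s ^+ 2 * k * sin (l x))).
- exact: s0.
- move=> x; have d := is_derive_normal_pdf m x s0.
  have dl : is_derive x (1 : R) l a by exact: is_derive_affine.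
  have ds := @is_derive1_comp _ sin l x _ _ (is_derive_sin (l x)) dl.
  have dz := is_deriveZ (s ^+ 2 * k) (is_deriveM ds d).
  have -> : (fun x => s ^+ 2 * k * sin (l x) * normal_pdf m s x) =
      (s ^+ 2 * k) \*: ((sin \o l) * normal_pdf m s).
    by apply/funext => y /=; rewrite -mulrA.
  apply: (is_derive_eq dz).
  rewrite /GRing.scale/= -/(l x); move: (sin (l x)) (cos (l x)) (normal_pdf m s x) => S C p.
  by field; rewrite gt_eqF.
- move=> x; apply: cvgM; first exact: cvg_cst.
  apply: cvgB; apply: cvgM.
  + exact: cvg_cst.
  + by apply: (continuous_comp (cl x)); exact: continuous_cos.
  + by apply: cvgB; [exact: cvg_id|exact: cvg_cst].
  + by apply: (continuous_comp (cl x)); exact: continuous_sin.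
- move=> x; rewrite normrM (normrM (s ^+ 2)) (ger0_norm (sqr_ge0 s)) (ger0_norm k0).
  apply: primitive_growth_le => //; try exact: sqr_ge0; exact: sin_max.
- move=> x; rewrite -/(l x) normrM (ger0_norm k0) -[leRHS]mulrA.
  apply: ler_wpM2l => //.
  apply: (le_trans (ler_normB _ _)); rewrite normrM (normrM (s ^+ 2)) (normrM (x - m)) (ger0_norm (sqr_ge0 s)).
  apply: integrand_growth_le => //; try exact: sqr_ge0; first exact: ler_norm_1Dsqr.
    exact: sin_max.
  exact: cos_max.
Qed.

(** The integral of
    [exp (s ^ 2 * a ^ 2 / 2) * cos (a * (x - m) + m + c) * normal_pdf m s x]
    does not depend on [a], by [normal_charfun_derive]; compare [a = 0] with
    [a = 1]. *)
Lemma normal_charfun (R : realType) (m s c : R) : 0 < s ->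
  \int[lebesgue_measure]_x (cos (x + c) * normal_pdf m s x) =
  expR (- s ^+ 2 / 2) * cos (m + c).
Proof.
move=> s0.
have s20 := sqr_ge0 s.
pose c' := m + c.
pose f a x : R := expR (s ^+ 2 * a ^+ 2 / 2) * cos (a * (x - m) + c') * normal_pdf m s x.
pose F a := \int[lebesgue_measure]_(x in [set: measurableTypeR R]) f a x.
have cosm a : measurable_fun [set: R] (fun x : R => cos (a * (x - m) + c')).
  apply: continuous_measurable_fun => x.
  by apply: (continuous_comp (@continuous_affine R a m c' x)); exact: continuous_cos.
have df (a x : R) : is_derive a (1 : R) (f ^~ x)
   ((expR (s ^+ 2 * a ^+ 2 / 2) *
     (s ^+ 2 * a * cos (a * (x - m) + c') - (x - m) * sin (a * (x - m) + c')))
     * normal_pdf m s x).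
  pose q (a : R) := s ^+ 2 * a ^+ 2 / 2.
  pose l (a : R) := a * (x - m) + c'.
  have dq : is_derive a (1 : R) q (s ^+ 2 * a).
    by apply: is_derive_eq; rewrite /GRing.scale/=; field.
  have dl : is_derive a (1 : R) l (x - m).
    by apply: is_derive_eq; rewrite /GRing.scale/=; ring.
  have de := @is_derive1_comp _ expR q a _ _ (is_derive_expR (q a)) dq.
  have dc := @is_derive1_comp _ cos l a _ _ (is_derive_cos (l a)) dl.
  have dz := is_deriveZ (normal_pdf m s x) (is_deriveM de dc).
  have -> : f ^~ x = normal_pdf m s x \*: ((expR \o q) * (cos \o l)).
    by apply/funext => b /=; rewrite /f mulrC.
  apply: (is_derive_eq dz); rewrite /GRing.scale/= -/(q a) -/(l a).
  move: (sin _) (cos _) (normal_pdf m s x) (expR _) => S C p e.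
  by ring.
have q0 (x : R) : 0 <= 1 + (x - m) ^+ 2 by rewrite addr_ge0 ?sqr_ge0.
have dF (a : R) : is_derive a (1 : R) F 0.
  (* Differentiation under the integral needs a dominating function that is
     uniform for parameters near [a]. *)
  pose u := a - 1; pose v := a + 1.
  have Ia : `]u, v[%classic a by rewrite /= in_itv/= /u /v; lra.
  pose K := expR (s ^+ 2 * (1 + `|a|) ^+ 2 / 2) * (1 + s ^+ 2 * (1 + (1 + `|a|))).
  have K0 : 0 <= K.
    by rewrite mulr_ge0 ?expR_ge0// addr_ge0// mulr_ge0// !addr_ge0.
  have If (b : R) : `]u, v[%classic b ->
      lebesgue_measure.-integrable [set: measurableTypeR R] (EFin \o f b).
    move=> _; apply: (@integrableM_normal_pdf _ m s (expR (s ^+ 2 * b ^+ 2 / 2))) => //.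
      by apply: measurable_funM => //; exact: cosm.
    move=> x; rewrite normrM ger0_norm ?expR_ge0// ler_wpM2l ?expR_ge0//.
    by apply: (le_trans (cos_max _)); rewrite lerDl sqr_ge0.
  have Df (b x : R) : `]u, v[%classic b -> [set: measurableTypeR R] x ->
      derivable (f ^~ x) b 1 by move=> _ _; have [] := df b x.
  pose G x := K * (1 + (x - m) ^+ 2) * normal_pdf m s x.
  have G0 x : 0 <= G x.
    by apply: mulr_ge0; [exact: mulr_ge0|exact: normal_pdf_ge0].
  have IG : lebesgue_measure.-integrable [set: measurableTypeR R] (EFin \o G).
    apply: (@integrableM_normal_pdf _ m s K) => //.
      apply: measurable_funM => //; apply: measurable_funD => //.
      by apply: measurable_funX; exact: measurable_funB.
    by move=> x; rewrite ger0_norm//; exact: mulr_ge0.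
  have GU (b x : R) : `]u, v[%classic b -> [set: measurableTypeR R] x ->
      `|partial1of2 f b x| <= G x.
    rewrite /= in_itv/= => /andP[ub bv] _.
    have ba : `|b| <= 1 + `|a|.
      rewrite -(subrK a b) (le_trans (ler_normD _ _))// lerD2r.
      by rewrite ler_norml; move: ub bv; rewrite /u /v; lra.
    rewrite partial1of2E (@derive_val _ _ _ _ _ _ _ (df b x)).
    rewrite normrM (ger0_norm (normal_pdf_ge0 _ _ _)) /G.
    apply: ler_wpM2r; first exact: normal_pdf_ge0.
    rewrite normrM ger0_norm ?expR_ge0// /K -[leRHS]mulrA.
    apply: ler_pM; rewrite ?expR_ge0//.
      rewrite ler_expR ler_pM2r// ler_wpM2l// -(real_normK (num_real b)).
      by rewrite lerXn2r ?nnegrE ?addr_ge0.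
    apply: (le_trans (ler_normB _ _)).
    rewrite normrM (normrM (s ^+ 2)) (normrM (x - m)) (ger0_norm (sqr_ge0 s)).
    apply: (@le_trans _ _ ((1 + s ^+ 2 * (1 + `|b|)) * (1 + (x - m) ^+ 2))).
      apply: integrand_growth_le => //; try exact: sqr_ge0; first exact: ler_norm_1Dsqr.
        exact: sin_max.
      exact: cos_max.
    apply: ler_wpM2r; first by rewrite addr_ge0 ?sqr_ge0.
    by rewrite lerD2l ler_wpM2l// lerD2l.
  have [dF F'] := (derivable_under_integral measurableT Ia If Df G0 IG GU,
    differentiation_under_integral measurableT Ia If Df G0 IG GU).
  apply: DeriveDef; first exact: dF.
  rewrite -derive1E; rewrite [LHS]F'.
  rewrite /Rintegral; under eq_integral => x _.
    rewrite partial1of2E (@derive_val _ _ _ _ _ _ _ (df a x)); over.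
  by rewrite normal_charfun_derive.
have F01 := is_derive_0_is_cst 0 1 dF.
have : F 0 = cos c'.
  rewrite /F /f; under eq_Rintegral => x _ do
    rewrite expr0n/= mulr0 mul0r expR0 mul1r mul0r add0r.
  rewrite RintegralZl//; last exact: integrable_normal_pdf.
  by rewrite /Rintegral integral_normal_pdf mulr1.
rewrite F01 /F /f => H.
rewrite -/c' -H.
under [in RHS]eq_Rintegral => x _ do rewrite -mulrA.
rewrite RintegralZl//; last first.
  apply: (@integrableM_normal_pdf _ m s 1 (fun x => cos (1 * (x - m) + c'))) => //.
  move=> x; have := cos_max (1 * (x - m) + c'); have := sqr_ge0 (x - m).
  by rewrite mul1r => h1 h2; apply: (le_trans h2); rewrite mul1r lerDl.
rewrite mulrA -expRD expr1n mulr1 -mulrDl addNr mul0r expR0 mul1r.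
apply: eq_Rintegral => x _; congr (cos _ * _).
by rewrite /c' mul1r; ring.
Qed.

(** * Laws of Gaussian variables and their tails *)

Lemma ge0_gaussian_law d (T : measurableType d) (R : realType) (P : probability T R)
    (Z : T -> R) (m s : R) (h : R -> R) :
  measurable_fun setT Z ->
  (forall A : set R, measurable A -> pushforward P Z A = normal_prob m s A) ->
  measurable_fun setT h -> (forall x, 0 <= h x) ->
  (\int[P]_w (h (Z w))%:E = \int[lebesgue_measure]_x (h x * normal_pdf m s x)%:E)%E.
Proof.
move=> mZ lawZ mh h0.
have mh' : measurable_fun [set: R] (EFin \o h) by exact/measurable_EFinP.
have := ge0_integral_pushforward mZ P (@measurableT _ R) mh' (fun x _ => h0 x).
rewrite preimage_setT => <-.
rewrite (@ge0_integral_density R _ (normal_pdf m s)) //.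
- exact: measurable_normal_pdf.
- by move=> x; exact: normal_pdf_ge0.
Qed.

Lemma gaussian_law_integrable d (T : measurableType d) (R : realType) (P : probability T R)
    (Z : T -> R) (m s K : R) (h : R -> R) : 0 < s ->
  measurable_fun setT Z ->
  (forall A : set R, measurable A -> pushforward P Z A = normal_prob m s A) ->
  measurable_fun setT h -> (forall x, `|h x| <= K * (1 + (x - m) ^+ 2)) ->
  P.-integrable setT (EFin \o (h \o Z)) /\
  \int[P]_w h (Z w) = \int[lebesgue_measure]_x (h x * normal_pdf m s x).
Proof.
move=> s0 mZ lawZ mh hK.
pose g x := K * (1 + (x - m) ^+ 2).
have g0 x : 0 <= g x by exact: le_trans (hK x).
have mg : measurable_fun setT g.
  apply: measurable_funM => //; apply: measurable_funD => //.
  by apply: measurable_funX; exact: measurable_funB.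
pose hp x := h x + g x.
have hp0 x : 0 <= hp x.
  by have := hK x; rewrite ler_norml -/(g x) => /andP[+ _]; rewrite /hp -subr_ge0 opprK.
have mhp : measurable_fun setT hp by exact: measurable_funD.
have ig0 : lebesgue_measure.-integrable [set: measurableTypeR R]
    (EFin \o (fun x => g x * normal_pdf m s x)).
  by apply: (@integrableM_normal_pdf _ m s K) => // x; rewrite ger0_norm.
have ihp0 : lebesgue_measure.-integrable [set: measurableTypeR R]
    (EFin \o (fun x => hp x * normal_pdf m s x)).
  apply: (@integrableM_normal_pdf _ m s (K + K)) => // x.
  rewrite mulrDl (le_trans (ler_normD _ _))// lerD//.
  by rewrite ger0_norm.
have Eg := ge0_gaussian_law mZ lawZ mg g0.
have Ehp := ge0_gaussian_law mZ lawZ mhp hp0.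
have ge0_int (f : R -> R) : measurable_fun setT f -> (forall x, 0 <= f x) ->
    lebesgue_measure.-integrable [set: measurableTypeR R]
      (EFin \o (fun x => f x * normal_pdf m s x)) ->
    P.-integrable setT (EFin \o (f \o Z)).
  move=> mf f0 /integrableP[_ fi].
  apply/integrableP; split.
    by apply/measurable_EFinP; exact: measurableT_comp.
  rewrite (eq_integral (fun w => (f (Z w))%:E)); last first.
    by move=> w _ /=; rewrite ger0_norm.
  rewrite (ge0_gaussian_law mZ lawZ mf f0).
  apply: le_lt_trans fi; apply: ge0_le_integral => //.
  - by move=> x _; rewrite lee_fin mulr_ge0// normal_pdf_ge0.
  - apply/measurable_EFinP/measurable_funM => //; exact: measurable_normal_pdf.
  - apply: measurableT_comp => //.
    apply/measurable_EFinP/measurable_funM => //; exact: measurable_normal_pdf.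
  - by move=> x _; rewrite lee_fin ler_norm.
have ig := ge0_int _ mg g0 ig0.
have ihp := ge0_int _ mhp hp0 ihp0.
have ih : P.-integrable setT (EFin \o (h \o Z)).
  have -> : EFin \o (h \o Z) = (fun w => (EFin \o (hp \o Z)) w - (EFin \o (g \o Z)) w)%E.
    by apply/funext => w /=; rewrite -EFinB /hp addrK.
  exact: integrableB.
split=> //.
have ih0 : lebesgue_measure.-integrable [set: measurableTypeR R]
    (EFin \o (fun x => h x * normal_pdf m s x)).
  exact: (@integrableM_normal_pdf _ m s K).
apply: (@addIr _ (\int[P]_w g (Z w))).
rewrite -RintegralD//.
have Eg' : \int[P]_w g (Z w) = \int[lebesgue_measure]_x (g x * normal_pdf m s x).
  by rewrite /Rintegral Eg.
rewrite [X in _ = _ + X]Eg' -RintegralD//.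
rewrite /Rintegral; congr fine; rewrite Ehp; apply: eq_integral => x _ /=.
by rewrite -mulrDl.
Qed.

Lemma Rintegral_probability_cst d (T : measurableType d) (R : realType)
    (P : probability T R) (c : R) : \int[P]_w c = c.
Proof.
rewrite Rintegral_cst//; transitivity (c * fine 1%E); last by rewrite mulr1.
by congr (c * fine _); exact: probability_setT.
Qed.

(** The parameters of the law are recovered from the moments, which is how the
    law of a linear combination of the process is identified. *)
Lemma gaussian_law_mean_variance d (T : measurableType d) (R : realType) (P : probability T R)
    (Z : T -> R) (m s : R) : 0 < s ->
  measurable_fun setT Z ->
  (forall A : set R, measurable A -> pushforward P Z A = normal_prob m s A) ->
  \int[P]_w Z w = m /\ \int[P]_w (Z w - m) ^+ 2 = s ^+ 2.
Proof.
move=> s0 mZ lawZ.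
have m1 : measurable_fun setT (fun x : R => x - m) by exact: measurable_funB.
have m2 : measurable_fun setT (fun x : R => (x - m) ^+ 2) by exact: measurable_funX.
have m3 : measurable_fun setT (fun x : R => (x - m) ^+ 2 - s ^+ 2) by exact: measurable_funB.
have cstI c : P.-integrable setT (EFin \o (fun _ => c)).
  exact: finite_measure_integrable_cst.
split.
  have b1 x : `|x - m| <= 1 * (1 + (x - m) ^+ 2) by rewrite mul1r ler_norm_1Dsqr.
  have [i1 e1] := gaussian_law_integrable s0 mZ lawZ m1 b1.
  move: e1; rewrite [RHS]/Rintegral normal_mean//= => e1.
  have <- : \int[P]_w ((Z w - m) + m) = \int[P]_w Z w.
    by apply: eq_Rintegral => w _; rewrite subrK.
  by rewrite RintegralD// e1 Rintegral_probability_cst add0r.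
have b3 x : `|(x - m) ^+ 2 - s ^+ 2| <= (1 + s ^+ 2) * (1 + (x - m) ^+ 2).
  apply: (le_trans (ler_normB _ _)); rewrite !ger0_norm ?sqr_ge0//.
  have := sqr_ge0 s; have := sqr_ge0 (x - m); nra.
have [i3 e3] := gaussian_law_integrable s0 mZ lawZ m3 b3.
move: e3; rewrite [RHS]/Rintegral normal_variance//= => e3.
have <- : \int[P]_w (((Z w - m) ^+ 2 - s ^+ 2) + s ^+ 2) = \int[P]_w (Z w - m) ^+ 2.
  by apply: eq_Rintegral => w _; rewrite subrK.
by rewrite RintegralD// e3 Rintegral_probability_cst add0r.
Qed.

Lemma dirac_law_Rintegral d (T : measurableType d) (R : realType) (P : probability T R)
    (Z : T -> R) (m : R) (h : R -> R) :
  measurable_fun setT Z ->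
  (forall A : set R, measurable A -> pushforward P Z A = \d_m A) ->
  measurable_fun setT h -> \int[P]_w h (Z w) = h m.
Proof.
move=> mZ lawZ mh.
have Z0 : P [set w | Z w != m] = 0%E.
  have -> : [set w | Z w != m] = Z @^-1` (~` [set m]).
    by apply/seteqP; split => w /= /eqP.
  have := lawZ (~` [set m]) (measurableC (measurable_set1 m)).
  by rewrite /pushforward => ->; rewrite diracE memNset//= => /(_ erefl).
rewrite -[RHS](Rintegral_probability_cst P) /Rintegral; congr fine.
apply: ae_eq_integral => //.
- by apply/measurable_EFinP; exact: measurableT_comp.
- exists [set w | Z w != m]; split => //.
    have -> : [set w | Z w != m] = Z @^-1` (~` [set m]).
      by apply/seteqP; split => w /= /eqP.
    by rewrite -[X in measurable X]setTI; apply: mZ => //; exact: measurableC (measurable_set1 m).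
  move=> w /= H; apply/eqP => Zm; apply: H => _ /=; by rewrite Zm.
Qed.

Lemma continuous_cosD (R : realType) (c : R) : continuous (fun x => cos (x + c)).
Proof.
move=> x; apply: (cvg_comp (fun x => x + c) cos); last exact: continuous_cos.
by apply: cvgD; [exact: cvg_id|exact: cvg_cst].
Qed.

(** The inequality form covers the point masses as well: for the mass at [0] the
    variance vanishes and the right side is [1]. *)
Lemma gaussian_charfun_le d (T : measurableType d) (R : realType) (P : probability T R)
    (Z : T -> R) (c : R) :
  measurable_fun setT Z -> is_gaussian P Z -> \int[P]_w Z w = 0 ->
  \int[P]_w cos (Z w + c) <= expR (- (\int[P]_w (Z w) ^+ 2) / 2).
Proof.
move=> mZ [m [lawZ|[s s0 lawZ]]] EZ.
  have m0 : m = 0 by rewrite -EZ (dirac_law_Rintegral (h := id) mZ lawZ).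
  rewrite (dirac_law_Rintegral (h := fun x => x ^+ 2) mZ lawZ)//.
  rewrite (dirac_law_Rintegral (h := fun x => cos (x + c)) mZ lawZ); last first.
    exact: continuous_measurable_fun (@continuous_cosD _ c).
  by rewrite m0 expr0n/= oppr0 mul0r expR0 cos_le1.
have [Em Ev] := gaussian_law_mean_variance s0 mZ lawZ.
have m0 : m = 0 by rewrite -Em EZ.
have -> : \int[P]_w (Z w) ^+ 2 = s ^+ 2.
  by rewrite -Ev; apply: eq_Rintegral => w _; rewrite m0 subr0.
have mc : measurable_fun [set: R] (fun x : R => cos (x + c)).
  exact: continuous_measurable_fun (@continuous_cosD _ c).
have bc x : `|cos (x + c)| <= 1 * (1 + (x - m) ^+ 2).
  by rewrite mul1r (le_trans (cos_max _))// lerDl sqr_ge0.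
have [_ ->] := gaussian_law_integrable s0 mZ lawZ mc bc.
by rewrite normal_charfun// ler_piMr ?expR_ge0 ?cos_le1.
Qed.

Lemma measurable_norm_gt (R : realType) (x : R) : measurable [set y : R | x < `|y|].
Proof.
have -> : [set y : R | x < `|y|] = (@Num.norm R R) @^-1` `]x, +oo[.
  by apply/seteqP; split => y /=; rewrite in_itv/= andbT.
rewrite -[X in measurable X]setTI; apply: normr_measurable => //.
Qed.

(** On [x < |y|], the density with variance [s ^ 2] is at most
    [2 * exp (- x ^ 2 / (4 * s ^ 2))] times the density with variance
    [2 * s ^ 2], which has total mass [1]. *)
Lemma normal_tail (R : realType) (s x : R) : 0 < s -> 0 <= x ->
  (normal_prob 0 s [set y : R | (x < `|y|)%R] <=
   (2 * expR (- (x ^+ 2 / (s ^+ 2 *+ 4))))%:E)%E.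
Proof.
move=> s0 x0.
pose s' := s * Num.sqrt 2.
have sq2 : 0 < Num.sqrt 2 :> R by rewrite sqrtr_gt0.
have s'0 : 0 < s' by rewrite mulr_gt0.
have s'2 : s' ^+ 2 = s ^+ 2 *+ 2 by rewrite exprMn sqr_sqrtr// mulr_natr.
have ss0 : 0 < s ^+ 2 by rewrite exprn_gt0.
pose D := [set y : R | x < `|y|].
have mD : measurable (D : set (measurableTypeR R)) by exact: measurable_norm_gt.
have mpdf t : measurable_fun [set: measurableTypeR R] (fun y => (normal_pdf 0 t y)%:E).
  by apply/measurable_EFinP; exact: measurable_normal_pdf.
set k := 2 * _.
have k0 : 0 <= k by rewrite mulr_ge0// expR_ge0.
have le1 : (\int[lebesgue_measure]_(y in D) (normal_pdf 0 s' y)%:E <= 1)%E.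
  have <- := @integral_normal_pdf R 0 s'.
  apply: ge0_subset_integral => //.
  - by move=> y _; rewrite lee_fin normal_pdf_ge0.
apply: (@le_trans _ _ (\int[lebesgue_measure]_(y in D) (k%:E * (normal_pdf 0 s' y)%:E))%E).
  apply: ge0_le_integral => //.
  - by move=> y _; rewrite lee_fin normal_pdf_ge0.
  - exact: measurable_funS (mpdf _).
  - apply: (@measurable_funS _ _ _ _ setT) => //; exact: measurable_funeM.
  - move=> y /= xy; rewrite -EFinM lee_fin !normal_pdfEpos// subr0.
    have peak : normal_peak s <= 2 * normal_peak s'.
      rewrite /normal_peak s'2 ler_pdivlMr ?sqrtr_gt0 ?mulrn_wgt0 ?mulr_gt0 ?pi_gt0 ?mulrn_wgt0//.
      rewrite mulrC ler_pdivrMr ?sqrtr_gt0 ?mulrn_wgt0 ?mulr_gt0 ?pi_gt0//.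
      rewrite mulrnAl -mulr_natl sqrtrM// ler_wpM2r ?sqrtr_ge0//.
      rewrite -[leRHS]ger0_norm// -sqrtr_sqr ler_sqrt ?expr2//; lra.
    rewrite mulrA (mulrAC _ _ (normal_peak s')) -[leRHS]mulrA.
    apply: ler_pM => //; rewrite ?normal_peak_ge0 ?expR_ge0//.
    rewrite -expRD ler_expR s'2 mulNr.
    have -> : - y ^+ 2 / (s ^+ 2 *+ 2 *+ 2) = - (y ^+ 2 / (s ^+ 2 *+ 4)).
      by rewrite mulNr -mulrnA.
    rewrite -opprD lerN2 -mulrDl ler_pdivrMr ?mulrn_wgt0//.
    have -> : y ^+ 2 / (s ^+ 2 *+ 2) * (s ^+ 2 *+ 4) = y ^+ 2 *+ 2.
      by field; rewrite gt_eqF.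
    by rewrite mulr2n lerD2r -(real_normK (num_real y)) lerXn2r ?nnegrE// ltW.
have := @ge0_integralZl _ _ R lebesgue_measure D mD (fun y => (normal_pdf 0 s' y)%:E)
  (measurable_funS measurableT (@subsetT _ D) (mpdf s')) k%:E
  (fun y _ => normal_pdf_ge0 0 s' y) k0.
by move=> ->; rewrite -[leRHS]mule1 lee_wpmul2l.
Qed.

Lemma gaussian_tail d (T : measurableType d) (R : realType) (P : probability T R)
    (Z : T -> R) (v x : R) :
  measurable_fun setT Z -> is_gaussian P Z -> \int[P]_w Z w = 0 ->
  \int[P]_w (Z w) ^+ 2 = v -> 0 < v -> 0 <= x ->
  (P [set w | (x < `|Z w|)%R] <= (2 * expR (- (x ^+ 2 / (v *+ 4))))%:E)%E.
Proof.
move=> mZ [m [lawZ|[s s0 lawZ]]] EZ EZ2 v0 x0.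
  have m0 : m = 0 by rewrite -EZ (dirac_law_Rintegral (h := id) mZ lawZ).
  move: v0; rewrite -EZ2 (dirac_law_Rintegral (h := fun x => x ^+ 2) mZ lawZ)//.
  by rewrite m0 expr0n/= ltxx.
have [Em Ev] := gaussian_law_mean_variance s0 mZ lawZ.
have m0 : m = 0 by rewrite -Em EZ.
have -> : v = s ^+ 2.
  by rewrite -Ev -EZ2; apply: eq_Rintegral => w _; rewrite m0 subr0.
have := lawZ _ (measurable_norm_gt x); rewrite m0 /pushforward /preimage/= => ->.
exact: normal_tail.
Qed.

(** * Changes of variable and power integrals *)

Lemma ge0_integral_affine (R : realType) (u h : R) (g : measurableTypeR R -> \bar R) :
  0 < h -> measurable_fun [set: measurableTypeR R] g -> (forall s, (0 <= g s)%E) ->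
  (\int[lebesgue_measure]_s g s = h%:E * \int[lebesgue_measure]_s g (u + h * s)%R)%E.
Proof.
move=> h0 mg g0.
pose phi (s : measurableTypeR R) : measurableTypeR R := u + h * s.
have mphi : measurable_fun [set: measurableTypeR R] phi.
  have m : measurable_fun [set: R] (fun s : R => u + h * s).
    by apply: measurable_funD => //; exact: measurable_funM.
  exact: m.
pose hn : {nonneg R} := NngNum (ltW h0).
pose nu : {measure set (measurableTypeR R) -> \bar R} := pushforward lebesgue_measure phi.
pose mu2 : {measure set (measurableTypeR R) -> \bar R} := mscale hn (nu mphi).
have E : forall A, measurable A -> lebesgue_measure A = mu2 A.
  apply: lebesgue_measure_unique => X [[a b] /= _ <-].
  rewrite /mu2 /mscale/= /nu /pushforward.
  have -> : phi @^-1` `]a, b] = `](a - u) / h, (b - u) / h]%classic.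
    apply/seteqP; split => s; rewrite /phi/= !in_itv/= => /andP[].
      move=> s1 s2; rewrite ltr_pdivrMr// ler_pdivlMr// (mulrC s).
      by rewrite ltrBlDl s1 lerBrDl.
    rewrite ltr_pdivrMr// ler_pdivlMr// (mulrC s) ltrBlDl lerBrDl => -> ->//.
  rewrite !lebesgue_measure_itv/= !lte_fin ltr_pM2r ?invr_gt0// ltrD2r.
  case: ifPn => ab; last by rewrite mule0.
  rewrite -!EFinB -EFinM; congr EFin.
  by field; rewrite gt_eqF.
rewrite (eq_measure_integral mu2); last by move=> A mA _; exact: E.
rewrite /mu2 ge0_integral_mscale//; congr (_ * _)%E.
by rewrite /nu ge0_integral_pushforward.
Qed.

Lemma integral_powR_le (R : realType) (q a b : R) : q != -1 -> 0 < a -> a <= b ->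
  (\int[lebesgue_measure]_(s in `[a, b]) (s `^ q)%:E =
    ((b `^ (q + 1) - a `^ (q + 1)) / (q + 1))%:E)%E.
Proof.
move=> q1 a0; rewrite le_eqVlt => /orP[/eqP <-|ab].
  by rewrite subrr mul0r set_itv1 integral_set1.
have q10 : q + 1 != 0 by rewrite addr_eq0.
have dF (x : R) : 0 < x -> is_derive x (1 : R) (fun x => x `^ (q + 1) / (q + 1)) (x `^ q).
  move=> x0; have d := is_derive1_powR (q + 1) x0.
  have -> : (fun x : R => x `^ (q + 1) / (q + 1)) = (q + 1)^-1 \*: (fun x => x `^ (q + 1)).
    by apply/funext => y /=; rewrite mulrC.
  apply: (is_derive_eq (is_deriveZ _ d)); rewrite /GRing.scale/= addrK.
  by rewrite mulrA mulVf// mul1r.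
have cp (x : R) : 0 < x -> {for x, continuous (fun x : R => x `^ q)}.
  move=> x0; apply: differentiable_continuous; apply/derivable1_diffP.
  by have [] := is_derive1_powR q x0.
have cF (x : R) : 0 < x -> {for x, continuous (fun x : R => x `^ (q + 1) / (q + 1))}.
  move=> x0; apply: differentiable_continuous; apply/derivable1_diffP.
  by have [] := dF _ x0.
rewrite (@continuous_FTC2 _ _ (fun x => x `^ (q + 1) / (q + 1)))//.
- by rewrite -EFinB -mulrBl.
- apply: continuous_in_subspaceT => x; rewrite inE/= in_itv/= => /andP[ax _].
  exact/cp/(lt_le_trans a0).
- split.
  + by move=> x; rewrite in_itv/= => /andP[ax _]; have [] := dF _ (lt_trans a0 ax).
  + exact/cvg_at_right_filter/cF.
  + exact/cvg_at_left_filter/cF/(lt_trans a0).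
- move=> x; rewrite in_itv/= => /andP[ax _]; rewrite derive1E.
  exact: (@derive_val _ _ _ _ _ _ _ (dF _ (lt_trans a0 ax))).
Qed.

Lemma integral_powR_01 (R : realType) (q : R) : -1 < q ->
  (\int[lebesgue_measure]_(s in `]0%R, 1%R]) (s `^ q)%:E < +oo)%E.
Proof.
move=> q1; have q0 : 0 < q + 1 by rewrite -ltrBlDr sub0r.
pose F (n : nat) : set (measurableTypeR R) := `[n.+1%:R^-1, 1]%classic.
have -> : `]0%R, 1%R]%classic = \bigcup_n F n.
  apply/seteqP; split => x /=; rewrite ?in_itv/=.
    move=> /andP[x0 x1]; have [n nx] := ltr_add_invr x0.
    by exists n => //=; rewrite /F/= in_itv/= x1 andbT; rewrite add0r in nx; exact: ltW.
  by move=> [n _]; rewrite /F/= in_itv/= => /andP[nx ->]; rewrite andbT (lt_le_trans _ nx)// invr_gt0.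
have mp : measurable_fun [set: measurableTypeR R] (fun s : R => (s `^ q)%:E).
  by apply/measurable_EFinP; exact: measurable_powR.
have cv : (\int[lebesgue_measure]_(s in F n) (s `^ q)%:E)%E @[n --> \oo] -->
    (\int[lebesgue_measure]_(s in \bigcup_n F n) (s `^ q)%:E)%E.
  apply: ge0_nondecreasing_set_cvg_integral.
  - move=> n m nm; apply/subsetPset => x; rewrite /F/= !in_itv/= => /andP[nx ->].
    by rewrite andbT (le_trans _ nx)// lef_pV2 ?posrE// ler_nat.
  - by move=> i; exact: measurable_itv.
  - by move=> i; exact: (measurable_funS measurableT _ mp).
  - by move=> i x _; rewrite lee_fin powR_ge0.
apply: (@le_lt_trans _ _ ((q + 1)^-1)%:E); last exact: ltry.
apply: (cvge_to_le cv); apply: nearW => n.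
rewrite integral_powR_le ?invr_gt0//.
- by rewrite lee_fin ler_piMl ?invr_ge0 ?(ltW q0)// powR1 lerBlDr lerDl powR_ge0.
- by rewrite gt_eqF.
- by rewrite invf_le1// ler1n.
Qed.

Lemma integral_powR_1y (R : realType) (q : R) : q < -1 ->
  (\int[lebesgue_measure]_(s in `[1%R, +oo[) (s `^ q)%:E < +oo)%E.
Proof.
move=> q1; have q0 : q + 1 < 0 by rewrite -ltrBrDr sub0r.
pose F (n : nat) : set (measurableTypeR R) := `[1, n.+1%:R]%classic.
have -> : `[1%R, +oo[%classic = \bigcup_n F n.
  apply/seteqP; split => x /=; rewrite ?in_itv/= ?andbT.
    move=> x1; exists (Num.truncn x) => //=.
    by rewrite /F/= in_itv/= x1/= ltW// truncnS_gt.
  by move=> [n _]; rewrite /F/= in_itv/= => /andP[].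
have mp : measurable_fun [set: measurableTypeR R] (fun s : R => (s `^ q)%:E).
  by apply/measurable_EFinP; exact: measurable_powR.
have cv : (\int[lebesgue_measure]_(s in F n) (s `^ q)%:E)%E @[n --> \oo] -->
    (\int[lebesgue_measure]_(s in \bigcup_n F n) (s `^ q)%:E)%E.
  apply: ge0_nondecreasing_set_cvg_integral.
  - move=> n m nm; apply/subsetPset => x; rewrite /F/= !in_itv/= => /andP[-> nx].
    by rewrite (le_trans nx)// ler_nat.
  - by move=> i; exact: measurable_itv.
  - by move=> i; exact: (measurable_funS measurableT _ mp).
  - by move=> i x _; rewrite lee_fin powR_ge0.
apply: (@le_lt_trans _ _ ((- (q + 1))^-1)%:E); last exact: ltry.
apply: (cvge_to_le cv); apply: nearW => n.
rewrite integral_powR_le//.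
- rewrite lee_fin -[leLHS]mulrNN -invrN ler_piMl ?invr_ge0 ?oppr_ge0 ?(ltW q0)//.
  by rewrite powR1 opprB lerBlDr lerDl powR_ge0.
- by rewrite lt_eqF.
- by rewrite ler1n.
Qed.

(** * The Mandelbrot-van Ness kernel *)

Lemma powR_sqr (R : realType) (x b : R) : (x `^ b) ^+ 2 = x `^ (2 * b).
Proof. by rewrite -powR_mulrn ?powR_ge0// -powRrM mulrC. Qed.

Lemma powR_1D_sub1 (R : realType) (b y : R) : -1 <= b <= 1 -> 0 <= y ->
  `|(1 + y) `^ b - 1| <= y.
Proof.
move=> /andP[b1 b2] y0.
have y1 : 1 <= 1 + y by rewrite lerDl.
have [b0|b0] := leP 0 b.
  have : 1 <= (1 + y) `^ b by rewrite -[leLHS](powRr0 (1 + y)) ler_powR.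
  have := ler1_powR y1 b2; rewrite ler_norml; lra.
have : (1 + y) `^ b <= 1 by rewrite -[leRHS](powRr0 (1 + y)) ler_powR// ltW.
have : (1 + y) `^ (-1) <= (1 + y) `^ b by rewrite ler_powR.
rewrite powR_inv1; last by rewrite addr_ge0.
have : (1 + y)^-1 * (1 + y) = 1 by rewrite mulVf// gt_eqF// ltr_wpDr.
have : 0 <= (1 + y)^-1 by rewrite invr_ge0 addr_ge0.
move: ((1 + y)^-1) ((1 + y) `^ b) => i p i0 i1 h1 h2.
rewrite ler_norml; nra.
Qed.

(** The power [u_+ ^ b]; [mvn b t] is the Mandelbrot-van Ness kernel of the time
    [t], with the noise variable reflected. *)
Definition mvn_kernel (R : realType) (b u : R) : R := if 0 < u then u `^ b else 0.

Definition mvn (R : realType) (b t s : R) : R := mvn_kernel b (t + s) - mvn_kernel b s.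

Lemma mvn_kernel0 (R : realType) (b u : R) : u <= 0 -> mvn_kernel b u = 0.
Proof. by rewrite /mvn_kernel leNgt => /negbTE ->. Qed.

Lemma mvn_kernelM (R : realType) (b h u : R) : 0 < h ->
  mvn_kernel b (h * u) = h `^ b * mvn_kernel b u.
Proof.
move=> h0; rewrite /mvn_kernel pmulr_rgt0//; case: ifPn => u0; last by rewrite mulr0.
by rewrite powRM ?ltW.
Qed.

Lemma measurable_mvn_kernel (R : realType) (b : R) : measurable_fun [set: R] (mvn_kernel b).
Proof.
by apply: measurable_fun_ifT => //; exact: measurable_fun_ltr.
Qed.

Lemma measurable_mvn (R : realType) (b t : R) : measurable_fun [set: R] (mvn b t).
Proof.
apply: measurable_funB; last exact: measurable_mvn_kernel.
by apply: measurableT_comp; [exact: measurable_mvn_kernel|exact: measurable_funD].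
Qed.

(** For [- 1 < s <= 0] only the first power is present; for [0 < s <= 1] the
    difference is at most [2] if [0 <= b] and at most [s ^ b] if [b < 0]; for
    larger [s] the two powers cancel to order [s ^ (b - 1)]. *)
Lemma mvn_sqr_bound (R : realType) (b s : R) : - 2^-1 < b < 2^-1 ->
  (mvn b 1 s) ^+ 2 <= (((fun x : R => x `^ (2 * b)) \_ `]0%R, 1%R]%classic) (1 + s)
    + ((fun _ : R => 4 : R) \_ `]0%R, 1%R]%classic) s + ((fun x : R => x `^ (2 * b)) \_ `]0%R, 1%R]%classic) s)
    + ((fun x : R => x `^ (2 * b - 2)) \_ `[1%R, +oo[%classic) s.
Proof.
move=> /andP[b1 b2].
have pos (A : set R) (f : R -> R) x : (forall x, 0 <= f x) -> 0 <= (f \_ A) x.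
  by move=> f0; rewrite patchE; case: ifPn.
have p0 (x : R) : 0 <= ((fun x : R => x `^ (2 * b)) \_ `]0%R, 1%R]%classic) x by apply: pos => y; exact: powR_ge0.
have p1 (x : R) : 0 <= ((fun _ : R => 4 : R) \_ `]0%R, 1%R]%classic) x by exact: pos.
have p2 (x : R) : 0 <= ((fun x : R => x `^ (2 * b - 2)) \_ `[1%R, +oo[%classic) x by apply: pos => y; exact: powR_ge0.
have := p0 s; have := p0 (1 + s); have := p1 s; have := p2 s => q1 q2 q3 q4.
have [s1|s1] := leP s (-1).
  have h1 : 1 + s <= 0 by lra.
  have h2 : s <= 0 by lra.
  by rewrite /mvn (mvn_kernel0 b h1) (mvn_kernel0 b h2) subrr expr0n/= !addr_ge0.
have [s0|s0] := leP s 0.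
  rewrite /mvn (mvn_kernel0 b s0) subr0 /mvn_kernel ifT; last by lra.
  rewrite powR_sqr; apply: (@le_trans _ _ (((fun x : R => x `^ (2 * b)) \_ `]0%R, 1%R]%classic) (1 + s))); last by lra.
  by rewrite patchE mem_set//= in_itv/=; apply/andP; split; lra.
rewrite /mvn /mvn_kernel s0 ifT; last by lra.
have [s11|s11] := leP s 1.
  have e1 : ((fun _ : R => 4 : R) \_ `]0%R, 1%R]%classic) s = 4 by rewrite patchE mem_set//= in_itv/= s0 s11.
  have e2 : ((fun x : R => x `^ (2 * b)) \_ `]0%R, 1%R]%classic) s = s `^ (2 * b).
    by rewrite patchE mem_set//= in_itv/= s0 s11.
  have [b0|b0] := leP 0 b.
    have : s `^ b <= 1.
      rewrite -[leRHS](powRr0 s); apply: ger_powR => //; by rewrite s0 s11.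
    have := powR_ge0 s b; have := powR_ge0 (1 + s) b.
    have : (1 + s) `^ b <= 1 + s by apply: ler1_powR; lra.
    rewrite e1; nra.
  have : (1 + s) `^ b <= s `^ b.
    by rewrite -(opprK b) powRN [leRHS]powRN lef_pV2 ?posrE ?powR_gt0//; try lra; apply: ge0_ler_powR; rewrite ?nnegrE; lra.
  have := powR_ge0 (1 + s) b; rewrite e2 -powR_sqr; nra.
have e : ((fun x : R => x `^ (2 * b - 2)) \_ `[1%R, +oo[%classic) s = s `^ (2 * b - 2).
  by rewrite patchE mem_set//= in_itv/= andbT ltW.
have -> : 1 + s = s * (1 + s^-1) by rewrite mulrDr mulr1 divff ?gt_eqF// addrC.
have si : 0 <= s^-1 by rewrite invr_ge0 ltW.
rewrite powRM ?(ltW s0) ?addr_ge0//.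
rewrite -[X in (_ - X) ^+ 2]mulr1 -mulrBr exprMn.
have b3 : -1 <= b <= 1 by apply/andP; split; lra.
have := powR_1D_sub1 b3 si.
rewrite -(real_normK (num_real (_ - 1))) => h.
have e' : s `^ (2 * b - 2) = (s `^ b) ^+ 2 * s^-1 ^+ 2.
  rewrite powR_sqr exprVn -powR_mulrn ?(ltW s0)// -powRN -powRD//.
  by apply/implyP => _; rewrite gt_eqF.
apply: (@le_trans _ _ ((s `^ b) ^+ 2 * s^-1 ^+ 2)); last by rewrite e e' lerDr !addr_ge0.
by rewrite ler_wpM2l ?sqr_ge0// lerXn2r ?nnegrE.
Qed.

Local Notation leb := lebesgue_measure.

Lemma integral_patch_lty (R : realType) (A : set (measurableTypeR R)) (f : R -> R) :
  measurable A ->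
  (\int[leb]_(s in A) (f s)%:E < +oo)%E -> (\int[leb]_s ((f \_ A) s)%:E < +oo)%E.
Proof.
move=> mA; congr (_ < _)%E; rewrite integral_mkcond; apply: eq_integral => x _.
by rewrite !patchE; case: ifPn.
Qed.

Lemma mvn_sqr_integral_lty (R : realType) (b : R) : - 2^-1 < b < 2^-1 ->
  (\int[leb]_s (mvn b 1 s ^+ 2)%:E < +oo)%E.
Proof.
move=> bb; have /andP[b1 b2] := bb.
pose A : R -> R := (fun x : R => x `^ (2 * b)) \_ `]0%R, 1%R]%classic.
pose O : R -> R := (fun _ : R => 4 : R) \_ `]0%R, 1%R]%classic.
pose B : R -> R := (fun x : R => x `^ (2 * b - 2)) \_ `[1%R, +oo[%classic.
have pos (C : set R) (f : R -> R) x : (forall x, 0 <= f x) -> 0 <= (f \_ C) x.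
  by move=> f0; rewrite patchE; case: ifPn.
have A0 x : 0 <= A x by apply: pos => y; exact: powR_ge0.
have O0 x : 0 <= O x by exact: pos.
have B0 x : 0 <= B x by apply: pos => y; exact: powR_ge0.
have mA : measurable_fun [set: R] A.
  apply/(measurable_restrictT _ _).1; first exact: measurable_itv.
  exact: measurable_funTS (measurable_powR _).
have mO : measurable_fun [set: R] O.
  by apply/(measurable_restrictT _ _).1; first exact: measurable_itv.
have mB : measurable_fun [set: R] B.
  apply/(measurable_restrictT _ _).1; first exact: measurable_itv.
  exact: measurable_funTS (measurable_powR _).
have mA1 : measurable_fun [set: R] (fun s => A (1 + s)).
  by apply: measurableT_comp => //; exact: measurable_funD.
have mE (f : R -> R) : measurable_fun [set: R] f ->
    measurable_fun [set: measurableTypeR R] (fun s : measurableTypeR R => (f s)%:E).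
  by move=> mf; apply/measurable_EFinP; exact: mf.
have iA : (\int[leb]_s (A s)%:E < +oo)%E.
  apply: integral_patch_lty; first exact: measurable_itv.
  by apply: integral_powR_01; lra.
have iO : (\int[leb]_s (O s)%:E < +oo)%E.
  apply: integral_patch_lty; first exact: measurable_itv.
  rewrite integral_cst; last exact: measurable_itv.
  have E1 : leb (`]0, 1]%classic : set R) = 1%E.
    by rewrite lebesgue_measure_itv/= lte01 oppr0 adde0.
  have : (4%:E * 1%:E < +oo :> \bar R)%E by rewrite mule1 ltry.
  by rewrite -E1.
have iB : (\int[leb]_s (B s)%:E < +oo)%E.
  apply: integral_patch_lty; first exact: measurable_itv.
  by apply: integral_powR_1y; rewrite ltrBlDr; lra.
have iA1 : (\int[leb]_s (A (1 + s))%:E < +oo)%E.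
  have := @ge0_integral_affine R 1 1 (fun s => (A s)%:E) ltr01 (mE _ mA) (fun s => A0 s).
  rewrite mul1e => H.
  have e : (\int[leb]_s (A (1 + 1 * s))%:E = \int[leb]_s (A (1 + s))%:E)%E.
    by apply: eq_integral => x _; rewrite mul1r.
  by rewrite -e -H.
have eA1 := mE _ mA1; have eO := mE _ mO; have eA := mE _ mA; have eB := mE _ mB.
have e2 := emeasurable_funD eA1 eO; have e3 := emeasurable_funD e2 eA.
have e4 := emeasurable_funD e3 eB.
have msq : measurable_fun [set: R] (fun s => mvn b 1 s ^+ 2).
  by apply: measurable_funX; exact: measurable_mvn.
apply: (@le_lt_trans _ _ (\int[leb]_s ((A (1 + s))%:E + (O s)%:E + (A s)%:E + (B s)%:E))%E).
  apply: (ge0_le_integral _ measurableT _ (mE _ msq) e4).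
  - by move=> x _; rewrite lee_fin sqr_ge0.
  - by move=> x _; rewrite -!EFinD lee_fin; exact: mvn_sqr_bound.
have zA x : (0 <= (A x)%:E)%E by rewrite lee_fin.
have zB x : (0 <= (B x)%:E)%E by rewrite lee_fin.
have zO x : (0 <= (O x)%:E)%E by rewrite lee_fin.
have p2 x : (0 <= (A (1 + x))%:E + (O x)%:E)%E by rewrite -EFinD lee_fin addr_ge0.
have p3 x : (0 <= (A (1 + x))%:E + (O x)%:E + (A x)%:E)%E by rewrite -!EFinD lee_fin !addr_ge0.
have E4 : (\int[leb]_s ((A (1 + s))%:E + (O s)%:E + (A s)%:E + (B s)%:E) =
    \int[leb]_s ((A (1 + s))%:E + (O s)%:E + (A s)%:E) + \int[leb]_s (B s)%:E)%E.
  exact: (ge0_integralD leb measurableT (fun x _ => p3 x) e3 (fun x _ => zB x) eB).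
have E3 : (\int[leb]_s ((A (1 + s))%:E + (O s)%:E + (A s)%:E) =
    \int[leb]_s ((A (1 + s))%:E + (O s)%:E) + \int[leb]_s (A s)%:E)%E.
  exact: (ge0_integralD leb measurableT (fun x _ => p2 x) e2 (fun x _ => zA x) eA).
have E2 : (\int[leb]_s ((A (1 + s))%:E + (O s)%:E) =
    \int[leb]_s (A (1 + s))%:E + \int[leb]_s (O s)%:E)%E.
  exact: (ge0_integralD leb measurableT (fun x _ => zA (1 + x)) eA1 (fun x _ => zO x) eO).
rewrite E4 E3 E2.
apply: lte_add_pinfty; last exact: iB.
apply: lte_add_pinfty; last exact: iA.
by apply: lte_add_pinfty; [exact: iA1|exact: iO].
Qed.

Definition mvn_const (R : realType) (b : R) : R := \int[leb]_s (mvn b 1 s ^+ 2).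

(** Homogeneity of the kernel: the substitution [s := - u + (t - u) * s] turns
    the difference into a multiple of [mvn b 1]. *)
Lemma mvn_incr_integral (R : realType) (b t u : R) : - 2^-1 < b < 2^-1 ->
  (\int[leb]_s ((mvn b t s - mvn b u s) ^+ 2)%:E =
   (`|t - u| `^ (2 * b + 1) * mvn_const b)%:E)%E.
Proof.
move=> bb; have /andP[b1 b2] := bb.
wlog ut : t u / u <= t.
  move=> H; have [|tu] := leP u t; first exact: H.
  rewrite distrC -(H u t (ltW tu)); apply: eq_integral => x _.
  by rewrite -sqrrN opprB.
move: ut; rewrite le_eqVlt => /orP[/eqP <-|ut].
  have q0 : 0 < 2 * b + 1 by lra.
  rewrite subrr normr0 powR0 ?gt_eqF// mul0r.
  by under eq_integral do rewrite subrr expr0n/=; rewrite integral0.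
have h0 : 0 < t - u by rewrite subr_gt0.
rewrite (ger0_norm (ltW h0)).
have mf : measurable_fun [set: R] (fun s => (mvn b t s - mvn b u s) ^+ 2).
  by apply: measurable_funX; apply: measurable_funB; exact: measurable_mvn.
have mE (f : R -> R) : measurable_fun [set: R] f ->
    measurable_fun [set: measurableTypeR R] (fun s : measurableTypeR R => (f s)%:E).
  by move=> mf'; apply/measurable_EFinP; exact: mf'.
rewrite (@ge0_integral_affine R (- u) (t - u) (fun s => ((mvn b t s - mvn b u s) ^+ 2)%:E))//; last 2 first.
- exact: mE.
- by move=> s; rewrite lee_fin sqr_ge0.
have e s : (((mvn b t (- u + (t - u) * s) - mvn b u (- u + (t - u) * s)) ^+ 2)%:E =
    ((t - u) `^ (2 * b))%:E * (mvn b 1 s ^+ 2)%:E)%E.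
  rewrite -EFinM; congr EFin; rewrite /mvn opprB addrA subrK.
  rewrite (_ : t + (- u + (t - u) * s) = (t - u) * (1 + s)); last by ring.
  rewrite (_ : u + (- u + (t - u) * s) = (t - u) * s); last by ring.
  by rewrite !mvn_kernelM// -mulrBr exprMn powR_sqr.
under eq_integral do rewrite e.
rewrite ge0_integralZl//; last 3 first.
- by apply: mE; apply: measurable_funX; exact: measurable_mvn.
- by move=> x _; rewrite lee_fin sqr_ge0.
- by rewrite lee_fin powR_ge0.
rewrite muleA -EFinM.
have -> : (t - u) * (t - u) `^ (2 * b) = (t - u) `^ (2 * b + 1).
  rewrite powRD ?powRr1 ?(ltW h0) 1?mulrC//.
  by apply/implyP => _; rewrite gt_eqF.
rewrite EFinM; congr (_ * _)%E; rewrite /mvn_const /Rintegral fineK//.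
rewrite ge0_fin_numE; first exact: mvn_sqr_integral_lty.
by apply: integral_ge0 => x _; rewrite lee_fin sqr_ge0.
Qed.

(** * Covariances of the kernel *)

Lemma integrable_sum_Rintegral d (T : measurableType d) (R : realType)
    (mu : {measure set T -> \bar R}) (D : set T) (I : Type) (r : seq I) (h : I -> T -> R) :
  measurable D -> (forall i, mu.-integrable D (EFin \o h i)) ->
  mu.-integrable D (EFin \o (fun x => \sum_(i <- r) h i x)) /\
  \int[mu]_(x in D) (\sum_(i <- r) h i x) = \sum_(i <- r) \int[mu]_(x in D) h i x.
Proof.
move=> mD ih; elim: r => [|i r [IH1 IH2]].
  have -> : (fun x => \sum_(i <- [::]) h i x) = (fun _ => 0).
    by apply/funext => x; rewrite big_nil.
  rewrite big_nil; split; first exact: integrable0.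
  by rewrite /Rintegral integral0.
have -> : (fun x => \sum_(j <- i :: r) h j x) = (fun x => h i x + \sum_(j <- r) h j x).
  by apply/funext => x; rewrite big_cons.
rewrite big_cons; split.
  exact: (integrableD mD (ih i) IH1).
by rewrite RintegralD// IH2.
Qed.

Lemma Rintegral_sqr_sum d (T : measurableType d) (R : realType)
    (mu : {measure set T -> \bar R}) (I : eqType) (f : I -> T -> R) (K : I -> I -> R)
    (z : seq (R * I)) :
  (forall x y, x \in z -> y \in z ->
     mu.-integrable setT (EFin \o (fun w => f x.2 w * f y.2 w)) /\
     \int[mu]_w (f x.2 w * f y.2 w) = K x.2 y.2) ->
  mu.-integrable setT (EFin \o (fun w => (\sum_(x <- z) x.1 * f x.2 w) ^+ 2)) /\
  \int[mu]_w ((\sum_(x <- z) x.1 * f x.2 w) ^+ 2) =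
    \sum_(x <- z) \sum_(y <- z) x.1 * y.1 * K x.2 y.2.
Proof.
move=> H.
pose h (x y : R * I) w := if (x \in z) && (y \in z) then x.1 * y.1 * (f x.2 w * f y.2 w) else 0.
have ih x y : mu.-integrable setT (EFin \o h x y).
  rewrite /h; case E : ((x \in z) && (y \in z)); last exact: integrable0.
  move/andP : E => [xz yz].
  have [i1 _] := H x y xz yz.
  by apply: (integrableZl measurableT (x.1 * y.1) i1).
have -> : (fun w => (\sum_(x <- z) x.1 * f x.2 w) ^+ 2) =
    (fun w => \sum_(x <- z) \sum_(y <- z) h x y w).
  apply/funext => w; rewrite expr2 mulr_suml; apply: eq_big_seq => x xz.
  rewrite mulr_sumr; apply: eq_big_seq => y yz.
  by rewrite /h xz yz/= mulrACA.
have ih2 x := integrable_sum_Rintegral z measurableT (ih x).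
have [i3 ->] := integrable_sum_Rintegral z measurableT (fun x => (ih2 x).1).
split=> //; apply: eq_big_seq => x xz.
rewrite (ih2 x).2; apply: eq_big_seq => y yz.
have [i1 <-] := H x y xz yz.
by rewrite /h xz yz/= RintegralZl.
Qed.

Lemma mvn0 (R : realType) (b s : R) : mvn b 0 s = 0.
Proof. by rewrite /mvn add0r subrr. Qed.

(** Causality: the noise to the left of [- t] has no effect at the time [t].  It
    gives linear combinations a triangular structure, slab by slab. *)
Lemma mvn_eq0 (R : realType) (b t s : R) : 0 <= t -> s <= - t -> mvn b t s = 0.
Proof.
move=> t0 st; have h1 : t + s <= 0 by lra.
have h2 : s <= 0 by lra.
by rewrite /mvn (mvn_kernel0 b h1) (mvn_kernel0 b h2) subrr.
Qed.

Lemma mvn_sqr_ge (R : realType) (b t u s : R) : - 2^-1 < b < 2^-1 ->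
  0 <= u -> u < t -> - u - (t - u) / 2 < s <= - u ->
  (t - u) `^ (2 * b) / 2 <= mvn b t s ^+ 2.
Proof.
move=> /andP[b1 b2] u0 ut /andP[s1 s2].
have h2 : s <= 0 by lra.
have h1 : 0 < t + s by lra.
have h0 : 0 < t - u by lra.
rewrite /mvn (mvn_kernel0 b h2) subr0 /mvn_kernel h1 powR_sqr.
have [b0|b0] := leP 0 b.
  apply: (@le_trans _ _ (((t - u) / 2) `^ (2 * b))); last first.
    by apply: ge0_ler_powR; rewrite ?nnegrE; lra.
  rewrite powRM ?(ltW h0)//.
  apply: ler_wpM2l; first exact: powR_ge0.
  rewrite -[leLHS]powRr1; last by lra.
  by apply: ger_powR; lra.
apply: (@le_trans _ _ ((t - u) `^ (2 * b))).
  by rewrite ler_pdivrMr// ler_peMr// ?powR_ge0//; lra.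
rewrite -(opprK (2 * b)) powRN [leRHS]powRN lef_pV2 ?posrE ?powR_gt0//.
by apply: ge0_ler_powR; rewrite ?nnegrE; lra.
Qed.

(** On the half of the slab next to [- u], the kernel is [(t + s) ^ b] with
    [t + s] between [(t - u) / 2] and [t - u], which is comparable with
    [(t - u) ^ b] for either sign of [b]. *)
Lemma mvn_sqr_integral_ge (R : realType) (b t u : R) : - 2^-1 < b < 2^-1 ->
  0 <= u -> u < t ->
  (((t - u) `^ (2 * b + 1) / 4)%:E <= \int[leb]_(s in `[(- t)%R, (- u)%R[) (mvn b t s ^+ 2)%:E)%E.
Proof.
move=> bb u0 ut.
have h0 : 0 < t - u by lra.
pose A : set (measurableTypeR R) := `]- u - (t - u) / 2, - u[%classic.
have mA : measurable A by exact: measurable_itv.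
have msq : measurable_fun [set: R] (fun s => mvn b t s ^+ 2).
  by apply: measurable_funX; exact: measurable_mvn.
have esq : measurable_fun [set: measurableTypeR R] (fun s : measurableTypeR R => (mvn b t s ^+ 2)%:E).
  by apply/measurable_EFinP; exact: msq.
apply: (@le_trans _ _ (\int[leb]_(s in A) (mvn b t s ^+ 2)%:E)%E); last first.
  apply: ge0_subset_integral => //.
  - exact: (measurable_funS measurableT (@subsetT _ _) esq).
  - by move=> x _; rewrite lee_fin sqr_ge0.
  - by move=> x; rewrite /A/= !in_itv/= => /andP[x1 x2]; rewrite x2 andbT; lra.
have LA : leb A = ((t - u) / 2)%:E.
  rewrite /A lebesgue_measure_itv/= lte_fin ifT; last by lra.
  by rewrite -EFinB; congr EFin; ring.
apply: (@le_trans _ _ (\int[leb]_(s in A) ((t - u) `^ (2 * b) / 2)%:E)%E); last first.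
  apply: ge0_le_integral => //.
  - by move=> x _; rewrite lee_fin divr_ge0// powR_ge0.
  - exact: (measurable_funS measurableT (@subsetT _ A) esq).
  - move=> x; rewrite /A/= in_itv/= => /andP[x1 x2]; rewrite lee_fin.
    by apply: mvn_sqr_ge => //; rewrite x1 ltW.
rewrite integral_cst//.
suff : (((t - u) `^ (2 * b + 1) / 4)%:E <= ((t - u) `^ (2 * b) / 2)%:E * ((t - u) / 2)%:E)%E.
  by rewrite -LA.
rewrite -EFinM lee_fin.
rewrite powRD; last by apply/implyP => _; rewrite gt_eqF.
rewrite powRr1 ?(ltW h0)//.
by rewrite le_eqVlt; apply/orP; left; apply/eqP; field.
Qed.

Lemma mvn_const_gt0 (R : realType) (b : R) : - 2^-1 < b < 2^-1 -> 0 < mvn_const b.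
Proof.
move=> bb; have fin := mvn_sqr_integral_lty bb.
have := mvn_sqr_integral_ge bb (lexx 0) ltr01.
have msq : measurable_fun [set: R] (fun s => mvn b 1 s ^+ 2).
  by apply: measurable_funX; exact: measurable_mvn.
have esq : measurable_fun [set: measurableTypeR R] (fun s : measurableTypeR R => (mvn b 1 s ^+ 2)%:E).
  by apply/measurable_EFinP; exact: msq.
rewrite subr0 powR1 => H.
rewrite /mvn_const /Rintegral fine_gt0// fin andbT.
apply: (@lt_le_trans _ _ (1 / 4)%:E); first by rewrite lte_fin divr_gt0.
apply: (le_trans H); apply: ge0_subset_integral => //.
by move=> x _; rewrite lee_fin sqr_ge0.
Qed.

(** Polarisation of [mvn_incr_integral]: up to the factor [mvn_const b], the
    functions [mvn b t] have the covariance of fractional Brownian motion of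
    index [b + 1 / 2]. *)
Lemma mvn_covariance (R : realType) (b t u : R) : - 2^-1 < b < 2^-1 ->
  leb.-integrable [set: measurableTypeR R] (EFin \o (fun s => mvn b t s * mvn b u s)) /\
  \int[leb]_s (mvn b t s * mvn b u s) =
  mvn_const b * (2^-1 * (`|t| `^ (2 * b + 1) + `|u| `^ (2 * b + 1) - `|t - u| `^ (2 * b + 1))).
Proof.
move=> bb.
have mE (f : R -> R) : measurable_fun [set: R] f ->
    measurable_fun [set: measurableTypeR R] (fun s : measurableTypeR R => (f s)%:E).
  by move=> mf; apply/measurable_EFinP; exact: mf.
have mm t' : measurable_fun [set: R] (fun s => mvn b t' s) by exact: measurable_mvn.
have i2 t' u' : leb.-integrable [set: measurableTypeR R]
    (EFin \o (fun s => (mvn b t' s - mvn b u' s) ^+ 2)).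
  apply/integrableP; split.
    by apply: mE; apply: measurable_funX; exact: measurable_funB.
  apply: (@le_lt_trans _ _ (`|t' - u'| `^ (2 * b + 1) * mvn_const b)%:E); last exact: ltry.
  rewrite -mvn_incr_integral// le_eqVlt; apply/orP; left; apply/eqP.
  by apply: eq_integral => x _ /=; rewrite ger0_norm// sqr_ge0.
have e2 t' u' : \int[leb]_s (mvn b t' s - mvn b u' s) ^+ 2 = `|t' - u'| `^ (2 * b + 1) * mvn_const b.
  by rewrite /Rintegral mvn_incr_integral.
pose p t' u' := fun s : measurableTypeR R => (mvn b t' s - mvn b u' s) ^+ 2.
have -> : (fun s => mvn b t s * mvn b u s) =
    (fun s : measurableTypeR R => 2^-1 * (p t 0 s + p u 0 s - p t u s)).
  by apply/funext => s; rewrite /p !mvn0; field.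
have iD : leb.-integrable [set: measurableTypeR R] (EFin \o (fun s => p t 0 s + p u 0 s)).
  exact: (integrableD measurableT (i2 t 0) (i2 u 0)).
have iB : leb.-integrable [set: measurableTypeR R] (EFin \o (fun s => p t 0 s + p u 0 s - p t u s)).
  exact: (integrableB measurableT iD (i2 t u)).
split; first exact: (integrableZl measurableT 2^-1 iB).
have -> : \int[leb]_s (2^-1 * (p t 0 s + p u 0 s - p t u s)) =
    2^-1 * \int[leb]_s (p t 0 s + p u 0 s - p t u s) by rewrite RintegralZl.
have -> : \int[leb]_s (p t 0 s + p u 0 s - p t u s) =
    \int[leb]_s (p t 0 s + p u 0 s) - \int[leb]_s p t u s.
  by apply: RintegralB => //; exact: i2.
have -> : \int[leb]_s (p t 0 s + p u 0 s) = \int[leb]_s p t 0 s + \int[leb]_s p u 0 s.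
  by apply: RintegralD => //; exact: i2.
by rewrite /p !e2 !subr0; ring.
Qed.

(** * Gaussian sums and the Fejér kernel *)

Lemma geometric_two_sided (R : realType) (x : R) (i0 n : nat) : 0 <= x <= 1 ->
  (1 - x) * (\sum_(i < n) x ^+ `|i - i0|%N) <= 2.
Proof.
rewrite -(big_mkord xpredT (fun i => x ^+ `|i - i0|%N)) => /andP[x0 x1].
(* The terms left of [i0], then the remaining ones: telescoping with an exact
   remainder makes both inductions go through. *)
have lem1 m : (m <= i0.+1)%N -> (1 - x) * (\sum_(0 <= i < m) x ^+ `|i - i0|%N) <= x ^+ (i0.+1 - m).
  elim: m => [|m IH] mi; first by rewrite big_geq// mulr0 exprn_ge0.
  rewrite big_nat_recr//= mulrDr subSS.
  have -> : `|m - i0|%N = (i0 - m)%N by rewrite distnC distnEl.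
  have := IH (ltnW mi); rewrite subSn// exprS.
  move: (x ^+ _) (\big[_/_]_(_ <- _ | _) _) => y S; nra.
have lem2 k : (1 - x) * (\sum_(0 <= i < i0.+1 + k) x ^+ `|i - i0|%N) <= 2 - x ^+ k.
  elim: k => [|k IH].
    by have := lem1 _ (leqnn i0.+1); rewrite addn0 subnn expr0; lra.
  rewrite addnS big_nat_recr//= mulrDr.
  have -> : `|i0.+1 + k - i0|%N = k.+1.
    by rewrite addSn -addnS distnEl ?leq_addr// addKn.
  have xk : 0 <= x ^+ k by rewrite exprn_ge0.
  by move: IH; rewrite exprS; move: (x ^+ k) xk (\big[_/_]_(_ <- _ | _) _) => y y0 S; have := mulr_ge0 y0 (sqr_ge0 (1 - x)); nra.
have [ni|ni] := leqP n i0.+1.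
  apply: (le_trans (lem1 _ ni)); apply: (@le_trans _ _ 1); last by lra.
  exact: exprn_ile1.
apply: (@le_trans _ _ (2 - x ^+ (n - i0.+1))).
  by have := lem2 (n - i0.+1)%N; rewrite subnKC// ltnW.
have : 0 <= x ^+ (n - i0.+1) by exact: exprn_ge0.
lra.
Qed.

(** [exp (- y ^ 2) <= 2 * exp (- |y|)] reduces the sum to a two-sided geometric
    series with ratio [exp (- tau)]. *)
Lemma gaussian_sum_le (R : realType) (tau : R) (i0 n : nat) : 0 < tau ->
  \sum_(i < n) expR (- (tau * (i%:R - i0%:R)) ^+ 2) <= 4 * (1 + tau^-1).
Proof.
move=> t0; pose x := expR (- tau).
have x0 : 0 <= x by exact: expR_ge0.
have xt : x * (1 + tau) <= 1.
  rewrite /x expRN mulrC ler_pdivrMr ?expR_gt0// mul1r; exact: expR_ge1Dx.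
have x1 : x <= 1 by nra.
have e4 : expR (4^-1) <= 2 :> R.
  have : expR (- 4^-1) >= 1 + - 4^-1 :> R by exact: expR_ge1Dx.
  rewrite expRN; have := expR_gt0 (4^-1 : R).
  by move: (expR 4^-1) => e e0 h; have := ler_wpM2r (ltW e0) h; rewrite mulVf ?gt_eqF//; lra.
have := geometric_two_sided i0 n (introT andP (conj x0 x1)).
set S := \sum_(i < n) x ^+ _ => hS.
have S0 : 0 <= S by apply: sumr_ge0 => i _; rewrite exprn_ge0.
apply: (@le_trans _ _ (2 * S)).
  rewrite mulr_sumr; apply: ler_sum => i _.
  have -> : x ^+ `|i - i0|%N = expR (- (tau * `|i%:R - i0%:R|)).
    rewrite /x -expRM_natr mulNr; congr (expR (- (_ * _))).
    have [h|/ltnW h] := leqP i i0.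
      by rewrite distnEr// natrB// distrC ger0_norm// subr_ge0 ler_nat.
    by rewrite distnEl// natrB// ger0_norm// subr_ge0 ler_nat.
  apply: (le_trans _ (ler_wpM2r (expR_ge0 _) e4)).
  rewrite -expRD ler_expR -(real_normK (num_real (tau * _))) normrM (gtr0_norm t0).
  by have := sqr_ge0 (tau * `|i%:R - i0%:R| - 2^-1); lra.
have ti : 0 < tau^-1 by rewrite invr_gt0.
have : tau * tau^-1 = 1 by rewrite divff ?gt_eqF.
have : tau * (S * x) <= S * (1 - x).
  by rewrite mulrCA ler_wpM2l//; lra.
move: (tau^-1) ti => i i0' ti h.
nra.
Qed.

(** The Fejér kernel normalised by [fejer M 0 = 1]: it is nonnegative, at least
    [1 / 4] on [[- 1 / M, 1 / M]], and a finite sum of cosines. *)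
Definition fejer (R : realType) (M : nat) (x : R) : R :=
  (M%:R ^+ 2)^-1 * \sum_(i < M) \sum_(j < M) cos ((i%:R - j%:R) * x).

Lemma fejerE (R : realType) (M : nat) (x : R) :
  fejer M x = (M%:R ^+ 2)^-1 *
    ((\sum_(i < M) cos (i%:R * x)) ^+ 2 + (\sum_(i < M) sin (i%:R * x)) ^+ 2).
Proof.
rewrite /fejer; congr (_ * _); rewrite !expr2 !mulr_suml -big_split/=.
apply: eq_bigr => i _; rewrite !mulr_sumr -big_split/=; apply: eq_bigr => j _.
by rewrite mulrBl cosB.
Qed.

Lemma fejer_ge0 (R : realType) (M : nat) (x : R) : 0 <= fejer M x.
Proof. by rewrite fejerE mulr_ge0 ?invr_ge0 ?sqr_ge0// addr_ge0 ?sqr_ge0. Qed.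

Lemma sin_le_id (R : realType) (x : R) : 0 <= x -> `|sin x| <= x.
Proof.
move=> x0.
have cs : {within `[0, x], continuous (@sin R)}.
  exact: continuous_subspaceT (@continuous_sin R).
have [c _] := MVT_segment x0 (fun y _ => is_derive_sin y) cs.
rewrite sin0 !subr0 => ->; rewrite normrM (ger0_norm x0) ler_piMl//.
exact: cos_max.
Qed.

Lemma cos_ge_half (R : realType) (x : R) : `|x| <= 1 -> 2^-1 <= cos x.
Proof.
move=> x1; have -> : cos x = cos (`|x|) by have [x0|x0] := ger0P x; rewrite ?cosN.
move: x1; have := normr_ge0 x; move: `|x| => y y0 y1.
have y2 : 0 <= y / 2 by lra.
have e : cos y = 1 - sin (y / 2) ^+ 2 *+ 2.
  have {1}-> : y = (y / 2) *+ 2 by rewrite -mulr_natr divfK.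
  by rewrite cos_mulr2n cos2sin2 mulrnBl; ring.
have := sin_le_id y2; rewrite e -(real_normK (num_real (sin (y / 2)))).
have := normr_ge0 (sin (y / 2)); move: `|sin _| => z; nra.
Qed.

Lemma fejer_ge (R : realType) (M : nat) (x : R) : (0 < M)%N -> `|x| <= M%:R^-1 ->
  4^-1 <= fejer M x.
Proof.
move=> M0 xM; have MR : 0 < M%:R :> R by rewrite ltr0n.
rewrite fejerE.
have C : M%:R / 2 <= \sum_(i < M) cos (i%:R * x).
  rewrite mulr_natl -[X in _ *+ X]card_ord -sumr_const; apply: ler_sum => i _.
  apply: cos_ge_half; rewrite normrM ger0_norm//.
  apply: (@le_trans _ _ (M%:R * M%:R^-1)); last by rewrite divff ?gt_eqF.
  by apply: ler_pM => //; rewrite ler_nat ltnW.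
have M2 : 0 < M%:R ^+ 2 :> R by rewrite exprn_gt0.
rewrite mulrC ler_pdivlMr//.
apply: (@le_trans _ _ ((M%:R / 2) ^+ 2)).
  by rewrite expr_div_n; lra.
apply: (@le_trans _ _ ((\sum_(i < M) cos (i%:R * x)) ^+ 2)).
  by rewrite lerXn2r// nnegrE ?divr_ge0// ?(le_trans _ C)// ?divr_ge0.
by rewrite lerDl sqr_ge0.
Qed.

(** The sines cancel by the symmetry [i <-> j], so multiplying by a Fejér kernel
    only shifts the phase of a cosine. *)
Lemma cos_fejer (R : realType) (M : nat) (x phi : R) :
  cos phi * fejer M x =
  (M%:R ^+ 2)^-1 * \sum_(i < M) \sum_(j < M) cos (phi + (i%:R - j%:R) * x).
Proof.
have S0 : \sum_(i < M) \sum_(j < M) sin ((i%:R - j%:R) * x) = 0.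
  have : \sum_(i < M) \sum_(j < M) sin ((i%:R - j%:R) * x) =
      - \sum_(i < M) \sum_(j < M) sin ((i%:R - j%:R) * x).
    rewrite {1}exchange_big/= -sumrN; apply: eq_bigr => i _.
    by rewrite -sumrN; apply: eq_bigr => j _; rewrite -sinN -mulNr opprB.
  lra.
rewrite /fejer mulrCA; congr (_ * _).
under [RHS]eq_bigr => i _ do under eq_bigr => j _ do rewrite cosD.
under [RHS]eq_bigr => i _ do rewrite sumrB -!mulr_sumr.
by rewrite sumrB -!mulr_sumr S0 mulr0 subr0.
Qed.

Lemma measurable_fejer (R : realType) (M : nat) : measurable_fun [set: R] (@fejer R M).
Proof.
apply: measurable_funM => //; apply: measurable_sum => i; apply: measurable_sum => j.
apply: measurableT_comp; last exact: measurable_funM.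
exact: continuous_measurable_fun (@continuous_cos R).
Qed.

Lemma fejer_le1 (R : realType) (M : nat) (x : R) : fejer M x <= 1.
Proof.
rewrite /fejer; case: M => [|M]; first by rewrite big_ord0 mulr0.
rewrite mulrC ler_pdivrMr ?exprn_gt0 ?ltr0n// mul1r.
apply: (@le_trans _ _ (\sum_(i < M.+1) \sum_(j < M.+1) 1)).
  by do 2 apply: ler_sum => ? _; exact: cos_le1.
by rewrite !sumr_const !card_ord -mulrnA natrM expr2.
Qed.

(** * Energy of linear combinations and local nondeterminism *)

Definition mvn_comb (R : realType) (b : R) (z : seq (R * R)) (s : R) : R :=
  \sum_(x <- z) x.1 * mvn b x.2 s.

(** Over the whole line this is the variance of the combination
    [sum x.1 * B x.2] of fractional Brownian motion; over a subset it is the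
    part of the variance explained by the noise in that subset. *)
Definition mvn_energy (R : realType) (b : R) (z : seq (R * R)) (A : set (measurableTypeR R)) : R :=
  (\int[leb]_(s in A) (mvn_comb b z s ^+ 2)) / mvn_const b.

Lemma mvn_comb_cons (R : realType) (b m t : R) z s :
  mvn_comb b ((m, t) :: z) s = m * mvn b t s + mvn_comb b z s.
Proof. by rewrite /mvn_comb big_cons. Qed.

Lemma mvn_comb_integral (R : realType) (b : R) (z : seq (R * R)) : - 2^-1 < b < 2^-1 ->
  leb.-integrable [set: measurableTypeR R] (EFin \o (fun s => mvn_comb b z s ^+ 2)) /\
  mvn_energy b z setT = \sum_(x <- z) \sum_(y <- z) x.1 * y.1 *
    (2^-1 * (`|x.2| `^ (2 * b + 1) + `|y.2| `^ (2 * b + 1) - `|x.2 - y.2| `^ (2 * b + 1))).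
Proof.
move=> bb.
have [i e] := @Rintegral_sqr_sum _ (measurableTypeR R) R leb R (mvn b)
  (fun t u => mvn_const b * (2^-1 * (`|t| `^ (2 * b + 1) + `|u| `^ (2 * b + 1) - `|t - u| `^ (2 * b + 1))))
  z (fun x y _ _ => mvn_covariance x.2 y.2 bb).
split; first exact: i.
rewrite /mvn_energy [X in X / _]e mulr_suml; apply: eq_bigr => x _.
rewrite mulr_suml; apply: eq_bigr => y _.
have J0 := mvn_const_gt0 bb.
by field; rewrite gt_eqF.
Qed.

Lemma mvn_comb_integrable (R : realType) (b : R) z (A : set (measurableTypeR R)) : - 2^-1 < b < 2^-1 ->
  measurable A -> leb.-integrable A (EFin \o (fun s => mvn_comb b z s ^+ 2)).
Proof.
move=> bb mA; have [i _] := mvn_comb_integral z bb.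
exact: (integrableS measurableT mA (@subsetT _ A) i).
Qed.

Lemma mvn_energy_le (R : realType) (b : R) z (A : set (measurableTypeR R)) : - 2^-1 < b < 2^-1 ->
  measurable A -> mvn_energy b z A <= mvn_energy b z setT.
Proof.
move=> bb mA; rewrite /mvn_energy ler_wpM2r//.
  by rewrite invr_ge0 ltW// mvn_const_gt0.
have iT := mvn_comb_integrable z bb measurableT.
have iA := mvn_comb_integrable z bb mA.
rewrite /Rintegral fine_le//.
- exact: (integrable_fin_num mA iA).
- exact: (integrable_fin_num measurableT iT).
- apply: ge0_subset_integral => //; first by case/integrableP : iT.
  by move=> x _; rewrite lee_fin sqr_ge0.
Qed.

(** By causality, adding a time [t] later than [u] does not change the energy
    below [- t]. *)
Lemma mvn_energy_cons (R : realType) (b m t u : R) z : - 2^-1 < b < 2^-1 ->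
  0 <= u <= t ->
  mvn_energy b ((m, t) :: z) `]-oo, (- u)%R[%classic =
  mvn_energy b z `]-oo, (- t)%R[%classic +
    mvn_energy b ((m, t) :: z) `[(- t)%R, (- u)%R[%classic.
Proof.
move=> bb /andP[u0 ut].
rewrite /mvn_energy -mulrDl; congr (_ / _).
have -> : (`]-oo, (- u)%R[%classic : set (measurableTypeR R)) =
    `]-oo, (- t)%R[%classic `|` `[(- t)%R, (- u)%R[%classic.
  apply/seteqP; split => x /=; rewrite !in_itv/=.
    by move=> xu; have [xt|xt] := ltP x (- t); [left|right; rewrite xu].
  by move=> [xt|/andP[]//]; rewrite (lt_le_trans xt)// lerN2.
rewrite Rintegral_setU//=; last 2 first.
- apply: mvn_comb_integrable => //; apply: measurableU; exact: measurable_itv.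
- apply/disj_setPS => x /= []; rewrite !in_itv/= => x1 /andP[x2 _].
  by have := lt_le_trans x1 x2; rewrite ltxx.
congr (_ + _).
apply: eq_Rintegral => x; rewrite inE/= in_itv/= => xt.
by rewrite mvn_comb_cons mvn_eq0 ?mulr0 ?add0r// ?(le_trans u0)// ltW.
Qed.

(** Local nondeterminism.  For a single [m] the energy in the slab can vanish,
    because the later times of [z] contribute there as well; but the energy is
    a quadratic polynomial in [m] with controlled leading coefficient, so it
    cannot be small at two distant values of [m]. *)
Lemma mvn_energy_parallelogram (R : realType) (b m m' t u : R) z : - 2^-1 < b < 2^-1 ->
  0 <= u -> u < t ->
  2^-1 * (m - m') ^+ 2 * ((t - u) `^ (2 * b + 1) / (4 * mvn_const b)) <=
  mvn_energy b ((m, t) :: z) `[(- t)%R, (- u)%R[%classic +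
    mvn_energy b ((m', t) :: z) `[(- t)%R, (- u)%R[%classic.
Proof.
move=> bb u0 ut; set A := [set` _].
have mA : measurable (A : set (measurableTypeR R)) by exact: measurable_itv.
have J0 := mvn_const_gt0 bb.
have i1 := mvn_comb_integrable ((m, t) :: z) bb mA.
have i2 := mvn_comb_integrable ((m', t) :: z) bb mA.
have i3 : leb.-integrable A (EFin \o (fun s => mvn b t s ^+ 2)).
  have -> : (fun s : measurableTypeR R => mvn b t s ^+ 2) = (fun s => mvn_comb b [:: (1, t)] s ^+ 2).
    by apply/funext => s; rewrite /mvn_comb big_seq1 mul1r.
  exact: mvn_comb_integrable.
have i3' : leb.-integrable A (EFin \o (fun s => 2^-1 * (m - m') ^+ 2 * mvn b t s ^+ 2)).
  exact: (integrableZl mA (2^-1 * (m - m') ^+ 2) i3).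
have low : (t - u) `^ (2 * b + 1) / 4 <= \int[leb]_(s in A) (mvn b t s ^+ 2).
  rewrite -lee_fin /Rintegral fineK; last exact: (integrable_fin_num mA i3).
  exact: mvn_sqr_integral_ge.
rewrite /mvn_energy -mulrDl -(RintegralD mA i1 i2).
rewrite ler_pdivlMr//.
apply: (@le_trans _ _ (2^-1 * (m - m') ^+ 2 * \int[leb]_(s in A) (mvn b t s ^+ 2))).
  have c0 : 0 <= 2^-1 * (m - m') ^+ 2 by rewrite mulr_ge0// sqr_ge0.
  apply: le_trans (ler_wpM2l c0 low); rewrite le_eqVlt; apply/orP; left; apply/eqP.
  by field; rewrite gt_eqF.
have <- : \int[leb]_(s in A) (2^-1 * (m - m') ^+ 2 * mvn b t s ^+ 2) =
    2^-1 * (m - m') ^+ 2 * \int[leb]_(s in A) (mvn b t s ^+ 2) by rewrite RintegralZl.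
apply: le_Rintegral => //.
  exact: (integrableD mA i1 i2).
move=> s _; rewrite !mvn_comb_cons.
(* The parallelogram identity
   [x ^ 2 + y ^ 2 = ((x - y) ^ 2 + (x + y) ^ 2) / 2]. *)
have := sqr_ge0 ((m + m') * mvn b t s + 2 * mvn_comb b z s).
nra.
Qed.

Lemma mvn_energy_ge0 (R : realType) (b : R) z (A : set (measurableTypeR R)) : - 2^-1 < b < 2^-1 ->
  0 <= mvn_energy b z A.
Proof.
move=> bb; rewrite divr_ge0 ?(ltW (mvn_const_gt0 bb))//.
by apply: Rintegral_ge0 => x _; exact: sqr_ge0.
Qed.

(** With [tau := lnd_const b * (t - u) ^ (b + 1 / 2)], the left side of
    [mvn_energy_parallelogram] equals [4 * (tau * (m - m')) ^ 2]. *)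
Definition lnd_const (R : realType) (b : R) : R := Num.sqrt (32 * mvn_const b)^-1.

Lemma lnd_const_gt0 (R : realType) (b : R) : - 2^-1 < b < 2^-1 -> 0 < lnd_const b.
Proof. by move=> bb; rewrite sqrtr_gt0 invr_gt0 mulr_gt0 ?mvn_const_gt0. Qed.

(** For fixed [j], let [i0] minimise the energy.  The parallelogram inequality
    against [i0] bounds every other energy below by a Gaussian profile
    centred at [i0], and [gaussian_sum_le] applies. *)
Lemma mvn_energy_sum (R : realType) (b t u : R) z (M : nat) : - 2^-1 < b < 2^-1 ->
  0 <= u -> u < t -> t <= 1 ->
  (M%:R ^+ 2)^-1 * (\sum_(i < M) \sum_(j < M)
    expR (- mvn_energy b ((i%:R - j%:R, t) :: z) `[(- t)%R, (- u)%R[%classic / 2)) <=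
  4 * (1 + (lnd_const b)^-1) / (M%:R * (t - u) `^ (b + 2^-1)).
Proof.
move=> bb u0 ut t1.
have h0 : 0 < t - u by rewrite subr_gt0.
have h1 : t - u <= 1 by lra.
have J0 := mvn_const_gt0 bb; have c0 := lnd_const_gt0 bb.
case: M => [|M].
  by rewrite big_ord0 mulr0 mul0r invr0 mulr0.
have bp : 0 < b + 2^-1 by move/andP : bb => [? _]; lra.
pose tau := lnd_const b * (t - u) `^ (b + 2^-1).
have p0 : 0 < (t - u) `^ (b + 2^-1) by rewrite powR_gt0.
have p1 : (t - u) `^ (b + 2^-1) <= 1.
  rewrite -[leRHS](powRr0 (t - u)); apply: ger_powR; rewrite ?h0// ltW//.
have tau0 : 0 < tau by rewrite mulr_gt0.
pose E m := mvn_energy b ((m, t) :: z) `[(- t)%R, (- u)%R[%classic.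
have par m m' : 4 * (tau * (m - m')) ^+ 2 <= E m + E m'.
  apply: le_trans (mvn_energy_parallelogram m m' z bb u0 ut).
  rewrite exprMn /tau exprMn powR_sqr /lnd_const sqr_sqrtr; last first.
    by rewrite invr_ge0 mulr_ge0// ltW.
  have -> : 2 * (b + 2^-1) = 2 * b + 1 by field.
  rewrite le_eqVlt; apply/orP; left; apply/eqP.
  by field; rewrite gt_eqF.
have row (j : 'I_M.+1) : \sum_(i < M.+1) expR (- E (i%:R - j%:R) / 2) <= 4 * (1 + tau^-1).
  have [i0 _ /= Pi0] := @arg_minP _ R 'I_M.+1 ord0 xpredT (fun i => E (i%:R - j%:R)) isT.
  apply: le_trans (gaussian_sum_le i0 M.+1 tau0); apply: ler_sum => i _.
  rewrite ler_expR mulNr lerN2.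
  have := par (i%:R - j%:R) (i0%:R - j%:R); have := Pi0 i isT.
  have -> : i%:R - j%:R - (i0%:R - j%:R) = i%:R - i0%:R :> R by ring.
  by move: (E _) (E _) (_ ^+ 2) => x y q; lra.
have -> : \sum_(i < M.+1) \sum_(j < M.+1) expR (- E (i%:R - j%:R) / 2) =
    \sum_(j < M.+1) \sum_(i < M.+1) expR (- E (i%:R - j%:R) / 2) by rewrite exchange_big.
apply: (@le_trans _ _ ((M.+1%:R ^+ 2)^-1 * (M.+1%:R * (4 * (1 + tau^-1))))).
  apply: ler_wpM2l; first by rewrite invr_ge0 sqr_ge0.
  apply: (@le_trans _ _ (\sum_(j < M.+1) (4 * (1 + tau^-1)))).
    by apply: ler_sum => j _; exact: row.
  by rewrite sumr_const card_ord [leRHS]mulr_natl.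
have MR : 0 < M.+1%:R :> R by rewrite ltr0n.
have -> : (M.+1%:R ^+ 2)^-1 * (M.+1%:R * (4 * (1 + tau^-1))) = 4 * (1 + tau^-1) / M.+1%:R.
  by field; rewrite !gt_eqF.
set p := (t - u) `^ _ in p0 p1 tau tau0 par row *.
have -> : 4 * (1 + (lnd_const b)^-1) / (M.+1%:R * p) =
    4 * ((1 + (lnd_const b)^-1) * p^-1) / M.+1%:R by field; rewrite !gt_eqF.
rewrite ler_wpM2r ?invr_ge0// ler_wpM2l// /tau mulrDl mul1r invfM lerD2r.
by rewrite invf_ge1.
Qed.

(** * First and second moments of fractional Brownian motion *)

Lemma fbm_covariance_integral d (T : measurableType d) (R : realType) (P : probability T R)
    (alpha : R) (B : R -> {RV P >-> R}) (s t : R) :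
  fractional_brownian_motion01 P alpha B -> 0 <= s <= 1 -> 0 <= t <= 1 ->
  P.-integrable setT (EFin \o (fun w => B s w * B t w)) /\
  \int[P]_w (B s w * B t w) =
    2^-1 * (`|s| `^ (2 * alpha) + `|t| `^ (2 * alpha) - `|s - t| `^ (2 * alpha)).
Proof.
move=> hB s01 t01.
have mB u : measurable_fun [set: T] (B u) by exact: measurable_funP.
have sq u : 0 <= u <= 1 -> P.-integrable setT (EFin \o (fun w => B u w ^+ 2)).
  move=> u01; have := fbm_covariance hB u01 u01; rewrite unlock => e.
  apply/integrableP; split.
    by apply/measurable_EFinP; exact: measurable_funX.
  rewrite (eq_integral (fun w => (B u w * B u w)%:E)); first by rewrite e ltry.
  by move=> w _ /=; rewrite ger0_norm ?sqr_ge0.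
have cov := fbm_covariance hB t01 s01; rewrite unlock in cov.
split; last by rewrite /Rintegral cov.
apply: (le_integrable measurableT _ _ (integrableD measurableT (sq s s01) (sq t t01))).
  by apply/measurable_EFinP; exact: measurable_funM.
move=> w _; rewrite -EFinD !abse_EFin lee_fin [leRHS]ger0_norm ?addr_ge0 ?sqr_ge0//.
rewrite ler_norml; have := sqr_ge0 (B s w + B t w); have := sqr_ge0 (B s w - B t w).
by have := sqr_ge0 (B s w); have := sqr_ge0 (B t w); move: (B s w) (B t w) => x y; nra.
Qed.

(** Positive times have the given normal law up to scaling; at time [0] the
    variable vanishes almost surely. *)
Lemma fbm_mean d (T : measurableType d) (R : realType) (P : probability T R)
    (alpha : R) (B : R -> {RV P >-> R}) (t : R) :
  fractional_brownian_motion01 P alpha B -> 0 <= t <= 1 ->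
  P.-integrable setT (EFin \o B t) /\ \int[P]_w B t w = 0.
Proof.
move=> hB t01; have /andP[t0 t1] := t01.
have mB : measurable_fun [set: T] (B t) by exact: measurable_funP.
move: t0; rewrite le_eqVlt => /orP[/eqP t0|t0].
  have ae0 : ae_eq P setT (EFin \o B t) (cst 0%E).
    by apply: filterS (fbm_start hB) => w e _ /=; rewrite -t0 e.
  have m0 : measurable_fun [set: T] (EFin \o B t) by exact/measurable_EFinP.
  split.
    have [isq _] := fbm_covariance_integral hB t01 t01.
    have i1 : P.-integrable setT (EFin \o cst 1) by exact: finite_measure_integrable_cst.
    apply: (le_integrable measurableT m0 _ (integrableD measurableT i1 isq)) => w _.
    rewrite -EFinD !abse_EFin lee_fin /cst/= -expr2 [leRHS]ger0_norm ?addr_ge0 ?sqr_ge0//.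
    exact: ler_norm_1Dsqr.
  by rewrite /Rintegral (ae_eq_integral (cst 0%E))// integral0.
have ta : 0 < t `^ (- alpha) by rewrite powR_gt0.
pose Z w := t `^ (- alpha) * B t w.
have mZ : measurable_fun [set: T] Z by exact: measurable_funM.
have lawZ : forall A : set R, measurable A -> pushforward P Z A = normal_prob 0 1 A.
  by apply: (fbm_normal hB); rewrite t0.
have [EZ _] := gaussian_law_mean_variance (@ltr01 R) mZ lawZ.
have bid x : `|id x| <= 1 * (1 + (x - 0) ^+ 2) :> R by rewrite subr0 mul1r ler_norm_1Dsqr.
have [iZ _] := gaussian_law_integrable (@ltr01 R) mZ lawZ (@measurable_id _ R setT) bid.
have e : B t = (fun w => (t `^ (- alpha))^-1 * Z w) :> (T -> R).
  by apply/funext => w; rewrite /Z mulrA mulVf ?mul1r// gt_eqF.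
rewrite e; split; first exact: (integrableZl measurableT _ iZ).
by rewrite RintegralZl// EZ mulr0.
Qed.

(** The combination is a centred Gaussian variable whose variance is the total
    energy. *)
Lemma fbm_comb_charfun d (T : measurableType d) (R : realType) (P : probability T R)
    (alpha : R) (B : R -> {RV P >-> R}) (z : seq (R * R)) (phi : R) :
  0 < alpha < 1 -> fractional_brownian_motion01 P alpha B ->
  (forall x, x \in z -> 0 <= x.2 <= 1) ->
  \int[P]_w cos (\sum_(x <- z) x.1 * B x.2 w + phi) <=
    expR (- mvn_energy (alpha - 2^-1) z setT / 2).
Proof.
move=> /andP[a0 a1] hB z01.
have bb : - 2^-1 < alpha - 2^-1 < 2^-1 by apply/andP; split; lra.
have mB u : measurable_fun [set: T] (B u) by exact: measurable_funP.
pose Z w := \sum_(x <- z) x.1 * B x.2 w.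
have mZ : measurable_fun [set: T] Z.
  by apply: measurable_sum => x; exact: measurable_funM.
have gZ : is_gaussian P Z.
  pose tt (i : 'I_(size z)) := (nth (0, 0) z i).2.
  pose cc (i : 'I_(size z)) := (nth (0, 0) z i).1.
  have := fbm_gaussian hB (t := tt) cc.
  have -> : Z = (fun w => \sum_(i < size z) cc i * B (tt i) w).
    by apply/funext => w; rewrite /Z (big_nth (0, 0)) big_mkord.
  by apply=> i; rewrite /= in_itv/= z01// mem_nth.
have EZ : \int[P]_w Z w = 0.
  pose h (x : R * R) w := if x \in z then x.1 * B x.2 w else 0.
  have ih x : P.-integrable setT (EFin \o h x) /\ \int[P]_w h x w = 0.
    rewrite /h; case E : (x \in z); last first.
      by split; [exact: integrable0|rewrite /Rintegral integral0].
    have [iB EB] := fbm_mean hB (z01 _ E).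
    split; first exact: (integrableZl measurableT x.1 iB).
    by rewrite RintegralZl// EB mulr0.
  have -> : Z = (fun w => \sum_(x <- z) h x w).
    by apply/funext => w; apply: eq_big_seq => x xz; rewrite /h xz.
  have [_ ->] := integrable_sum_Rintegral z measurableT (fun x => (ih x).1).
  by apply: big1 => x _; rewrite (ih x).2.
have := gaussian_charfun_le phi mZ gZ EZ.
have [_ ->] := mvn_comb_integral z bb.
have [_ ->] := @Rintegral_sqr_sum _ T R P R (fun u w => B u w)
  (fun s t => 2^-1 * (`|s| `^ (2 * alpha) + `|t| `^ (2 * alpha) - `|s - t| `^ (2 * alpha))) z
  (fun x y xz yz => fbm_covariance_integral hB (z01 x xz) (z01 y yz)).
suff -> : 2 * (alpha - 2^-1) + 1 = 2 * alpha by [].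
by field.
Qed.

(** * Joint small-ball estimate *)

(** Up to a factor [4] per time, a bound for the probability that [B] is within
    [1 / M] of a given point at all the times [ts], listed from the latest to
    the earliest; the earliest one is compared with time [0], where [B]
    starts. *)
Fixpoint chain_weight (R : realType) (C alpha : R) (M : nat) (ts : seq R) : R :=
  if ts is t :: ts' then
    C / (M%:R * (t - head 0 ts') `^ alpha) * chain_weight C alpha M ts'
  else 1.

Fixpoint decreasing_times (R : realType) (ts : seq R) : bool :=
  if ts is t :: ts' then [&& head 0 ts' < t, t <= 1 & decreasing_times ts'] else true.

Lemma decreasing_times_head (R : realType) (ts : seq R) :
  decreasing_times ts -> 0 <= head 0 ts <= 1.
Proof.
elim: ts => [|t ts IH] /=; first by rewrite lexx ler01.
by move=> /and3P[ht -> /IH /andP[h0 _]]; rewrite (le_trans h0) ?ltW.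
Qed.

Lemma bounded_integrable d (T : measurableType d) (R : realType) (P : probability T R)
    (f : T -> R) (K : R) : measurable_fun setT f -> (forall w, `|f w| <= K) ->
  P.-integrable setT (EFin \o f).
Proof.
move=> mf fK.
have iK : P.-integrable setT (EFin \o cst K) by exact: finite_measure_integrable_cst.
apply: (le_integrable measurableT _ _ iK); first exact/measurable_EFinP.
by move=> w _; rewrite /= lee_fin (le_trans (fK w))// ler_norm.
Qed.

Lemma fejer_prod_bound (R : realType) (M : nat) (I : Type) (ts : seq I) (x : I -> R) :
  0 <= \prod_(t <- ts) fejer M (x t) <= 1.
Proof.
elim: ts => [|t ts /andP[h0 h1]]; first by rewrite big_nil ler01 lexx.
rewrite big_cons mulr_ge0 ?fejer_ge0//= mulr_ile1 ?fejer_ge0//.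
exact: fejer_le1.
Qed.

(** Induction on the times, from the latest to the earliest.  The combination
    [z] collects the frequencies produced by the kernels of later times, and
    the exponential keeps the energy of [z] that the slabs of [ts] do not use.
    Expanding the kernel at the next time [t] adds [(i - j, t)] to [z]; the
    energy then splits into the part below [- t], which is that of [z] alone,
    and the part in the new slab, which [mvn_energy_sum] sums over
    [i] and [j]. *)
Lemma fbm_joint_fejer d (T : measurableType d) (R : realType) (P : probability T R)
    (alpha : R) (B : R -> {RV P >-> R}) (M : nat) (y : R) (ts : seq R) :
  0 < alpha < 1 -> fractional_brownian_motion01 P alpha B -> decreasing_times ts ->
  forall (z : seq (R * R)) (phi : R), (forall x, x \in z -> 0 <= x.2 <= 1) ->
  \int[P]_w (cos (\sum_(x <- z) x.1 * B x.2 w + phi) *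
             \prod_(t <- ts) fejer M (B t w - y)) <=
  chain_weight (4 * (1 + (lnd_const (alpha - 2^-1))^-1)) alpha M ts *
    expR (- mvn_energy (alpha - 2^-1) z `]-oo, (- head 0 ts)%R[%classic / 2).
Proof.
move=> a01 hB; have /andP[a0 a1] := a01.
have bb : - 2^-1 < alpha - 2^-1 < 2^-1 by apply/andP; split; lra.
set C := 4 * _.
have C0 : 0 < C by rewrite mulr_gt0// addr_gt0// invr_gt0 lnd_const_gt0.
have mB u : measurable_fun [set: T] (B u) by exact: measurable_funP.
have mcos (z : seq (R * R)) (phi : R) :
    measurable_fun [set: T] (fun w => cos (\sum_(x <- z) x.1 * B x.2 w + phi)).
  apply: measurableT_comp; first exact: continuous_measurable_fun (@continuous_cos R).
  apply: measurable_funD => //; apply: measurable_sum => x; exact: measurable_funM.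
have mprod (r : seq R) : measurable_fun [set: T] (fun w => \prod_(t <- r) fejer M (B t w - y)).
  apply: measurable_prod => t _; apply: measurableT_comp; first exact: measurable_fejer.
  exact: measurable_funB.
have W0 (r : seq R) : decreasing_times r -> 0 <= chain_weight C alpha M r.
  elim: r => [|t r IH]//= /and3P[h1 _ h2].
  by rewrite mulr_ge0 ?IH// divr_ge0 ?(ltW C0)// mulr_ge0// powR_ge0.
elim: ts => [|t ts IH] hts z phi z01.
  rewrite [X in X <= _](_ : _ = \int[P]_w cos (\sum_(x <- z) x.1 * B x.2 w + phi)); last first.
    by apply: eq_Rintegral => w _; rewrite big_nil mulr1.
  apply: (le_trans (fbm_comb_charfun phi a01 hB z01)).
  rewrite mul1r ler_expR ler_pM2r// lerN2.
  exact: (mvn_energy_le z bb (measurable_itv _)).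
have /and3P[ht t1 hts'] := hts.
have /andP[hd0 hd1] := decreasing_times_head hts'.
have zt01 (m : R) x : x \in (m, t) :: z -> 0 <= x.2 <= 1.
  by rewrite inE => /orP[/eqP -> /=|/z01//]; rewrite t1 andbT (le_trans hd0)// ltW.
pose g (i j : 'I_M) w := (M%:R ^+ 2)^-1 *
  (cos (\sum_(x <- (i%:R - j%:R, t) :: z) x.1 * B x.2 w + (phi - (i%:R - j%:R) * y)) *
   \prod_(s <- ts) fejer M (B s w - y)).
have ig i j : P.-integrable setT (EFin \o g i j).
  apply: (@bounded_integrable _ _ _ _ _ ((M%:R ^+ 2)^-1)).
    by apply: measurable_funM => //; apply: measurable_funM => //; exact: mcos.
  move=> w; rewrite normrM ger0_norm ?invr_ge0 ?sqr_ge0// ler_piMr ?invr_ge0 ?sqr_ge0//.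
  have /andP[p0 p1] := fejer_prod_bound M ts (fun s => B s w - y).
  by rewrite normrM mulr_ile1// ?cos_max// ger0_norm.
have ig2 i := integrable_sum_Rintegral (index_enum 'I_M) measurableT (ig i).
have ig3 := integrable_sum_Rintegral (index_enum 'I_M) measurableT (fun i => (ig2 i).1).
rewrite [X in X <= _](_ : _ = \int[P]_w (\sum_(i < M) \sum_(j < M) g i j w)); last first.
  apply: eq_Rintegral => w _; rewrite big_cons mulrA cos_fejer -mulrA mulr_suml mulr_sumr.
  apply: eq_bigr => i _; rewrite mulr_suml mulr_sumr; apply: eq_bigr => j _.
  rewrite /g big_cons/=; congr (_ * (cos _ * _)); ring.
rewrite ig3.2.
set w' := chain_weight C alpha M ts; have w0 : 0 <= w' by exact: W0.
pose E m A := mvn_energy (alpha - 2^-1) ((m, t) :: z) A.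
apply: (@le_trans _ _ (\sum_(i < M) \sum_(j < M) (M%:R ^+ 2)^-1 *
   (w' * expR (- E (i%:R - j%:R) `]-oo, (- head 0 ts)%R[%classic / 2)))).
  apply: ler_sum => i _; rewrite (ig2 i).2; apply: ler_sum => j _.
  rewrite /g RintegralZl//; last first.
    apply: (@bounded_integrable _ _ _ _ _ 1).
      by apply: measurable_funM => //; exact: mcos.
    move=> w; have /andP[p0 p1] := fejer_prod_bound M ts (fun s => B s w - y).
    by rewrite normrM mulr_ile1// ?cos_max// ger0_norm.
  apply: ler_wpM2l; first by rewrite invr_ge0 sqr_ge0.
  by apply: IH => //; exact: zt01.
have hdt : 0 <= head 0 ts <= t by rewrite hd0 ltW.
rewrite /= -/w'.
set Ez := mvn_energy _ z _.
have split_exp (m : R) : expR (- E m `]-oo, (- head 0 ts)%R[%classic / 2) =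
   expR (- Ez / 2) * expR (- E m `[(- t)%R, (- head 0 ts)%R[%classic / 2).
  by rewrite -expRD /E mvn_energy_cons// opprD mulrDl.
have -> : \sum_(i < M) \sum_(j < M) (M%:R ^+ 2)^-1 *
   (w' * expR (- E (i%:R - j%:R) `]-oo, (- head 0 ts)%R[%classic / 2)) =
   w' * expR (- Ez / 2) * ((M%:R ^+ 2)^-1 * \sum_(i < M) \sum_(j < M)
      expR (- E (i%:R - j%:R) `[(- t)%R, (- head 0 ts)%R[%classic / 2)).
  rewrite !mulr_sumr; apply: eq_bigr => i _; rewrite !mulr_sumr; apply: eq_bigr => j _.
  by rewrite split_exp; ring.
rewrite [leRHS](_ : _ = w' * expR (- Ez / 2) * (C / (M%:R * (t - head 0 ts) `^ alpha))); last by ring.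
apply: ler_wpM2l; first by rewrite mulr_ge0// expR_ge0.
have := mvn_energy_sum z M bb hd0 ht t1.
by rewrite subrK.
Qed.

(** * Moments of the number of visits *)

Fixpoint subsequences (T : Type) (p : nat) (s : seq T) : seq (seq T) :=
  match p, s with
  | 0%N, _ => [:: [::]]
  | _.+1, [::] => [::]
  | p'.+1, k :: s' => [seq k :: c | c <- subsequences p' s'] ++ subsequences p s'
  end.

(** A combinatorial Markov inequality: the right side is the elementary symmetric
    sum of the [e k], and it dominates the number of [p]-subsets of the entries
    satisfying [a]. *)
Lemma sum_subsequences_ge (R : realType) (T : Type) (e : T -> R) (a : pred T) (p : nat) (s : seq T) :
  (forall k, 0 <= e k) -> (forall k, a k -> 1 <= e k) ->
  'C(count a s, p)%:R <= \sum_(c <- subsequences p s) \prod_(k <- c) e k.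
Proof.
move=> e0 e1; elim: s p => [|k s IH] [|p] /=; rewrite ?bin0 ?big_seq1 ?big_nil//.
rewrite big_cat big_map/=.
under eq_bigr do rewrite big_cons.
rewrite -mulr_sumr; have S0 : 0 <= \sum_(c <- subsequences p s) \prod_(k <- c) e k.
  by apply: sumr_ge0 => c _; apply: prodr_ge0.
case: (boolP (a k)) => ak /=.
  rewrite add1n binS natrD addrC lerD//.
  by apply: (le_trans (IH p)); rewrite ler_peMl// e1.
by rewrite add0n (le_trans (IH _))// lerDr mulr_ge0.
Qed.

Lemma subsequences_mem (T : eqType) (p : nat) (s c : seq T) :
  c \in subsequences p s -> subseq c s /\ size c = p.
Proof.
elim: s p c => [|k s IH] [|p] c /=; rewrite ?inE; try by move=> /eqP ->; rewrite ?sub0seq.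
  by [].
rewrite mem_cat => /orP[/mapP[c' /IH[c's sc'] ->]|/IH[cs sc]].
  by rewrite /= eqxx sc'.
split=> //; exact: subseq_trans cs (subseq_cons _ _).
Qed.

Definition nat_times (R : realType) (m : nat) (c : seq nat) : seq R :=
  [seq k%:R / m%:R | k <- c].

Lemma head_nat_times (R : realType) (m : nat) (c : seq nat) :
  head 0 (nat_times R m c) = (head 0%N c)%:R / m%:R.
Proof. by case: c => //=; rewrite mul0r. Qed.

Lemma decreasing_nat_times (R : realType) (m : nat) (c : seq nat) : (0 < m)%N ->
  sorted gtn c -> all (fun k => (0 < k <= m)%N) c -> decreasing_times (nat_times R m c).
Proof.
move=> m0; have mR : 0 < m%:R :> R by rewrite ltr0n.
elim: c => [|k c IH]//= kc /andP[/andP[k0 km] ac]; apply/and3P; split.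
- rewrite head_nat_times ltr_pM2r ?invr_gt0// ltr_nat.
  by case: c kc ac {IH} => [|k' c]//= /andP[].
- by rewrite ler_pdivrMr// mul1r ler_nat.
- by apply: IH => //; exact: path_sorted kc.
Qed.

(** The weight of a chain factors along consecutive entries, so the sum over
    chains is at most the product of the sums over one step. *)
Section chain_sum.
Context (R : realType) (C alpha Lam : R) (M m : nat) (U : pred nat).

Let u (k k' : nat) : R := C / (M%:R * ((k%:R - k'%:R) / m%:R) `^ alpha).
Let wt (c : seq nat) : R := chain_weight C alpha M (nat_times R m c).

Hypotheses (C0 : 0 <= C) (Lam0 : 0 <= Lam).
Hypothesis first_le : forall k, U k -> u k 0 <= Lam.
Hypothesis next_le : forall k s, U k -> all U s -> path gtn k s -> \sum_(k' <- s) u k k' <= Lam.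

Let u0 k k' : 0 <= u k k'.
Proof. by rewrite /u divr_ge0// mulr_ge0// powR_ge0. Qed.

Let wt_cons k c : wt (k :: c) = u k (head 0%N c) * wt c.
Proof. by rewrite /wt /= head_nat_times -mulrBl. Qed.

Let chain_sum_from p k s : U k -> all U s -> path gtn k s ->
  \sum_(c <- subsequences p s) wt (k :: c) <= Lam ^+ p.+1.
Proof.
elim: p k s => [|p IHp] k s Uk Us ks.
  case: s ks Us => [|? ?] _ _; rewrite /= big_seq1 wt_cons expr1 /wt/= mulr1; exact: first_le.
suff : \sum_(c <- subsequences p.+1 s) wt (k :: c) <= (\sum_(k' <- s) u k k') * Lam ^+ p.+1.
  by move=> /le_trans; apply; rewrite [leRHS]exprS ler_wpM2r ?exprn_ge0// next_le.
elim: s ks Us => [|k' s IHs] ks /= Us; first by rewrite !big_nil mul0r.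
have /andP[Uk' {}Us] := Us; have /andP[k'k k's] := ks.
rewrite big_cat big_map/= big_cons mulrDl lerD//; last first.
  apply: IHs => //; case: (s) k's => // a r /andP[ha pr].
  by apply/andP; split=> //; exact: ltn_trans ha k'k.
under eq_bigr do rewrite wt_cons/=.
by rewrite -mulr_sumr ler_wpM2l// IHp.
Qed.

Lemma chain_sum_le p s : all U s -> sorted gtn s ->
  \sum_(c <- subsequences p.+1 s) chain_weight C alpha M (nat_times R m c) <=
  (size s)%:R * Lam ^+ p.+1.
Proof.
elim: s => [|k s IH] /= Us ks; first by rewrite big_nil mul0r.
have /andP[Uk {}Us] := Us.
rewrite big_cat big_map/= -natr1 mulrDl mul1r addrC lerD//.
  by apply: IH => //; exact: path_sorted ks.
exact: chain_sum_from.
Qed.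

End chain_sum.

Lemma measurable_count_ge d (T : measurableType d) (R : realType) (X : nat -> T -> R)
    (L : nat) (s : seq nat) (y r : R) : (forall k, measurable_fun setT (X k)) ->
  measurable [set w | (L <= count (fun k => (`|X k w - y| <= r)%R) s)%N].
Proof.
move=> mX; pose a w (k : nat) := `|X k w - y| <= r.
have mak k : measurable [set w | a w k].
  have -> : [set w | a w k] = (fun w => `|X k w - y|) @^-1` `]-oo, r].
    by apply/seteqP; split => w /=; rewrite /a in_itv.
  rewrite -[X in measurable X]setTI.
  have mf : measurable_fun [set: T] (fun w => `|X k w - y|).
    by apply: measurableT_comp => //; exact: measurable_funB.
  by apply: mf => //; exact: measurable_itv.
pose g w : R := \sum_(k <- s) \1_[set w | a w k] w.
have gE w : g w = (count (a w) s)%:R.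
  rewrite /g -sum1_count natr_sum [RHS]big_mkcond; apply: eq_bigr => k _.
  rewrite indicE; case: (boolP (a w k)) => h; first by rewrite mem_set.
  by rewrite memNset//; exact/negP.
have mg : measurable_fun [set: T] g.
  by apply: measurable_sum => k; exact: measurable_indic.
rewrite (_ : [set w | _] = g @^-1` `[L%:R, +oo[).
  by rewrite -[X in measurable X]setTI; apply: mg => //; exact: measurable_itv.
by apply/seteqP; split => w /=; rewrite in_itv/= andbT gE ler_nat.
Qed.

(** At least [L] visits produce at least [C(L, p + 1)] chains of visits, each of
    which makes the product of [4 * fejer] at its times at least [1]. *)
Lemma fbm_count_bound d (T : measurableType d) (R : realType) (P : probability T R)
    (alpha : R) (B : R -> {RV P >-> R}) (M m p L : nat) (Lam y : R) (s : seq nat) :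
  let C := 4 * (1 + (lnd_const (alpha - 2^-1))^-1) in
  let u k k' := C / (M%:R * ((k%:R - k'%:R) / m%:R) `^ alpha) in
  0 < alpha < 1 -> fractional_brownian_motion01 P alpha B -> (0 < M)%N -> (0 < m)%N -> 0 <= Lam ->
  sorted gtn s -> all (fun k => (0 < k <= m)%N) s ->
  (forall k, k \in s -> u k 0%N <= Lam) ->
  (forall k r, k \in s -> {subset r <= s} -> path gtn k r -> \sum_(k' <- r) u k k' <= Lam) ->
  ('C(L, p.+1)%:R%:E * P [set w | (L <= count (fun k => (`|B (k%:R / m%:R) w - y| <= M%:R^-1)%R) s)%N] <=
    (4 ^+ p.+1 * ((size s)%:R * Lam ^+ p.+1))%:E)%E.
Proof.
move=> C u a01 hB M0 m0 Lam0 ss sm first_le next_le.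
have bb : - 2^-1 < alpha - 2^-1 < 2^-1 by move/andP : a01 => [? ?]; apply/andP; split; lra.
have C0 : 0 < C by rewrite mulr_gt0// addr_gt0// invr_gt0 lnd_const_gt0.
have mB v : measurable_fun [set: T] (B v) by exact: measurable_funP.
pose F (c : seq nat) w := \prod_(k <- c) fejer M (B (k%:R / m%:R) w - y).
have mF c : measurable_fun [set: T] (F c).
  apply: measurable_prod => t _; apply: measurableT_comp; first exact: measurable_fejer.
  exact: measurable_funB.
have F01 c w : 0 <= F c w <= 1 by exact: fejer_prod_bound.
have iF c : P.-integrable setT (EFin \o F c).
  by apply: (@bounded_integrable _ _ _ _ _ 1) => // w; have /andP[h0 h1] := F01 c w; rewrite ger0_norm.
have EF c : c \in subsequences p.+1 s -> \int[P]_w F c w <= chain_weight C alpha M (nat_times R m c).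
  move=> /subsequences_mem[cs _].
  have dec : decreasing_times (nat_times R m c).
    apply: decreasing_nat_times => //.
      by apply: subseq_sorted cs ss => a b e /= h1 h2; exact: ltn_trans h2 h1.
    by apply/allP => k /(mem_subseq cs) ks; exact: (allP sm).
  have z0 (x : R * R) : x \in [::] -> 0 <= x.2 <= 1 by rewrite in_nil.
  have := fbm_joint_fejer M y a01 hB dec 0 z0.
  rewrite [X in X <= _ -> _](_ : _ = \int[P]_w F c w); last first.
    by apply: eq_Rintegral => w _; rewrite big_nil addr0 cos0 mul1r /F big_map.
  move=> /le_trans; apply; rewrite -/C ler_piMr//.
    by elim: (c) => [|k c' IH] //=; rewrite mulr_ge0// divr_ge0 ?(ltW C0)// mulr_ge0// powR_ge0.
  by rewrite -[leRHS]expR0 ler_expR mulNr oppr_le0 divr_ge0// mvn_energy_ge0.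
pose a w (k : nat) := `|B (k%:R / m%:R) w - y| <= M%:R^-1.
pose A := [set w | (L <= count (a w) s)%N].
have mA : measurable A.
  exact: (measurable_count_ge L s y (M%:R^-1) (fun k : nat => mB (k%:R / m%:R))).
pose G c w := 4 ^+ p.+1 * F c w.
have iG c : P.-integrable setT (EFin \o G c) by exact: (integrableZl measurableT _ (iF c)).
have [iS ES] := integrable_sum_Rintegral (subsequences p.+1 s) measurableT iG.
have ptw w : 'C(L, p.+1)%:R * \1_A w <= \sum_(c <- subsequences p.+1 s) G c w.
  have S0 : 0 <= \sum_(c <- subsequences p.+1 s) G c w.
    by apply: sumr_ge0 => c _; rewrite mulr_ge0 ?exprn_ge0//; have /andP[] := F01 c w.
  rewrite indicE; case: (boolP (w \in A)) => [|_]; last by rewrite mulr0.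
  rewrite inE/= mulr1 => Lw.
  have e0 (k : nat) : 0 <= 4 * fejer M (B (k%:R / m%:R) w - y) by rewrite mulr_ge0 ?fejer_ge0.
  have e1 (k : nat) : a w k -> 1 <= 4 * fejer M (B (k%:R / m%:R) w - y).
    by move=> ak; rewrite -[leLHS](@divff _ 4)// ler_wpM2l// fejer_ge.
  have := sum_subsequences_ge p.+1 s e0 e1.
  have CL : 'C(L, p.+1)%:R <= 'C(count (a w) s, p.+1)%:R :> R.
    by rewrite ler_nat leq_bin2l.
  move=> /(le_trans CL) /le_trans; apply.
  rewrite le_eqVlt; apply/orP; left; apply/eqP; apply: eq_big_seq => c /subsequences_mem[_ sc].
  by rewrite big_split/= big_const_seq count_predT iter_mulr_1 sc.
have -> : ('C(L, p.+1)%:R%:E * P A = \int[P]_w ('C(L, p.+1)%:R * \1_A w)%:E)%E.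
  under eq_integral do rewrite EFinM.
  rewrite ge0_integralZl//=; last first.
    exact/measurable_EFinP/measurable_indic.
  by rewrite integral_indic// setIT.
apply: (@le_trans _ _ (\int[P]_w (\sum_(c <- subsequences p.+1 s) G c w)%:E)%E).
  have mI : measurable_fun [set: T] (EFin \o (fun w => 'C(L, p.+1)%:R * \1_A w : R)).
    by apply/measurable_EFinP; apply: measurable_funM => //; exact: measurable_indic.
  have mS : measurable_fun [set: T] (EFin \o (fun w => \sum_(c <- subsequences p.+1 s) G c w)).
    by case/integrableP : iS.
  apply: (ge0_le_integral _ measurableT _ mI mS).
    by move=> w _; rewrite lee_fin mulr_ge0.
  by move=> w _; rewrite lee_fin.
rewrite -[leLHS]fineK ?(integrable_fin_num measurableT iS)// lee_fin.
rewrite -/(Rintegral _ _ _) ES.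
apply: (@le_trans _ _ (4 ^+ p.+1 * \sum_(c <- subsequences p.+1 s) chain_weight C alpha M (nat_times R m c))).
  rewrite mulr_sumr big_seq [leRHS]big_seq; apply: ler_sum => c cs.
  by rewrite RintegralZl// ler_wpM2l ?exprn_ge0// EF.
apply: ler_wpM2l; first by rewrite exprn_ge0.
apply: (@chain_sum_le _ _ _ _ _ _ (mem s)) => //.
  exact: ltW.
by move=> k r ks /allP rs; exact: next_le.
Qed.

(** * Cells that meet a set of controlled Assouad dimension *)

Lemma mdistRE (R : realType) (x y : R^o) : mdist x y = `|y - x|.
Proof. by []. Qed.

Definition hits (R : realType) (E : set R^o) (m k : nat) : bool :=
  `[< exists2 x : R, E x & k%:R <= m%:R * x < k.+1%:R >].

(** In decreasing order, which is the order of chains; the cell of [0] is left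
    out because [B 0] is degenerate. *)
Definition hit_list (R : realType) (E : set R^o) (m : nat) : seq nat :=
  [seq k <- rev (iota 1 m) | hits E m k].

(** The infimum over naturals that defines a finite covering number is attained. *)
Lemma covering_number_attained (R : realType) (T : metricType R) (X A : set T) (r v : R) :
  (covering_number X r A <= v%:E)%E ->
  exists n (c : 'I_n -> T), [/\ n%:R <= v, forall i, X (c i) &
    A `<=` [set y | exists i, cball (c i) (r / 2) y]].
Proof.
move=> h; have : (covering_number X r A < ((Num.floor v)%:~R + 1)%:E)%E.
  by apply: (le_lt_trans h); rewrite lte_fin -intrD1 floorD1_gt.
move=> /ereal_inf_lt[_ [n [c [Xc Ac]] <-]]; rewrite lte_fin => nv.
exists n, c; split => //; apply: le_trans (floor_le v).
have h1 : (n%:Z)%:~R < (Num.floor v + 1)%:~R :> R by rewrite rmorphD.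
by move: h1; rewrite ltr_int ltzD1 -(ler_int R).
Qed.

Lemma cell_near (R : realType) (a v : R) (k : nat) : `|v - a| <= 2^-1 -> k%:R <= v < k.+1%:R ->
  (k : int) \in [:: Num.floor a - 1; Num.floor a; Num.floor a + 1].
Proof.
move=> va /andP[kv vk].
have f1 := floor_le a; have f2 := floorD1_gt a.
set f := Num.floor a in f1 f2 *.
have h1 : (k : int) < f + 2.
  rewrite -(ltr_int R) !rmorphD/= -[(k%:Z)%:~R]/(k%:R : R).
  move: va f2; rewrite rmorphD/= ler_norml; lra.
have h2 : f - 2 < (k : int).
  rewrite -(ltr_int R) rmorphB/= -[(k%:Z)%:~R]/(k%:R : R).
  have vk1 : v < k%:R + 1 by rewrite natr1.
  move: va; rewrite ler_norml; lra.
rewrite !inE; lia.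
Qed.

(** A ball of diameter [1 / m] meets at most three cells. *)
Lemma hit_count_le (R : realType) (E : set R^o) (m q : nat) (c : 'I_q -> R^o) (s : seq nat) (A : set R^o) :
  (0 < m)%N -> uniq s ->
  A `<=` [set y | exists i, cball (c i) (m%:R^-1 / 2) y] ->
  (forall k, k \in s -> exists2 x : R, A x & k%:R <= m%:R * x < k.+1%:R) ->
  (size s <= 3 * q)%N.
Proof.
move=> m0 us Ac sA; have mR : 0 < m%:R :> R by rewrite ltr0n.
pose F (i : 'I_q) := Num.floor (m%:R * (c i : R)).
pose S := [seq f | i <- enum 'I_q, f <- [:: F i - 1; F i; F i + 1]].
have sS : size S = (3 * q)%N.
  rewrite /S size_allpairs_dep /= -[in RHS](size_enum_ord q).
  by elim: (enum _) => //= _ r ->; rewrite mulnS.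
rewrite -sS -(size_map (fun k : nat => k : int)); apply: uniq_leq_size.
  by rewrite map_inj_uniq// => a b [].
move=> _ /mapP[k ks ->]; have [x Ax kx] := sA k ks.
have [i /=] := Ac _ Ax; rewrite /cball/= mdistRE => xc.
apply/allpairsPdep; exists i, (k : int); split => //; first by rewrite mem_enum.
apply: (@cell_near _ _ (m%:R * x)) => //.
rewrite -mulrBr normrM gtr0_norm// -(ler_pM2l (x := m%:R^-1)) ?invr_gt0//.
by rewrite mulrA mulVf ?gt_eqF// mul1r.
Qed.

(** The definition is applied at scale [r = 1 / m].  The constraint
    [r ^ (1 - eps) <= rho] is met by enlarging the radius from about [L / m] to
    [(L + 1) * m ^ eps / m], at the price of the factor [m ^ eps]. *)
Lemma assouad_hit_count (R : realType) (E : set R^o) (eps gam : R) :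
  0 < eps < 1 -> 0 <= gam -> (assouad_dim_eps eps E < gam%:E)%E ->
  exists2 K : R, 1 <= K & forall (m k0 L : nat), (0 < m)%N -> hits E m k0 ->
    (count (fun k => (k <= k0)%N && (k0 - k < L)%N) (hit_list E m))%:R <=
      K * (L.+1%:R * m%:R `^ eps) `^ gam.
Proof.
move=> /andP[e0 e1] gam0 /ereal_inf_lt[_ [g [C HC] <-]]; rewrite lte_fin => ggam.
pose K := 3 * (`|C| + 1).
exists K.
  have := normr_ge0 C; rewrite /K; lra.
move=> m k0 L m0 /asboolP[x0 Ex0 kx0].
have mR : 0 < m%:R :> R by rewrite ltr0n.
have m1 : 1 <= m%:R :> R by rewrite ler1n.
pose r : R := m%:R^-1; have r0 : 0 < r by rewrite invr_gt0.
have me1 : 1 <= m%:R `^ eps.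
  by rewrite -[leLHS](powRr0 m%:R); apply: ler_powR => //; exact: ltW.
have me0 : 0 < m%:R `^ eps by rewrite powR_gt0.
have re : r `^ (1 - eps) = m%:R `^ eps * r.
  rewrite powRD; last by apply/implyP => _; rewrite gt_eqF.
  rewrite powRr1 ?(ltW r0)// mulrC; congr (_ * _).
  by rewrite /r -powR_inv1 ?(ltW mR)// -powRrM mulN1r opprK.
pose rho := L.+1%:R * m%:R `^ eps * r.
have L1 : 1 <= L.+1%:R :> R by rewrite ler1n.
have h1 : r <= r `^ (1 - eps) by rewrite re ler_peMl ?(ltW r0).
have h2 : r `^ (1 - eps) <= rho by rewrite re /rho -mulrA ler_peMl// mulr_ge0// ltW.
have := HC r rho r0 h1 h2.
set X := L.+1%:R * m%:R `^ eps.
have X1 : 1 <= X by rewrite /X -[leLHS]mulr1 ler_pM.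
have -> : rho / r = X by rewrite /rho mulfK ?gt_eqF.
have Xg : X `^ g <= X `^ gam by apply: ler_powR => //; exact: ltW.
move=> hsup.
have : (covering_number E r (E `&` cball (x0 : R^o) rho) <= (C * X `^ g)%:E)%E.
  by apply: le_trans hsup; apply: ereal_sup_ubound; exists x0.
move=> /covering_number_attained[q [c [qC _ Ac]]].
have Cg : C * X `^ g <= `|C| * X `^ gam.
  apply: (@le_trans _ _ (`|C| * X `^ g)); first by rewrite ler_wpM2r ?powR_ge0// ler_norm.
  by rewrite ler_wpM2l.
apply: (@le_trans _ _ (3 * q)%:R); last first.
  rewrite natrM /K -mulrA ler_wpM2l//; apply: (le_trans qC); apply: (le_trans Cg).
  by rewrite mulrDl mul1r lerDl powR_ge0.
rewrite ler_nat -size_filter.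
apply: (@hit_count_le _ E m q c _ _ m0 _ Ac).
  by rewrite !filter_uniq// rev_uniq iota_uniq.
move=> k; rewrite !mem_filter => /andP[/andP[kk0 kL] /andP[/asboolP[x Ex kx] _]].
exists x => //; split => //; rewrite /cball/= mdistRE.
have : m%:R * `|x - x0| <= L.+1%:R.
  have -> : m%:R * `|x - x0| = `|m%:R * x - m%:R * x0|.
    by rewrite -mulrBr normrM (gtr0_norm mR).
  rewrite ler_norml.
  have kL' : (k0 < L + k)%N by clear -kk0 kL; lia.
  have : k0%:R + 1 <= L%:R + k%:R :> R by rewrite natr1 -natrD ler_nat.
  have : k%:R <= k0%:R :> R by rewrite ler_nat.
  move: kx kx0; rewrite -[k.+1%:R]natr1 -[k0.+1%:R]natr1 -[L.+1%:R]natr1 => /andP[a1 a2] /andP[b1 b2] c1 c2.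
  have : 0 <= L%:R :> R by [].
  by move=> ?; apply/andP; split; lra.
move=> hx; rewrite /rho /X -(ler_pM2l mR).
apply: (le_trans hx).
by rewrite mulrCA /r divff ?gt_eqF// mulr1 ler_peMr.
Qed.

(** * Uniform bound for the number of visits *)

(** The Borel-Cantelli lemma. *)
Lemma ae_eventually_not d (T : measurableType d) (R : realType) (P : probability T R)
    (F : nat -> set T) (D : R) : (forall n, measurable (F n)) ->
  (forall n, (P (F n) <= (D / 2 ^+ n)%:E)%E) ->
  {ae P, forall w, exists n0, forall n, (n0 <= n)%N -> ~ F n w}.
Proof.
move=> mF PF.
have D0 : 0 <= D.
  by have := le_trans (measure_ge0 P _) (PF 0%N); rewrite expr0 divr1 lee_fin.
have sum_fin : (\sum_(n <oo) P (F n) < +oo)%E.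
  apply: (@le_lt_trans _ _ (\sum_(n <oo) (D / 2 ^+ n)%:E)%E).
    by apply: lee_nneseries => // n _ _.
  have := @cvg_geometric_eseries_half R (D * 2) 0.
  have -> : (fun k : nat => (D * 2 / (2 ^ (k + 1))%:R)%:E) = (fun k => (D / 2 ^+ k)%:E).
    by apply/funext => k; rewrite addn1 expnS natrM natrX invfM mulrA -(mulrA D) divff// mulr1.
  by move=> /cvg_lim ->//; exact: ltry.
have L0 := lim_sup_set_cvg0 mF sum_fin.
exists (lim_sup_set F); split => //.
  by apply: bigcap_measurable => // k _; apply: bigcup_measurable.
move=> w /= nw n _; apply: contrapT => nF; apply: nw; exists n => k nk Fk.
by apply: nF; exists k.
Qed.

Lemma ffact_ge (l q : nat) : (l ^ q <= (l + q) ^_ q)%N.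
Proof.
elim: q => [|q IH]; first by rewrite expn0 ffactn0.
by rewrite addnS ffactSS expnS leq_mul// leqW// leq_addr.
Qed.

Lemma natrS_le_powR (R : realType) (delta : R) : 0 < delta ->
  exists2 C : R, 0 <= C & forall n : nat, n.+1%:R <= C * (2 ^+ n) `^ delta.
Proof.
move=> d0; have l2 : 0 < ln 2 :> R by rewrite ln_gt0// ltr1n.
pose c : R := delta * ln 2; have c0 : 0 < c by rewrite mulr_gt0.
exists (c^-1 + 1); first by rewrite addr_ge0// invr_ge0 ltW.
move=> n; have -> : (2 ^+ n) `^ delta = expR (c * n%:R) :> R.
  by rewrite /powR gt_eqF ?exprn_gt0// lnXn// /c -[X in delta * X]mulr_natr mulrA.
have := expR_ge1Dx (c * n%:R); set e := expR _ => he.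
have n0 : 0 <= n%:R :> R by [].
have ci : 0 < c^-1 by rewrite invr_gt0.
rewrite -natr1 mulrDl mul1r; apply: lerD.
  rewrite -(ler_pM2l c0) mulrA divff ?gt_eqF// mul1r.
  by apply: le_trans he; rewrite lerDr.
by apply: le_trans he; rewrite lerDl mulr_ge0// ltW.
Qed.

Lemma dyadic_weight (R : realType) (alpha : R) (n d : nat) : 0 < alpha ->
  (0 < d)%N -> (d < 2 ^ n.+1)%N ->
  (d%:R : R) `^ (- alpha) <= \sum_(j < n.+1) (2 ^+ j) `^ (- alpha) * (d < 2 ^ j.+1)%N%:R.
Proof.
move=> a0 d0 dn; have /andP[t1 t2] := @trunc_log_bounds 2 d isT d0.
set j0 := trunc_log 2 d in t1 t2.
have jn : (j0 < n.+1)%N by rewrite -(ltn_exp2l _ _ (isT : 1 < 2)%N) (leq_ltn_trans t1).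
rewrite (bigD1 (Ordinal jn))//= t2 mulr1.
apply: (@le_trans _ _ ((2 ^+ j0) `^ (- alpha))); last first.
  by rewrite lerDl; apply: sumr_ge0 => j _; rewrite mulr_ge0// powR_ge0.
have p0 : 0 < 2 ^+ j0 :> R by rewrite exprn_gt0.
have dR : 0 < d%:R :> R by rewrite ltr0n.
rewrite !powRN lef_pV2 ?posrE ?powR_gt0//.
apply: ge0_ler_powR; rewrite ?nnegrE ?(ltW p0) ?(ltW a0)//.
have -> : 2 ^+ j0 = (2 ^ j0)%:R :> R by rewrite natrX.
by rewrite ler_nat.
Qed.

(** Group the cells [k] by the dyadic size of [k0 - k].  Each of the [n + 1]
    groups contributes at most [2 ^ (n * (gam - alpha))] up to the factor
    [2 ^ (n * eps * gam)], because its count is a [gam]-th power of the size. *)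
Lemma hit_weight_sum (R : realType) (E : set R^o) (alpha gam eps : R) :
  0 < alpha -> alpha <= gam -> 0 < eps < 1 -> (assouad_dim_eps eps E < gam%:E)%E ->
  exists2 K : R, 1 <= K & forall (n k0 : nat) (r : seq nat), hits E (2 ^ n) k0 ->
    (k0 <= 2 ^ n)%N -> {subset r <= hit_list E (2 ^ n)} -> path gtn k0 r ->
    \sum_(k <- r) (k0%:R - k%:R : R) `^ (- alpha) <=
      K * n.+1%:R * (2 ^+ n) `^ (eps * gam + (gam - alpha)).
Proof.
move=> a0 ag e01 dE; have g0 : 0 < gam by exact: lt_le_trans ag.
have [K K1 HK] := assouad_hit_count e01 (ltW g0) dE.
have K0 : 0 < K by exact: lt_le_trans K1.
exists (K * 4 `^ gam).
  have : 1 <= 4 `^ gam :> R.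
    by rewrite -[leLHS](powRr0 4); apply: ler_powR; rewrite ?ler1n// ltW.
  by nra.
move=> n k0 r hk0 k0n rs k0r.
have m0 : (0 < 2 ^ n)%N by rewrite expn_gt0.
have tr : transitive gtn by move=> a b c /= h1 h2; exact: ltn_trans h2 h1.
have rlt k : k \in r -> (k < k0)%N.
  by move: k0r; rewrite path_sortedE// => /andP[/allP h _] /h.
have ur : uniq r.
  by apply: (sorted_uniq tr) => [a|]; [rewrite /= ltnn|exact: path_sorted k0r].
pose W j : R := (2 ^+ j) `^ (- alpha).
apply: (@le_trans _ _ (\sum_(k <- r) \sum_(j < n.+1) W j * (k0 - k < 2 ^ j.+1)%N%:R)).
  rewrite big_seq [leRHS]big_seq; apply: ler_sum => k kr; rewrite -natrB ?(ltnW (rlt _ kr))//.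
  apply: dyadic_weight => //; first by rewrite subn_gt0 rlt.
  by rewrite (leq_ltn_trans (leq_subr _ _))// (leq_ltn_trans k0n)// ltn_exp2l.
rewrite exchange_big/=.
set e' := _ + (_ - _); pose b : R := K * 4 `^ gam * (2 ^+ n) `^ e'.
apply: (@le_trans _ _ (\sum_(j < n.+1) b)); last first.
  by rewrite sumr_const card_ord -[leLHS]mulr_natr /b mulrAC.
apply: ler_sum => j _; rewrite -mulr_sumr -natr_sum.
have cnt : (\sum_(k <- r) (k0 - k < 2 ^ j.+1)%N <=
    count (fun k => (k <= k0)%N && (k0 - k < 2 ^ j.+1)%N) (hit_list E (2 ^ n)))%N.
  have -> : (\sum_(k <- r) (k0 - k < 2 ^ j.+1) = count (fun k => k0 - k < 2 ^ j.+1) r)%N.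
    by rewrite -sum1_count [RHS]big_mkcond; apply: eq_bigr => k _; case: ifP.
  rewrite -!size_filter; apply: uniq_leq_size; first by rewrite filter_uniq.
  move=> k; rewrite !mem_filter => /andP[-> kr]; have := rs k kr.
  by rewrite mem_filter => ->; rewrite andbT (ltnW (rlt k kr)).
have mE : (2 ^ n)%:R = 2 ^+ n :> R by rewrite natrX.
have p2 i : 0 < 2 ^+ i :> R by rewrite exprn_gt0.
have h1 : (\sum_(k <- r) (k0 - k < 2 ^ j.+1))%N%:R <=
    K * ((2 ^ j.+1).+1%:R * (2 ^+ n) `^ eps) `^ gam.
  by rewrite -mE; apply: le_trans (HK (2 ^ n)%N k0 (2 ^ j.+1)%N m0 hk0); rewrite ler_nat.
have h2 : ((2 ^ j.+1).+1%:R * (2 ^+ n) `^ eps) `^ gam <=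
    4 `^ gam * (2 ^+ j) `^ gam * (2 ^+ n) `^ (eps * gam) :> R.
  rewrite -powRM ?(ltW (p2 _))// powRrM -powRM ?mulr_ge0 ?powR_ge0 ?(ltW (p2 _))//.
  apply: ge0_ler_powR; rewrite ?nnegrE ?(ltW g0) ?mulr_ge0 ?powR_ge0 ?(ltW (p2 _))//.
  apply: ler_wpM2r; first exact: powR_ge0.
  have -> : 4 * 2 ^+ j = (2 ^ j.+2)%:R :> R by rewrite natrX !exprS mulrA -natrM.
  by rewrite ler_nat !expnS !mul2n -!addnn; have := expn_gt0 2 j; lia.
have h3 : W j * (2 ^+ j) `^ gam <= (2 ^+ n) `^ (gam - alpha).
  rewrite /W -powRD; last by apply/implyP => _; rewrite gt_eqF.
  rewrite addrC; apply: ge0_ler_powR; rewrite ?nnegrE ?subr_ge0 ?(ltW (p2 _))//.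
  by rewrite ler_eXn2l ?ltr1n// -ltnS.
have W0 : 0 <= W j by exact: powR_ge0.
apply: (le_trans (ler_wpM2l W0 (le_trans h1 (ler_wpM2l (ltW K0) h2)))).
rewrite /b /e' powRD; last by apply/implyP => _; rewrite gt_eqF.
rewrite [leRHS]mulrA.
apply: le_trans (ler_wpM2l (mulr_ge0 (mulr_ge0 (ltW K0) (powR_ge0 4 gam)) (powR_ge0 (2 ^+ n) (eps * gam))) h3).
by rewrite le_eqVlt; apply/orP; left; apply/eqP; ring.
Qed.

Lemma hit_listP (R : realType) (E : set R^o) (m : nat) :
  [/\ sorted gtn (hit_list E m), all (fun k => (0 < k <= m)%N) (hit_list E m) &
      (size (hit_list E m) <= m)%N].
Proof.
have tr : transitive gtn by move=> a b c /= h1 h2; exact: ltn_trans h2 h1.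
split.
- by apply: sorted_filter => //; rewrite rev_sorted; exact: iota_ltn_sorted.
- apply/allP => k; rewrite mem_filter mem_rev mem_iota => /andP[_]; lia.
- by rewrite (leq_trans (size_subseq (filter_subseq _ _)))// size_rev size_iota.
Qed.

(** Markov's inequality for the number of chains of [q + 1 >= 4 / delta] visits,
    a union over about [2 ^ (2 * n)] windows centred in [[- 2 ^ n, 2 ^ n]], and
    Borel-Cantelli.  The windows are larger than the natural size
    [2 ^ (- n * alpha)]; this leaves room for replacing a point by the left end
    of its cell. *)
Lemma fbm_count_ae d (T : measurableType d) (R : realType) (P : probability T R)
    (alpha delta : R) (B : R -> {RV P >-> R}) (E : set R^o) :
  0 < alpha < 1 -> fractional_brownian_motion01 P alpha B ->
  0 < delta < 1 -> delta <= alpha -> (assouad_dim_eps delta E < (alpha + delta)%:E)%E ->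
  exists2 C : R, 0 <= C & {ae P, forall w, exists n0, forall n, (n0 <= n)%N ->
    forall i : nat, (i <= 2 * (2 ^ n) ^ 2)%N ->
    (count (fun k => `|B (k%:R / (2 ^ n)%:R) w - (i%:R / (2 ^ n)%:R - (2 ^ n)%:R)| <=
              (2 ^+ n) `^ (- (alpha - delta)) / 2) (hit_list E (2 ^ n)))%:R <=
      C * (2 ^+ n) `^ (6 * delta)}.
Proof.
move=> a01 hB d01 da dE; have /andP[a0 a1] := a01; have /andP[d0 d1] := d01.
have bb : - 2^-1 < alpha - 2^-1 < 2^-1 by apply/andP; split; lra.
pose C := 4 * (1 + (lnd_const (alpha - 2^-1))^-1).
have C0 : 0 < C by rewrite mulr_gt0// addr_gt0// invr_gt0 lnd_const_gt0.
have ag : alpha <= alpha + delta by lra.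
have [K K1 HK] := hit_weight_sum a0 ag d01 dE.
have [Cd Cd0 HCd] := natrS_le_powR d0.
pose L0 := C * K * (Cd + 1).
have K0 : 0 < K by lra.
have L00 : 0 < L0 by rewrite mulr_gt0 ?(mulr_gt0 C0 K0)//; lra.
pose m n : R := 2 ^+ n.
have m0 n : 0 < m n by rewrite exprn_gt0.
have m1 n : 1 <= m n by rewrite exprn_ege1// ler1n.
have mE n : (2 ^ n)%:R = m n by rewrite natrX.
pose Lam n := L0 * m n `^ (5 * delta).
pose M n := (Num.truncn (m n `^ (alpha - delta))).+1.
have MR n : m n `^ (alpha - delta) <= (M n)%:R by rewrite ltW// truncnS_gt.
have MR0 n : 0 < (M n)%:R :> R by rewrite ltr0n.
have mp n x : 0 <= x -> 1 <= m n `^ x.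
  by move=> x0; rewrite -[leLHS](powRr0 (m n)); apply: ler_powR.
have M2 n : m n `^ (- (alpha - delta)) / 2 <= (M n)%:R^-1.
  rewrite powRN -invfM lef_pV2 ?posrE// ?mulr_gt0 ?powR_gt0//.
  have := mp n (alpha - delta); rewrite subr_ge0 => /(_ da) h.
  have := truncn_itv (powR_ge0 (m n) (alpha - delta)) => /andP[t1 _].
  rewrite /M -natr1; lra.
(* The order of the moment: large enough to beat the [2 ^ n] starting cells of
   the chains, the [3 * 2 ^ (2 * n)] windows, and still leave a summable
   factor. *)
have [q qd] : exists q : nat, 4 <= delta * q.+1%:R.
  exists (Num.truncn (4 / delta)).
  by rewrite -ler_pdivrMl// mulrC ltW// truncnS_gt.
pose l n := (Num.truncn (m n `^ (6 * delta))).+1.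
have lR n : m n `^ (6 * delta) <= (l n)%:R by rewrite ltW// truncnS_gt.
pose L n := (l n + q.+1)%N.
pose y n (i : nat) : R := i%:R / (2 ^ n)%:R - (2 ^ n)%:R.
pose N n i w := count (fun k => `|B (k%:R / (2 ^ n)%:R) w - y n i| <= (M n)%:R^-1) (hit_list E (2 ^ n)).
pose F n i := [set w | (L n <= N n i w)%N].
have mF n i : measurable (F n i).
  apply: (measurable_count_ge (L n) (hit_list E (2 ^ n)) (y n i) (M n)%:R^-1
    (X := fun k => B (k%:R / (2 ^ n)%:R))) => k; exact: measurable_funP.
pose D : R := 4 ^+ q.+1 * q.+1`!%:R * L0 ^+ q.+1.
have D0 : 0 <= D by rewrite mulr_ge0 ?exprn_ge0 ?(ltW L00)// mulr_ge0.
have PF n i : (P (F n i) <= (D / m n ^+ 3)%:E)%E.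
  have [hs1 hs2 hs3] := hit_listP E (2 ^ n).
  have Lam0 : 0 <= Lam n by rewrite mulr_ge0 ?powR_ge0// ltW.
  have m2 : (0 < 2 ^ n)%N by rewrite expn_gt0.
  have uE (x : R) : 0 < x -> C / ((M n)%:R * (x / (2 ^ n)%:R) `^ alpha) <=
      C * (m n `^ delta * x `^ (- alpha)).
    move=> x0; rewrite mE ler_wpM2l ?(ltW C0)//.
    have -> : m n `^ delta * x `^ (- alpha) = (m n `^ (- delta) * x `^ alpha)^-1.
      by rewrite invfM -!powRN opprK.
    have e1 : (x / m n) `^ alpha = x `^ alpha * m n `^ (- alpha).
      rewrite powRM ?(ltW x0) ?invr_ge0 ?(ltW (m0 n))//; congr (_ * _).
      by rewrite -powR_inv1 ?(ltW (m0 n))// -powRrM mulN1r.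
    have xa : 0 < x `^ alpha by rewrite powR_gt0.
    have ma a : 0 < m n `^ a by rewrite powR_gt0.
    rewrite e1 lef_pV2 ?posrE ?(mulr_gt0 (ma _) xa) ?(mulr_gt0 (MR0 n) (mulr_gt0 xa (ma _)))//.
    rewrite mulrCA [leLHS]mulrC ler_wpM2l ?(ltW xa)//.
    apply: le_trans (ler_wpM2r (ltW (ma _)) (MR n)).
    by rewrite -powRD ?(gt_eqF (m0 n)) ?implybT// addrAC subrr add0r.
  have first_le k : k \in hit_list E (2 ^ n) ->
      C / ((M n)%:R * ((k%:R - 0%:R) / (2 ^ n)%:R) `^ alpha) <= Lam n.
    move=> ks; have /andP[k0 km] := allP hs2 k ks.
    rewrite subr0; apply: (le_trans (uE _ _)); first by rewrite ltr0n.
    rewrite /Lam /L0 -(mulrA (C * K)) -(mulrA C K) ler_wpM2l ?(ltW C0)//.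
    have k1 : k%:R `^ (- alpha) <= 1 :> R.
      rewrite powRN invf_le1 ?powR_gt0 ?ltr0n// -[leLHS](powRr0 k%:R).
      by apply: ler_powR; rewrite ?ler1n// ltW.
    have h1 : m n `^ delta <= m n `^ (5 * delta) by apply: ler_powR => //; lra.
    have h2 : m n `^ delta * k%:R `^ (- alpha) <= m n `^ (5 * delta).
      by rewrite -[leRHS]mulr1 ler_pM// powR_ge0.
    apply: (le_trans h2); rewrite mulrA ler_peMl ?powR_ge0//.
    by rewrite -[leLHS]mulr1 ler_pM//; lra.
  have next_le k r : k \in hit_list E (2 ^ n) -> {subset r <= hit_list E (2 ^ n)} -> path gtn k r ->
      \sum_(k' <- r) C / ((M n)%:R * ((k%:R - k'%:R) / (2 ^ n)%:R) `^ alpha) <= Lam n.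
    move=> ks rs kr; have /andP[k0 km] := allP hs2 k ks.
    have hk : hits E (2 ^ n) k by move: ks; rewrite mem_filter => /andP[].
    have tr : transitive gtn by move=> a b c /= h1 h2; exact: ltn_trans h2 h1.
    apply: (@le_trans _ _ (\sum_(k' <- r) C * (m n `^ delta * (k%:R - k'%:R) `^ (- alpha)))).
      rewrite big_seq [leRHS]big_seq; apply: ler_sum => k' k'r; apply: uE.
      rewrite subr_gt0 ltr_nat.
      by move: kr; rewrite path_sortedE// => /andP[/allP h _]; exact: h.
    rewrite -!mulr_sumr /Lam /L0 -(mulrA (C * K)) -(mulrA C K) ler_wpM2l ?(ltW C0)//.
    have h1 := HK n k r hk km rs kr.
    have h2 := HCd n.
    set S := \sum_(_ <- _) _ in h1 *.
    set e := _ + _ in h1.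
    have h3 : m n `^ e <= m n `^ (3 * delta) by apply: ler_powR => //; rewrite /e; nra.
    have p0 : 0 <= m n `^ (3 * delta) by exact: powR_ge0.
    have pd0 : 0 <= m n `^ delta by exact: powR_ge0.
    have -> : m n `^ (5 * delta) = m n `^ delta * (m n `^ delta * m n `^ (3 * delta)).
      by rewrite -!powRD ?(gt_eqF (m0 n)) ?implybT//; congr (_ `^ _); ring.
    have t0 : 0 <= m n `^ e by exact: powR_ge0.
    have h2' : n.+1%:R <= (Cd + 1) * m n `^ delta by apply: (le_trans h2); rewrite mulrDl mul1r lerDl.
    have := ler_pM (ler0n _ _) t0 h2' h3.
    rewrite -/(m n) in h1; move: h1 pd0 K0; move: (m n `^ delta) (m n `^ e) (m n `^ (3 * delta)) => x t z h1 x0 K0 h4.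
    apply: (le_trans (ler_wpM2l x0 h1)).
    have -> : K * ((Cd + 1) * (x * (x * z))) = x * (K * ((Cd + 1) * x * z)) by ring.
    by rewrite ler_wpM2l// -mulrA ler_wpM2l// ltW.
  have bound := @fbm_count_bound _ _ _ _ _ _ (M n) (2 ^ n) q (L n) (Lam n) (y n i) _ a01 hB
    isT m2 Lam0 hs1 hs2 first_le next_le.
  have PfE : P (F n i) = (fine (P (F n i)))%:E by rewrite fineK// fin_num_measure.
  have p0 : 0 <= fine (P (F n i)) by exact: fine_ge0.
  move: bound; rewrite -/(N n i) -/(F n i) PfE -EFinM !lee_fin.
  move: (fine _) p0 => p p0 bound.
  pose x := m n `^ delta; have x1 : 1 <= x by apply: mp; exact: ltW.
  have x0 : 0 < x by lra.
  have x6 : m n `^ (6 * delta) = x ^+ 6 by rewrite mulrC powRrM powR_mulrn// ltW.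
  have x5 : m n `^ (5 * delta) = x ^+ 5 by rewrite mulrC powRrM powR_mulrn// ltW.
  have xq : m n ^+ 4 <= x ^+ q.+1.
    by rewrite -!powR_mulrn ?(ltW x0) ?(ltW (m0 n))// -powRrM; apply: ler_powR.
  have h1 : (x ^+ 6) ^+ q.+1 <= 'C(L n, q.+1)%:R * q.+1`!%:R.
    rewrite -natrM bin_ffact -x6.
    apply: (@le_trans _ _ ((l n ^ q.+1)%:R)); last by rewrite ler_nat ffact_ge.
    by rewrite natrX lerXn2r ?nnegrE ?powR_ge0.
  have h2 : p * (x ^+ 6) ^+ q.+1 <= D * m n * (x ^+ 5) ^+ q.+1.
    apply: (le_trans (ler_wpM2l p0 h1)).
    rewrite mulrA [p * _]mulrC.
    apply: (le_trans (ler_wpM2r (ler0n _ _) bound)).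
    have hsz : (size (hit_list E (2 ^ n)))%:R <= m n by rewrite -mE ler_nat.
    rewrite /D /Lam x5 exprMn.
    have -> : 4 ^+ q.+1 * q.+1`!%:R * L0 ^+ q.+1 * m n * (x ^+ 5) ^+ q.+1 =
      4 ^+ q.+1 * (m n * (L0 ^+ q.+1 * (x ^+ 5) ^+ q.+1)) * q.+1`!%:R by ring.
    rewrite ler_wpM2r// ler_wpM2l ?exprn_ge0// ler_wpM2r// mulr_ge0 ?exprn_ge0 ?(ltW x0) ?(ltW L00)//.
  have x5q : 0 < (x ^+ 5) ^+ q.+1 by rewrite !exprn_gt0.
  have h3 : p * x ^+ q.+1 <= D * m n.
    by rewrite -(ler_pM2r x5q) -mulrA -exprMn -exprS.
  have h4 : p * m n ^+ 4 <= D * m n by apply: le_trans h3; rewrite ler_wpM2l.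
  rewrite ler_pdivlMr ?exprn_gt0//.
  by rewrite -(ler_pM2r (m0 n)) -mulrA -exprSr.
clearbody D.
pose G n := \big[setU/set0]_(i < (2 * (2 ^ n) ^ 2).+1) F n i.
have mG n : measurable (G n) by apply: bigsetU_measurable => i _.
have PG n : (P (G n) <= (3 * D / 2 ^+ n)%:E)%E.
  apply: (le_trans (@Boole_inequality _ _ _ P (F n) _ (fun i _ => mF n i))).
  apply: (@le_trans _ _ (\sum_(i < (2 * (2 ^ n) ^ 2).+1) (D / m n ^+ 3)%:E)%E).
    by apply: lee_sum => i _; exact: PF.
  rewrite sumEFin lee_fin sumr_const card_ord -[leLHS]mulr_natr -natr1 natrM natrX mE -/(m n).
  rewrite -!mulrA -[leRHS]mulrCA ler_wpM2l//.
  have m3 : 0 < m n ^+ 3 by rewrite exprn_gt0.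
  rewrite -(ler_pM2l m3) [leLHS]mulrA mulfV ?gt_eqF// mul1r.
  have -> : m n ^+ 3 * (3 / m n) = 3 * m n ^+ 2.
    by field; rewrite gt_eqF.
  have : 1 <= m n ^+ 2 by rewrite exprn_ege1.
  lra.
exists (2 + q.+1%:R) => //.
apply: filterS (ae_eventually_not mG PG) => w [n0 hn0]; exists n0 => n nn i hi.
have : ~ F n i w.
  move=> Fw; apply: (hn0 n nn); rewrite /G -bigcup_mkord; exists i => //.
move=> /negP; rewrite -ltnNge => NL.
apply: (@le_trans _ _ (L n)%:R).
  rewrite ler_nat; apply: leq_trans (ltnW NL); apply: sub_count => k /= h.
  exact: le_trans h (M2 n).
have h6 := mp n (6 * delta) (mulr_ge0 (ler0n _ _) (ltW d0)).
have := truncn_itv (powR_ge0 (m n) (6 * delta)) => /andP[t1 _].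
rewrite /L /l natrD -[(_.+1)%:R as X in X + _]natr1 -/(m n).
have : q.+1%:R <= q.+1%:R * m n `^ (6 * delta) by rewrite ler_peMr.
lra.
Qed.

(** * Dyadic increments *)

(** [E (B t - B s) ^ 2 = |t - s| ^ (2 alpha)], so the increment has Gaussian tails. *)
Lemma fbm_increment_tail d (T : measurableType d) (R : realType) (P : probability T R)
    (alpha : R) (B : R -> {RV P >-> R}) (s t x : R) :
  0 < alpha -> fractional_brownian_motion01 P alpha B -> 0 <= s <= 1 -> 0 <= t <= 1 -> s != t -> 0 <= x ->
  (P [set w | (x < `|B t w - B s w|)%R] <=
     (2 * expR (- (x ^+ 2 / (`|t - s| `^ (2 * alpha) *+ 4))))%:E)%E.
Proof.
move=> a0 hB s01 t01 st x0.
have mB u : measurable_fun [set: T] (B u) by exact: measurable_funP.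
have [is1 Es] := fbm_mean hB s01.
have [it1 Et] := fbm_mean hB t01.
have [iss Ess] := fbm_covariance_integral hB s01 s01.
have [its Ets] := fbm_covariance_integral hB t01 s01.
have [itt Ett] := fbm_covariance_integral hB t01 t01.
apply: (gaussian_tail (Z := fun w => B t w - B s w)) => //.
- exact: measurable_funB.
- pose u (i : 'I_2) : R := if i == 0 then t else s.
  pose c (i : 'I_2) : R := if i == 0 then 1 else -1.
  have := @fbm_gaussian _ _ _ _ _ _ hB 2 u c.
  have -> : (fun w => \sum_(i < 2) c i * B (u i) w) = (fun w => B t w - B s w).
    by apply/funext => w; rewrite !big_ord_recl big_ord0 /c /u/= mul1r mulN1r addr0.
  by apply=> i; rewrite /u/= in_itv/=; case: ifP.
- by rewrite RintegralB// Et Es subrr.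
- have -> : \int[P]_w (B t w - B s w) ^+ 2 =
      \int[P]_w (B t w * B t w - 2 * (B t w * B s w) + B s w * B s w).
    by apply: eq_Rintegral => w _; ring.
  have i2 : P.-integrable setT (EFin \o (fun w => 2 * (B t w * B s w))).
    exact: (integrableZl measurableT _ its).
  have i3 : P.-integrable setT (EFin \o (fun w => B t w * B t w - 2 * (B t w * B s w))).
    exact: (integrableB measurableT itt i2).
  rewrite RintegralD// RintegralB// RintegralZl// Ett Ess Ets !subrr normr0.
  by rewrite powR0 ?mulf_neq0 ?gt_eqF//; field.
- by rewrite powR_gt0// normr_gt0 subr_eq0 eq_sym.
Qed.

Lemma expRN_le_inv_pow (R : realType) (x : R) (j : nat) : 0 < x -> expR (- x) <= j`!%:R / x ^+ j.
Proof.
move=> x0; rewrite expRN -[leRHS]invrK lef_pV2 ?posrE ?expR_gt0 ?invr_gt0 ?divr_gt0 ?exprn_gt0 ?ltr0n ?fact_gt0//.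
rewrite invf_div; case: j => [|j]; first by rewrite expr0 fact0 divr1 -[leLHS]expR0 ler_expR ltW.
by apply: le_trans (expR_ge1Dxn j (ltW x0)); rewrite lerDr.
Qed.

(** Gaussian tails decay faster than any power of [2 ^ n], so the exceptional
    events are summable even after a union over [2 ^ n] increments. *)
Lemma fbm_dyadic_increments d (T : measurableType d) (R : realType) (P : probability T R)
    (alpha beta : R) (B : R -> {RV P >-> R}) :
  0 < alpha -> fractional_brownian_motion01 P alpha B -> beta < alpha ->
  {ae P, forall w, exists n0, forall n, (n0 <= n)%N -> forall k : nat, (k < 2 ^ n)%N ->
    `|B (k.+1%:R / 2 ^+ n) w - B (k%:R / 2 ^+ n) w| <= (2 ^+ n) `^ (- beta)}.
Proof.
move=> a0 hB ba.
pose m n : R := 2 ^+ n.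
have m0 n : 0 < m n by rewrite exprn_gt0.
have m1 n : 1 <= m n by rewrite exprn_ege1// ler1n.
have mE n : (2 ^ n)%:R = m n by rewrite natrX.
have mB u : measurable_fun [set: T] (B u) by exact: measurable_funP.
pose F n k := [set w | m n `^ (- beta) < `|B (k.+1%:R / m n) w - B (k%:R / m n) w|].
have mF n k : measurable (F n k).
  have -> : F n k = (fun w => `|B (k.+1%:R / m n) w - B (k%:R / m n) w|) @^-1` `]m n `^ (- beta), +oo[.
    by apply/seteqP; split=> w /=; rewrite in_itv/= andbT.
  rewrite -[X in measurable X]setTI; apply: measurableT_comp => //.
  exact: measurable_funB.
have [j jd] : exists j : nat, 2 <= 2 * (alpha - beta) * j%:R.
  exists (Num.truncn ((alpha - beta)^-1)).+1.
  rewrite -mulrA ler_peMr// -ler_pdivrMl ?subr_gt0// mulr1.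
  by rewrite ltW// truncnS_gt.
pose D : R := 2 * (j`!%:R * 4 ^+ j).
have PF n k : (k < 2 ^ n)%N -> (P (F n k) <= (D / m n ^+ 2)%:E)%E.
  move=> kn.
  have h01 i : (i <= 2 ^ n)%N -> 0 <= (i%:R : R) / m n <= 1.
    by move=> i2; rewrite divr_ge0 ?(ltW (m0 n))//= ler_pdivrMr// mul1r -mE ler_nat.
  have := @fbm_increment_tail _ _ _ _ _ _ (k%:R / m n) (k.+1%:R / m n) (m n `^ (- beta))
     a0 hB (h01 _ (ltnW kn)) (h01 _ kn).
  have -> : k.+1%:R / m n - k%:R / m n = (m n)^-1 by rewrite -mulrBl -natr1 addrAC subrr add0r mul1r.
  rewrite (gtr0_norm (x := (m n)^-1)) ?invr_gt0//.
  have -> : k%:R / m n != k.+1%:R / m n.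
    by rewrite -subr_eq0 -mulrBl -natr1 opprD addrA subrr add0r mulN1r oppr_eq0 invr_eq0 gt_eqF.
  move=> /(_ isT (powR_ge0 _ _)) h; apply: (le_trans h); rewrite lee_fin.
  have -> : (m n `^ (- beta)) ^+ 2 / ((m n)^-1 `^ (2 * alpha) *+ 4) = m n `^ (2 * (alpha - beta)) / 4.
    rewrite -powR_mulrn ?powR_ge0// -[(m n)^-1]powR_inv1 ?(ltW (m0 n))// -!powRrM.
    rewrite -[X in _ / X]mulr_natr invfM [LHS]mulrA; congr (_ / _).
    rewrite -powRN -powRD ?(gt_eqF (m0 n)) ?implybT//; congr (_ `^ _); ring.
  set y := m n `^ _.
  have y0 : 0 < y by rewrite powR_gt0.
  have yj : m n ^+ 2 <= y ^+ j.
    by rewrite -!powR_mulrn ?(ltW y0) ?(ltW (m0 n))// -powRrM; apply: ler_powR.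
  rewrite /D -mulrA ler_wpM2l//.
  have y4 : 0 < y / 4 by rewrite divr_gt0.
  apply: (le_trans (expRN_le_inv_pow j y4)).
  rewrite -mulrA ler_wpM2l// expr_div_n invf_div ler_wpM2l ?exprn_ge0//.
  by rewrite lef_pV2 ?posrE ?exprn_gt0.
pose G n := \big[setU/set0]_(k < 2 ^ n) F n k.
have mG n : measurable (G n) by apply: bigsetU_measurable => k _.
have PG n : (P (G n) <= (D / 2 ^+ n)%:E)%E.
  apply: (le_trans (@Boole_inequality _ _ _ P (F n) _ (fun i _ => mF n i))).
  apply: (@le_trans _ _ (\sum_(i < 2 ^ n) (D / m n ^+ 2)%:E)%E).
    by apply: lee_sum => i _; exact: PF.
  rewrite sumEFin lee_fin sumr_const card_ord -[leLHS]mulr_natr mE -/(m n).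
  by rewrite expr2 invfM -!mulrA mulVf ?gt_eqF// mulr1.
apply: filterS (ae_eventually_not mG PG) => w [n0 hn0]; exists n0 => n nn k kn.
rewrite leNgt; apply/negP => h; apply: (hn0 n nn); rewrite /G -bigcup_mkord.
by exists k.
Qed.

(** * Hölder continuity by chaining *)

Definition dyadic (R : realType) (n : nat) (t : R) : nat := Num.truncn (t * 2 ^+ n).

Lemma dyadic_itv (R : realType) (n : nat) (t : R) : 0 <= t ->
  (dyadic n t)%:R / 2 ^+ n <= t < (dyadic n t).+1%:R / 2 ^+ n.
Proof.
move=> t0; have p0 : 0 < 2 ^+ n :> R by rewrite exprn_gt0.
have h0 : 0 <= t * 2 ^+ n by rewrite mulr_ge0// ltW.
by rewrite ler_pdivrMr// ltr_pdivlMr//; exact: truncn_itv.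
Qed.

Lemma dyadicS (R : realType) (n : nat) (t : R) : 0 <= t ->
  dyadic n.+1 t = (dyadic n t).*2 \/ dyadic n.+1 t = (dyadic n t).*2.+1.
Proof.
move=> t0; have p0 : 0 < 2 ^+ n :> R by rewrite exprn_gt0.
have h0 : 0 <= t * 2 ^+ n by rewrite mulr_ge0// ltW.
have h1 : 0 <= t * 2 ^+ n.+1 by rewrite mulr_ge0// exprn_ge0.
have := truncn_itv h0; have := truncn_itv h1; rewrite -/(dyadic n t) -/(dyadic n.+1 t).
move: (dyadic n.+1 t) (dyadic n t) => a b /andP[h2 h3] /andP[h4 h5].
have e : t * 2 ^+ n.+1 = (t * 2 ^+ n) * 2 by rewrite exprS; ring.
have c1 : (a < b.+1.*2)%N.
  by rewrite -(ltr_nat R) (le_lt_trans h2)// e -muln2 natrM ltr_pM2r.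
have c2 : (b.*2 < a.+1)%N.
  by rewrite -(ltr_nat R) (le_lt_trans _ h3)// e -muln2 natrM ler_pM2r.
clear -c1 c2; lia.
Qed.

Lemma dyadic_le (R : realType) (n : nat) (t : R) : 0 <= t <= 1 -> (dyadic n t <= 2 ^ n)%N.
Proof.
move=> /andP[t0 t1]; rewrite -(ler_nat R) natrX.
have := dyadic_itv n t0 => /andP[+ _].
rewrite ler_pdivrMr ?exprn_gt0// => h; apply: (le_trans h).
by rewrite ler_piMl ?exprn_ge0.
Qed.

(** The bound is a difference, so that it telescopes along the induction. *)
Lemma dyadic_chain (R : realType) (f : R -> R) (q t : R) (n0 n p : nat) :
  0 < q < 1 -> 0 <= t <= 1 ->
  (forall n, (n0 <= n)%N -> forall k : nat, (k < 2 ^ n)%N ->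
    `|f (k.+1%:R / 2 ^+ n) - f (k%:R / 2 ^+ n)| <= q ^+ n) -> (n0 <= n)%N ->
  `|f ((dyadic (n + p) t)%:R / 2 ^+ (n + p)) - f ((dyadic n t)%:R / 2 ^+ n)| <=
     (1 - q)^-1 * (q ^+ n - q ^+ (n + p)).
Proof.
move=> /andP[q0 q1] t01 hf nn; have /andP[t0 _] := t01.
elim: p => [|p IH]; first by rewrite addn0 !subrr normr0 mulr0.
set a := f _ - f _ in IH *; rewrite addnS.
set x := f _; set z := f _.
have q1' : 0 < 1 - q by lra.
have step : `|x - f ((dyadic (n + p) t)%:R / 2 ^+ (n + p))| <= q ^+ (n + p).+1.
  have e : (dyadic (n + p) t)%:R / 2 ^+ (n + p) = (dyadic (n + p) t).*2%:R / 2 ^+ (n + p).+1 :> R.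
    by rewrite exprS -muln2 natrM; field; rewrite gt_eqF// exprn_gt0.
  rewrite /x e; have [->|h] := dyadicS (n + p) t0.
    by rewrite subrr normr0 exprn_ge0// ltW.
  rewrite h; apply: hf; first by rewrite ltnW// ltnS (leq_trans nn)// leq_addr.
  by have := dyadic_le (n + p).+1 t01; rewrite h.
have -> : x - z = (x - f ((dyadic (n + p) t)%:R / 2 ^+ (n + p))) + a by rewrite /a /z; ring.
apply: (le_trans (ler_normD _ _)); apply: (le_trans (lerD step IH)).
set Q := q ^+ (n + p); have Q0 : 0 <= Q by rewrite exprn_ge0// ltW.
have -> : (1 - q)^-1 * (q ^+ n - q ^+ (n + p).+1) = Q + (1 - q)^-1 * (q ^+ n - Q).
  by rewrite exprS /Q; field; rewrite gt_eqF.
by rewrite lerD2r exprS -/Q ler_piMl// ltW.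
Qed.

(** Chaining: increments of size [q ^ n] between dyadic neighbours add up to a
    geometric series, which gives Hölder continuity with exponent [- log_2 q]. *)
Lemma dyadic_increments_holder (R : realType) (f : R -> R) (beta : R) (n0 : nat) :
  0 < beta -> {within `[0, 1], continuous f} ->
  (forall n, (n0 <= n)%N -> forall k : nat, (k < 2 ^ n)%N ->
    `|f (k.+1%:R / 2 ^+ n) - f (k%:R / 2 ^+ n)| <= (2 ^+ n) `^ (- beta)) ->
  exists2 K : R, 0 <= K & forall s t, 0 <= s <= 1 -> 0 <= t <= 1 ->
    `|f t - f s| <= K * `|t - s| `^ beta.
Proof.
move=> b0 cf hf.
pose q : R := 2 `^ (- beta).
have q0 : 0 < q by rewrite powR_gt0.
have q1 : q < 1.
  by rewrite /q /powR ?gt_eqF// expR_lt1 mulNr oppr_lt0 mulr_gt0// ln_gt0// ltr1n.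
have q01 : 0 < q < 1 by rewrite q0.
have qE n : (2 ^+ n) `^ (- beta) = q ^+ n :> R.
  by rewrite -(powR_mulrn n (ler0n R 2)) -(powR_mulrn n (ltW q0)) -!powRrM mulrC.
have hf' n : (n0 <= n)%N -> forall k : nat, (k < 2 ^ n)%N ->
    `|f (k.+1%:R / 2 ^+ n) - f (k%:R / 2 ^+ n)| <= q ^+ n.
  by move=> nn k kn; rewrite -qE; exact: hf.
pose c := (1 - q)^-1; have c0 : 0 < c by rewrite invr_gt0; lra.
have p0 n : 0 < 2 ^+ n :> R by rewrite exprn_gt0.
have d01 n (t : R) : 0 <= t <= 1 -> 0 <= ((dyadic n t)%:R : R) / 2 ^+ n <= 1.
  move=> t01; rewrite divr_ge0 ?(ltW (p0 _))//= ler_pdivrMr// mul1r.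
  by have := dyadic_le n t01; rewrite -(ler_nat R) natrX.
(* The chain of dyadic approximations of [t] converges to [t]; continuity turns
   the estimate along the chain into one for [f t]. *)
have near_dyadic n (t : R) : (n0 <= n)%N -> 0 <= t <= 1 ->
    `|f t - f ((dyadic n t)%:R / 2 ^+ n)| <= c * q ^+ n.
  move=> nn t01; have /andP[t0 t1] := t01; apply/ler_addgt0Pr => e e0.
  have := (subspace_continuousP _ f).1 cf t; rewrite /= in_itv/= => /(_ t01).
  move=> /cvgrPdist_lt /(_ e e0); rewrite near_withinE => /nbhs_ballP[r /= r0 hr].
  have [N Nr] : exists N : nat, (2 ^+ (n + N))^-1 < r.
    exists (Num.truncn r^-1).+1.
    rewrite -[ltRHS]invrK ltf_pV2 ?posrE ?invr_gt0//.
    apply: (lt_le_trans (truncnS_gt _)).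
    rewrite -natrX ler_nat (leq_trans (ltnW (ltn_expl _ (isT : 1 < 2)%N)))//.
    by rewrite leq_exp2l// leq_addl.
  pose x : R := (dyadic (n + N) t)%:R / 2 ^+ (n + N).
  have fx : `|f t - f x| < e.
    apply: hr; last by rewrite /= in_itv/= d01.
    rewrite /ball/=; apply: le_lt_trans Nr.
    have /andP[h1 h2] := dyadic_itv (n + N) t0.
    rewrite ger0_norm ?subr_ge0// /x.
    by move: h2; rewrite -natr1 mulrDl mul1r => /ltW; rewrite lerBlDl.
  have -> : f t - f ((dyadic n t)%:R / 2 ^+ n) = (f t - f x) + (f x - f ((dyadic n t)%:R / 2 ^+ n)) by ring.
  apply: (le_trans (ler_normD _ _)); rewrite addrC; apply: lerD (ltW fx).
  apply: (le_trans (dyadic_chain N q01 t01 hf' nn)).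
  by rewrite ler_wpM2l ?(ltW c0)// gerBl exprn_ge0// ltW.
(* The increments are controlled from level [n0] on only; longer increments are
   bounded by the finitely many values at level [n0]. *)
pose S := \sum_(k < (2 ^ n0).+1) `|f (k%:R / 2 ^+ n0)|.
have coarse (t : R) : 0 <= t <= 1 -> `|f t| <= c * q ^+ n0 + S.
  move=> t01; have := near_dyadic n0 t (leqnn _) t01.
  have := dyadic_le n0 t01; rewrite -ltnS; set k := dyadic _ _ => kn h.
  have : `|f (k%:R / 2 ^+ n0)| <= S.
    rewrite /S (bigD1 (Ordinal kn))//= lerDl; exact: sumr_ge0.
  have -> : f t = (f t - f (k%:R / 2 ^+ n0)) + f (k%:R / 2 ^+ n0) by ring.
  move=> h2; apply: (le_trans (ler_normD _ _)); exact: lerD.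
have S0 : 0 <= S by exact: sumr_ge0.
pose K1 := 2 * (c * q ^+ n0 + S) * q ^- n0.
pose K2 := (2 * c + 1) * q^-1.
have cq n : 0 <= c * q ^+ n by rewrite mulr_ge0 ?exprn_ge0// ltW.
have K10 : 0 <= K1 by rewrite mulr_ge0 ?invr_ge0 ?exprn_ge0 ?(ltW q0)// mulr_ge0// addr_ge0.
have K20 : 0 <= K2 by rewrite mulr_ge0 ?invr_ge0 ?(ltW q0)//; lra.
exists (K1 + K2); first exact: addr_ge0.
have powq (x : R) n : (2 ^+ n)^-1 <= x -> q ^+ n <= x `^ beta.
  move=> hx; have x0 : 0 < x by apply: lt_le_trans hx; rewrite invr_gt0.
  rewrite -qE powRN -powR_inv1 ?powR_ge0// -powRrM mulrC powRrM.
  rewrite powR_inv1 ?(ltW (p0 _))//.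
  by apply: ge0_ler_powR; rewrite ?nnegrE ?invr_ge0 ?(ltW (p0 _)) ?(ltW b0) ?(ltW x0).
move=> s t; wlog st : s t / s < t => [hw|] s01 t01.
  have [h|h|->] := ltgtP s t; first exact: hw.
    by rewrite distrC [X in _ * X `^ _]distrC; exact: hw.
  by rewrite subrr normr0 mulr_ge0// ?powR_ge0 ?addr_ge0.
rewrite (gtr0_norm (x := t - s)) ?subr_gt0//.
set h := t - s; have h0 : 0 < h by rewrite subr_gt0.
have [hc|hc] := leP (2 ^+ n0)^-1 h.
  rewrite mulrDl -[leLHS]addr0; apply: lerD; last by rewrite mulr_ge0// powR_ge0.
  apply: (@le_trans _ _ (K1 * q ^+ n0)); last by rewrite ler_wpM2l// powq.
  rewrite /K1 -mulrA mulVf ?gt_eqF ?exprn_gt0// mulr1.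
  apply: (le_trans (ler_normB _ _)).
  have := coarse t t01; have := coarse s s01; lra.
have ex : exists n, (2 ^+ n)^-1 <= h.
  exists (Num.truncn h^-1).+1.
  rewrite -[leRHS]invrK lef_pV2 ?posrE ?invr_gt0//.
  apply: (le_trans (ltW (truncnS_gt _))).
  by rewrite -natrX ler_nat ltnW// ltn_expl.
case: (ex_minnP ex) => -[|n] hn minn.
  exfalso; move: hc hn; rewrite expr0 invr1 => hc hn.
  have : h <= 1 by rewrite /h; move/andP: t01 => []; move/andP: s01 => []; lra.
  have : (2 ^+ n0)^-1 <= 1 :> R by rewrite invf_le1// exprn_ege1// ler1n.
  lra.
have nh : h < (2 ^+ n)^-1.
  by rewrite ltNge; apply/negP => /minn; rewrite ltnn.
have nn : (n0 <= n)%N.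
  rewrite leqNgt; apply/negP => nn0; move: hc; apply/negP; rewrite -leNgt.
  apply: le_trans hn; rewrite lef_pV2 ?posrE//.
  by rewrite ler_eXn2l ?ltr1n.
rewrite mulrDl -[leLHS]add0r; apply: lerD; first by rewrite mulr_ge0// powR_ge0.
apply: (@le_trans _ _ (K2 * q ^+ n.+1)); last by rewrite ler_wpM2l// powq.
rewrite /K2 exprS -mulrA mulKf ?gt_eqF// mulrDl mul1r.
have /andP[s0 _] := s01; have /andP[t0 t1] := t01.
have := dyadic_itv n s0; have := dyadic_itv n t0.
have h1 := near_dyadic n t nn t01; have h2 := near_dyadic n s nn s01.
have ktn := dyadic_le n t01.
move: h1 h2 ktn; move: (dyadic n t) (dyadic n s) => kt ks h1 h2 ktn /andP[t2 t3] /andP[s2 s3].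
have c1 : (ks <= kt)%N.
  rewrite -ltnS -(ltr_nat R) -(ltr_pM2r (x := (2 ^+ n)^-1)) ?invr_gt0//.
  by apply: (le_lt_trans s2); apply: lt_trans st t3.
have c2 : (kt < ks.+2)%N.
  rewrite -(ltr_nat R) -(ltr_pM2r (x := (2 ^+ n)^-1)) ?invr_gt0//.
  apply: (le_lt_trans t2); rewrite -[ks.+2%:R]natr1 mulrDl mul1r.
  by have -> : t = s + h by [rewrite /h; ring]; exact: ltrD.
have h3 : `|f (kt%:R / 2 ^+ n) - f (ks%:R / 2 ^+ n)| <= q ^+ n.
  have : kt = ks \/ kt = ks.+1 by clear -c1 c2; lia.
  case=> e; first by rewrite e subrr normr0 exprn_ge0// ltW.
  by rewrite e hf'// -e.
have -> : f t - f s = (f t - f (kt%:R / 2 ^+ n)) + (f (kt%:R / 2 ^+ n) - f (ks%:R / 2 ^+ n)) -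
   (f s - f (ks%:R / 2 ^+ n)) by ring.
apply: (le_trans (ler_normB _ _)); apply: (le_trans (lerD (ler_normD _ _) (lexx _))).
lra.
Qed.

(** * Covering numbers and upper Minkowski dimension *)

Lemma covering_number_le_seq (R : realType) (T : metricType R) (X A : set T) (r : R) (s : seq T) :
  (forall c, c \in s -> X c) -> A `<=` [set y | exists2 c, c \in s & cball c (r / 2) y] ->
  (covering_number X r A <= (size s)%:R%:E)%E.
Proof.
move=> sX As; apply: ereal_inf_lbound; exists (size s) => //.
exists (fun i => tnth (in_tuple s) i); split=> [i|y /As[c cs cy]].
  by apply: sX; exact: mem_tnth.
by have /tnthP[i ci] : c \in in_tuple s; [exact: cs|exists i; rewrite /= -ci].
Qed.

Lemma covering_number_ge0 (R : realType) (T : metricType R) (X A : set T) (r : R) :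
  (0 <= covering_number X r A)%E.
Proof. by apply: le_ereal_inf_tmp => _ [n _ <-]; rewrite lee_fin. Qed.

(** With [upper_minkowski_le], this replaces the limit superior of logarithms by
    power bounds for covering numbers at small scales. *)
Lemma upper_minkowski_lt (R : realType) (T : metricType R) (X : set T) (g : R) :
  (upper_minkowski_dim X < g%:E)%E ->
  exists2 r0, 0 < r0 & forall r : R, 0 < r < r0 -> (covering_number X r X <= (r `^ (- g))%:E)%E.
Proof.
rewrite /upper_minkowski_dim limf_esupE => /ereal_inf_lt[_ [V VF <-]] Vg.
have [r0 /= r00 Hr0] := VF.
exists (Num.min r0 1); first by rewrite lt_min r00 ltr01.
move=> r /andP[rp]; rewrite lt_min => /andP[rr0 r1].
have Vr : V r.
  by apply: Hr0 => //; rewrite /= sub0r normrN gtr0_norm.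
set N := covering_number X r X.
have L0 : 0 < ln r^-1 by rewrite ln_gt0// invf_gt1.
have hq : (lne N * ((ln r^-1)^-1)%:E < g%:E)%E.
  by apply: le_lt_trans Vg; apply: ereal_sup_ubound; exists r.
have hN : (lne N <= (g * ln r^-1)%:E)%E.
  by rewrite EFinM -lee_pdivrMr// ltW.
have N0 : (0 <= N)%E by exact: covering_number_ge0.
have p0 : 0 < r `^ (- g) by rewrite powR_gt0.
have iN : N \in `[0%E, +oo%E] by rewrite in_itv/= N0 leey.
have ip : (r `^ (- g))%:E \in `[0%E, +oo%E] by rewrite in_itv/= lee_fin (ltW p0) leey.
by rewrite -(lee_lne iN ip) lne_EFin// ln_powR mulNr -mulrN -lnV.
Qed.

Lemma upper_minkowski_le (R : realType) (T : metricType R) (X : set T) (C g r0 : R) :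
  0 < C -> 0 < r0 ->
  (forall r : R, 0 < r < r0 -> (covering_number X r X <= (C * r `^ (- g))%:E)%E) ->
  (upper_minkowski_dim X <= g%:E)%E.
Proof.
move=> C0 r00 H; apply/lee_addgt0Pr => e e0.
rewrite /upper_minkowski_dim limf_esupE.
pose r1 := Num.min (Num.min r0 1) (expR (- (`|ln C| / e))).
have r10 : 0 < r1 by rewrite !lt_min r00 ltr01 expR_gt0.
pose V := [set r : R | 0 < r < r1].
have VF : 0^'+ V.
  exists r1 => // r /=; rewrite sub0r normrN => h r0'; rewrite /V/= r0'.
  by move: h; rewrite gtr0_norm.
apply: (le_trans (ereal_inf_lbound _)); first by exists V; [exact: VF|reflexivity].
apply: ge_ereal_sup => _ [r /= /andP[rp]] + <-.
rewrite !lt_min => /andP[/andP[rr0 r1'] re].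
have L0 : 0 < ln r^-1 by rewrite ln_gt0// invf_gt1.
have hN := H r; rewrite rp rr0 in hN; have {}hN := hN isT.
have p0 : 0 < r `^ (- g) by rewrite powR_gt0.
have cp0 : 0 < C * r `^ (- g) by rewrite mulr_gt0.
have iN : covering_number X r X \in `[0%E, +oo%E] by rewrite in_itv/= covering_number_ge0 leey.
have ip : (C * r `^ (- g))%:E \in `[0%E, +oo%E] by rewrite in_itv/= lee_fin (ltW cp0) leey.
move: hN; rewrite -(lee_lne iN ip) (lne_EFin cp0) lnM ?posrE// ln_powR mulNr -mulrN -lnV// => hN.
rewrite lee_pdivrMr//.
apply: (le_trans hN).
rewrite -EFinD -EFinM lee_fin mulrDl addrC lerD2l.
apply: (le_trans (ler_norm _)); rewrite -ler_pdivrMl// mulrC.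
rewrite -[leLHS]opprK lnV// lerN2.
by rewrite -[leRHS]expRK ler_ln ?posrE ?expR_gt0// ltW.
Qed.

(** * Hausdorff null sets *)

Lemma diam_le (R : realType) (T : metricType R) (A : set T) (r : R) :
  (forall x y, A x -> A y -> mdist x y <= r) -> (diam A <= r%:E)%E.
Proof. by move=> h; apply: ge_ereal_sup => _ [x Ax [y Ay <-]]; rewrite lee_fin h. Qed.

Lemma mdist_le_diam (R : realType) (T : metricType R) (A : set T) (r : R) (x y : T) :
  (diam A <= r%:E)%E -> A x -> A y -> mdist x y <= r.
Proof.
move=> Ar Ax Ay; rewrite -lee_fin; apply: le_trans Ar.
by apply: ereal_sup_ubound; exists x => //; exists y.
Qed.

Lemma diam_nonempty (R : realType) (T : metricType R) (A : set T) (r : R) :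
  A !=set0 -> (diam A <= r%:E)%E -> exists2 a : R, diam A = a%:E & 0 <= a <= r.
Proof.
move=> [x Ax] Ar.
have d0 : (0 <= diam A)%E.
  apply: ereal_sup_ubound; exists x => //; exists x => //; congr EFin.
  exact: mdistxx.
have fd : diam A \is a fin_num by rewrite ge0_fin_numE// (le_lt_trans Ar)// ltry.
by exists (fine (diam A)); [rewrite fineK|rewrite fine_ge0//= -lee_fin fineK].
Qed.

Lemma hausdorff_null_cover (R : realType) (T : metricType R) (s e delta : R) (A : set T) :
  hausdorff_measure s A = 0%E -> 0 < e -> 0 < delta ->
  exists F : nat -> set T, [/\ A `<=` \bigcup_i F i, forall i, (diam (F i) <= delta%:E)%E &
    (\sum_(i <oo) (if F i != set0 then poweR (diam (F i)) s else 0) <= e%:E)%E].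
Proof.
move=> HA e0 d0.
have : (hausdorff_pre s delta A < e%:E)%E.
  apply: (@le_lt_trans _ _ 0%E); last by rewrite lte_fin.
  by rewrite -HA; apply: ereal_sup_ubound; exists delta.
move=> /ereal_inf_lt[_ [F [AF Fd] <-]] h; exists F; split => //.
by rewrite -eseries_mkcond; exact: ltW.
Qed.

Lemma cover_hausdorff_null (R : realType) (T : metricType R) (s : R) (A : set T) :
  (forall e delta : R, 0 < e -> 0 < delta -> exists (F : nat -> set T) (a : nat -> \bar R),
    [/\ A `<=` \bigcup_i F i, forall i, (diam (F i) <= delta%:E)%E,
      forall i, (0 <= a i)%E, forall i, F i !=set0 -> (poweR (diam (F i)) s <= a i)%E &
      (\sum_(i <oo) a i <= e%:E)%E]) ->
  hausdorff_measure s A = 0%E.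
Proof.
move=> H; apply/eqP; rewrite eq_le; apply/andP; split; last first.
  apply: (@le_trans _ _ (hausdorff_pre s 1 A)); last by apply: ereal_sup_ubound; exists 1 => //=; exact: ltr01.
  apply: le_ereal_inf_tmp => _ [F _ <-]; apply: nneseries_ge0 => i _ _.
  exact: poweR_ge0.
apply: ge_ereal_sup => _ [delta /= d0 <-].
apply/lee_addgt0Pr => e e0; rewrite add0e.
have [F [a [AF Fd a0 Fa ae]]] := H e delta e0 d0.
apply: (le_trans (ereal_inf_lbound _)); first by exists F; [split|reflexivity].
apply: le_trans ae; rewrite eseries_mkcond; apply: lee_nneseries => [i _ _|i _].
  by case: ifP => // _; exact: poweR_ge0.
by case: ifPn => [/set0P/Fa//|_]; exact: a0.
Qed.

(** Covers indexed by pairs are what one obtains both from countable unions and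
    from covering each element of a cover again. *)
Lemma double_cover_hausdorff_null (R : realType) (T : metricType R) (s : R) (A : set T) :
  (forall e delta : R, 0 < e -> 0 < delta ->
    exists (F : nat -> nat -> set T) (a : nat -> nat -> \bar R),
    [/\ A `<=` \bigcup_i \bigcup_j F i j, forall i j, (diam (F i j) <= delta%:E)%E,
      forall i j, (0 <= a i j)%E, forall i j, F i j !=set0 -> (poweR (diam (F i j)) s <= a i j)%E &
      (\sum_(i <oo) \sum_(j <oo) a i j <= e%:E)%E]) ->
  hausdorff_measure s A = 0%E.
Proof.
move=> H; apply: cover_hausdorff_null => e delta e0 d0.
have [F [a [AF Fd a0 Fa ae]]] := H e delta e0 d0.
have /card_esym/ppcard_eqP[p] := card_nat2.
exists (fun k => F (p k).1 (p k).2), (fun k => a (p k).1 (p k).2); split => //.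
- move=> x /AF[i _ [j _ Fx]]; exists (p^-1%FUN (i, j)) => //=.
  by rewrite invK ?inE.
- move=> k; exact: Fa.
- apply: le_trans ae; rewrite nneseries_esumT//.
  rewrite -(reindex_esum setT setT p (fun q => a q.1 q.2))//.
  rewrite nneseries_esumT; last by move=> i; apply: nneseries_ge0.
  rewrite (eq_esum (b := fun i => \esum_(j in [set: nat]) a i j)%E); last first.
    by move=> i _; rewrite nneseries_esumT.
  rewrite (esum_esum (fun i j _ _ => a0 i j)) le_eqVlt; apply/orP; left; apply/eqP.
  by congr esum; apply/seteqP; split => // -[].
Qed.

Lemma hausdorff_null_bigcup (R : realType) (T : metricType R) (s : R) (A : nat -> set T) :
  (forall i, hausdorff_measure s (A i) = 0%E) -> hausdorff_measure s (\bigcup_i A i) = 0%E.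
Proof.
move=> HA; apply: double_cover_hausdorff_null => e delta e0 d0.
have ei i : 0 < e / (2 ^ i.+1)%:R by rewrite divr_gt0// ltr0n expn_gt0.
pose F i := sval (cid (hausdorff_null_cover (HA i) (ei i) d0)).
have FP i : [/\ A i `<=` \bigcup_j F i j, forall j, (diam (F i j) <= delta%:E)%E &
    (\sum_(j <oo) (if F i j != set0 then poweR (diam (F i j)) s else 0) <= (e / (2 ^ i.+1)%:R)%:E)%E].
  by rewrite /F; case: cid.
have a0 i j : (0 <= if F i j != set0 then poweR (diam (F i j)) s else 0)%E.
  by case: ifP => // _; exact: poweR_ge0.
exists F, (fun i j => if F i j != set0 then poweR (diam (F i j)) s else 0%E); split => //.
- by move=> x [i _ Ax]; exists i => //; have [h _ _] := FP i; exact: h.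
- by move=> i j; have [_ h _] := FP i.
- by move=> i j /set0P ->.
- apply: le_trans (epsilon_trick0 xpredT (ltW e0)).
  by apply: lee_nneseries => [i _ _|i _]; [exact: nneseries_ge0|have [] := FP i].
Qed.

(** * Images under Hölder maps *)

Lemma powR_invK (R : realType) (x b : R) : 0 <= x -> b != 0 -> (x `^ b^-1) `^ b = x.
Proof. by move=> x0 b0; rewrite -powRrM mulVf// powRr1. Qed.

Lemma powR_Kinv (R : realType) (x b : R) : 0 <= x -> b != 0 -> (x `^ b) `^ b^-1 = x.
Proof. by move=> x0 b0; rewrite -powRrM mulfV// powRr1. Qed.

(** The [s / b]-cost of the image of a set is at most [K ^ (s / b)] times the
    [s]-cost of the set. *)
Lemma hausdorff_null_image (R : realType) (f : R -> R) (K b s : R) (A : set R^o) :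
  0 < K -> 0 < b -> 0 <= s ->
  (forall x y, A x -> A y -> `|f y - f x| <= K * `|y - x| `^ b) ->
  hausdorff_measure s A = 0%E -> hausdorff_measure (s / b) (f @` A : set R^o) = 0%E.
Proof.
move=> K0 b0 s0 hf HA; apply: cover_hausdorff_null => e delta e0 d0.
have Ks : 0 < K `^ (s / b) by rewrite powR_gt0.
pose d' := (delta / K) `^ b^-1.
have d'0 : 0 < d' by rewrite powR_gt0// divr_gt0.
have [F [AF Fd Fe]] := hausdorff_null_cover HA (divr_gt0 e0 Ks) d'0.
have bn : b != 0 by rewrite gt_eqF.
pose G i : set R^o := f @` (A `&` F i).
have Gd i r : (diam (F i) <= r%:E)%E -> 0 <= r -> (diam (G i) <= (K * r `^ b)%:E)%E.
  move=> Fr r0; apply: diam_le => _ _ [x [Ax Fx] <-] [y [Ay Fy] <-].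
  rewrite mdistRE; apply: (le_trans (hf _ _ Ax Ay)); rewrite ler_wpM2l ?(ltW K0)//.
  apply: ge0_ler_powR; rewrite ?nnegrE ?(ltW b0)//.
  by have := mdist_le_diam Fr Fx Fy; rewrite mdistRE.
have w0 i : (0 <= if F i != set0 then poweR (diam (F i)) s else 0)%E.
  by case: ifP => // _; exact: poweR_ge0.
exists G, (fun i => ((K `^ (s / b))%:E * (if F i != set0 then poweR (diam (F i)) s else 0))%E); split.
- by move=> _ [x Ax <-]; have [i _ Fx] := AF x Ax; exists i => //; exists x.
- move=> i; apply: (le_trans (Gd i _ (Fd i) (ltW d'0))).
  by rewrite /d' powR_invK// ?divr_ge0 ?(ltW d0) ?(ltW K0)// mulrC divfK ?gt_eqF.
- by move=> i; rewrite mule_ge0// lee_fin ltW.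
- move=> i Gi; have [_ [x [Ax Fx] _]] := Gi.
  have Fi : F i !=set0 by exists x.
  have /set0P -> := Fi.
  have [r re /andP[r0 _]] := diam_nonempty Fi (Fd i).
  have Fr : (diam (F i) <= r%:E)%E by rewrite re.
  have [g ge /andP[g0 gr]] := diam_nonempty Gi (Gd i r Fr r0).
  rewrite re ge !poweR_EFin -EFinM lee_fin.
  apply: (@le_trans _ _ ((K * r `^ b) `^ (s / b))).
    apply: ge0_ler_powR; rewrite ?nnegrE// ?divr_ge0 ?(ltW b0)//.
    by rewrite mulr_ge0 ?powR_ge0 ?(ltW K0).
  by rewrite powRM ?powR_ge0 ?(ltW K0)// -powRrM mulrCA divff// mulr1.
- rewrite nneseriesZl//; apply: (le_trans (lee_wpmul2l _ Fe)); first by rewrite lee_fin ltW.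
  by rewrite -EFinM lee_fin mulrC divfK ?gt_eqF.
Qed.

(** Centres of balls are points of the set, so their images are admissible
    centres for the image. *)
Lemma upper_minkowski_image (R : realType) (f : R -> R) (K b g : R) (A : set R^o) :
  0 < K -> 0 < b ->
  (forall x y, A x -> A y -> `|f y - f x| <= K * `|y - x| `^ b) ->
  (upper_minkowski_dim A < g%:E)%E -> (upper_minkowski_dim (f @` A : set R^o) <= (g / b)%:E)%E.
Proof.
move=> K0 b0 hf /upper_minkowski_lt[r0 r00 Hr0].
have bn : b != 0 by rewrite gt_eqF.
have K2 : 0 < 2 * K by rewrite mulr_gt0.
pose C := 2 `^ (- g) * ((2 * K)^-1) `^ (- (g / b)).
apply: (@upper_minkowski_le _ _ _ C _ (2 * K * (r0 / 2) `^ b)).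
- by rewrite mulr_gt0 ?powR_gt0 ?invr_gt0.
- by rewrite mulr_gt0 ?powR_gt0 ?divr_gt0.
move=> r /andP[rp rr0].
have rK : 0 < r / (2 * K) by rewrite divr_gt0.
pose t := 2 * (r / (2 * K)) `^ b^-1.
have tp : 0 < t by rewrite mulr_gt0// powR_gt0.
have tr0 : t < r0.
  rewrite /t -ltr_pdivlMl// [ltRHS]mulrC -[ltRHS](powR_Kinv (b := b))// ?divr_ge0 ?(ltW r00)//.
  apply: gt0_ltr_powR; rewrite ?invr_gt0 ?nnegrE ?powR_ge0 ?(ltW rK)//.
  by rewrite ltr_pdivrMr// [ltRHS]mulrC.
have := Hr0 t; rewrite tp tr0 => /(_ isT) /covering_number_attained[n [c [nt Ac cA]]].
have -> : C * r `^ (- (g / b)) = t `^ (- g).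
  rewrite /C /t [in RHS]powRM ?powR_ge0// -powRrM mulrN [b^-1 * g]mulrC.
  by rewrite [r / _]mulrC powRM ?invr_ge0 ?(ltW rp) ?(ltW K2)// mulrA.
apply: (@le_trans _ _ (n%:R%:E)%E); last by rewrite lee_fin.
pose sq : seq R^o := [seq f (c i) | i <- enum 'I_n].
have <- : size sq = n by rewrite size_map size_enum_ord.
apply: covering_number_le_seq.
  by move=> _ /mapP[i _ ->]; exists (c i).
move=> _ [x Ax <-]; have [i /=] := cA _ Ax; rewrite /cball/= mdistRE => xi.
exists (f (c i)); first by apply: map_f; rewrite mem_enum.
rewrite /= mdistRE; apply: (le_trans (hf _ _ (Ac i) Ax)).
apply: (@le_trans _ _ (K * (t / 2) `^ b)).
  rewrite ler_wpM2l ?(ltW K0)//; apply: ge0_ler_powR; rewrite ?nnegrE ?(ltW b0)//.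
  by rewrite divr_ge0// ltW.
have -> : t / 2 = (r / (2 * K)) `^ b^-1 by rewrite /t; field.
rewrite powR_invK// ?(ltW rK)// le_eqVlt; apply/orP; left; apply/eqP.
by field; rewrite gt_eqF.
Qed.

(** * Pulling back covers through thin fibres *)

(** A substitute for an inverse Hölder condition, for maps that need not be
    injective: when [eta] is small, the fibre of an interval of the size that a
    cell would have under a Hölder map of exponent [alpha] consists of little
    more than one cell. *)
Definition sparse_fibres (R : realType) (f : R -> R) (alpha eta : R) (E : set R) : Prop :=
  exists2 C : R, 0 < C & exists n0 : nat, forall n, (n0 <= n)%N -> forall u : R,
    exists2 s : seq nat, (size s)%:R <= C * (2 ^+ n) `^ eta &
      forall t, E t -> `|f t - u| <= (2 ^+ n) `^ (- alpha) ->
        exists2 k, k \in s & k%:R <= 2 ^+ n * t < k.+1%:R.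

Lemma dyadic_powR_small (R : realType) (h e : R) (N : nat) : 0 < h -> 0 < e ->
  exists2 n, (N <= n)%N & (2 ^+ n) `^ (- h) <= e.
Proof.
move=> h0 e0; pose x := (e^-1) `^ h^-1.
exists (N + (Num.truncn x).+1)%N; first exact: leq_addr.
have p0 i : 0 < 2 ^+ i :> R by rewrite exprn_gt0.
rewrite powRN -[leRHS]invrK lef_pV2 ?posrE ?invr_gt0 ?powR_gt0//.
rewrite -[leLHS](powR_invK (b := h)) ?gt_eqF ?invr_ge0 ?(ltW e0)// -/x.
apply: ge0_ler_powR; rewrite ?nnegrE ?powR_ge0 ?(ltW h0) ?(ltW (p0 _))//.
apply: (le_trans (ltW (truncnS_gt x))); rewrite -natrX ler_nat.
by rewrite (leq_trans (ltnW (ltn_expl _ (isT : 1 < 2)%N)))// leq_exp2l// leq_addl.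
Qed.

(** The scale at which to pull back a set of diameter [d]: essentially
    [d ^ (1 / alpha)], and so small that it costs less than [e] when [d] is
    zero. *)
Lemma dyadic_scale (R : realType) (alpha s h d e : R) (N : nat) :
  0 < alpha -> 0 <= s -> s * alpha < h -> 0 < e -> 0 <= d <= (2 ^+ N) `^ (- alpha) ->
  exists n, [/\ (N <= n)%N, d <= (2 ^+ n) `^ (- alpha) &
    (2 ^+ n) `^ (- h) <= 2 `^ (s * alpha) * d `^ s + e].
Proof.
move=> a0 s0 sh e0 /andP[d0 dN].
have h0 : 0 < h by apply: le_lt_trans sh; rewrite mulr_ge0// ltW.
have p0 i : 0 < 2 ^+ i :> R by rewrite exprn_gt0.
move: d0; rewrite le_eqVlt => /predU1P[<-|d0].
  have [n Nn he] := dyadic_powR_small N h0 e0; exists n; split => //.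
  by apply: (le_trans he); rewrite lerDr mulr_ge0// powR_ge0.
have ex : exists n, (2 ^+ n) `^ (- alpha) < d.
  have [n _ hn] := dyadic_powR_small 0 a0 (divr_gt0 d0 (ltr0n _ 2)).
  by exists n; apply: (le_lt_trans hn); rewrite ltr_pdivrMr//; lra.
case: (ex_minnP ex) => n1 hn1 minn1.
have Nn1 : (N < n1)%N.
  rewrite ltnNge; apply/negP => n1N.
  have : (2 ^+ N) `^ (- alpha) <= (2 ^+ n1) `^ (- alpha) :> R.
    rewrite !powRN lef_pV2 ?posrE ?powR_gt0//.
    apply: ge0_ler_powR; rewrite ?nnegrE ?(ltW a0) ?(ltW (p0 _))//.
    by rewrite ler_eXn2l ?ltr1n.
  by move=> h1; move: (lt_le_trans hn1 dN); rewrite ltNge h1.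
case: n1 hn1 minn1 Nn1 => // n hn1 minn1 Nn1; exists n; split => //.
  by rewrite leNgt; apply/negP => /minn1; rewrite ltnn.
rewrite -[leLHS]addr0; apply: lerD (ltW e0).
apply: (@le_trans _ _ ((2 ^+ n) `^ (- (s * alpha)))).
  by apply: ler_powR; [rewrite exprn_ege1// ler1n|rewrite lerN2 ltW].
have -> : (2 ^+ n) `^ (- (s * alpha)) = 2 `^ (s * alpha) * ((2 ^+ n.+1) `^ (- alpha)) `^ s :> R.
  rewrite -powRrM exprS powRM// ?(ltW (p0 _))// mulrA.
  have -> : - alpha * s = - (s * alpha) by ring.
  by rewrite [2 `^ (- _)]powRN mulfV ?mul1r// gt_eqF// powR_gt0.
rewrite ler_wpM2l ?powR_ge0//.
by apply: ge0_ler_powR; rewrite ?nnegrE ?powR_ge0 ?(ltW d0) ?(ltW hn1).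
Qed.

Lemma nneseries_nat_cst (R : realType) (n : nat) (x : R) : 0 <= x ->
  (\sum_(k <oo) (if (k < n)%N then x%:E else 0) = (n%:R * x)%:E)%E.
Proof.
move=> x0; rewrite (nneseries_split 0 n); last by move=> k _; case: ifP.
rewrite add0n [X in (_ + X)%E]eseries0 ?adde0; last by move=> k nk _; rewrite ltnNge nk.
rewrite big_mkord (eq_bigr (fun=> x%:E)); last by move=> i _; rewrite ltn_ord.
by rewrite sumEFin sumr_const card_ord mulr_natl.
Qed.

Lemma cell_mdist_le (R : realType) (n k : nat) (x y : R) :
  k%:R <= 2 ^+ n * x < k.+1%:R -> k%:R <= 2 ^+ n * y < k.+1%:R -> `|y - x| <= (2 ^+ n)^-1.
Proof.
have p0 : 0 < 2 ^+ n :> R by rewrite exprn_gt0.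
move=> /andP[x1 x2] /andP[y1 y2].
rewrite -(ler_pM2l p0) divff ?gt_eqF// -{1}(gtr0_norm p0) -normrM mulrBr ler_norml.
move: x2 y2; rewrite -natr1 => x2 y2; apply/andP; split; lra.
Qed.

(** Each element [G] of a cover of [f @` A] is replaced by the few dyadic cells
    that cover its fibre.  Their total [s']-cost is
    [C * 2 ^ (n * (eta - s'))], which [dyadic_scale] bounds by a multiple of
    [diam G ^ s], up to a summable error, because [s * alpha < s' - eta]. *)
Lemma hausdorff_null_fibres (R : realType) (f : R -> R) (alpha eta s s' : R) (E : set R) (A : set R^o) :
  0 < alpha -> 0 <= s -> s * alpha + eta < s' -> 0 <= s' -> sparse_fibres f alpha eta E -> A `<=` E ->
  hausdorff_measure s (f @` A : set R^o) = 0%E -> hausdorff_measure s' A = 0%E.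
Proof.
move=> a0 s0 ss s'0 [C C0 [n0 HC]] AE HfA.
apply: double_cover_hausdorff_null => e delta e0 d0.
have p0 i : 0 < 2 ^+ i :> R by rewrite exprn_gt0.
have [N n0N Nd] : exists2 N, (n0 <= N)%N & (2 ^+ N)^-1 <= delta.
  have [N h1 h2] := dyadic_powR_small n0 (@ltr01 R) d0; exists N => //.
  by rewrite -powR_inv1// ltW.
pose c : R := 2 `^ (s * alpha); have c0 : 0 < c by rewrite powR_gt0.
pose e1 := e / 2 / (C * c); have e10 : 0 < e1 by rewrite !divr_gt0// mulr_gt0.
pose e2 := e / 2 / C; have e20 : 0 < e2 by rewrite !divr_gt0.
have N0 : 0 < (2 ^+ N) `^ (- alpha) by rewrite powR_gt0.
have [G [AG Gd Ge]] := hausdorff_null_cover HfA e10 N0.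
pose w j : \bar R := if G j != set0 then poweR (diam (G j)) s else 0%E.
have w0 j : (0 <= w j)%E by rewrite /w; case: ifP => // _; exact: poweR_ge0.
have sh : s * alpha < s' - eta by rewrite ltrBrDr.
pose e2_ j := e2 / (2 ^ j.+1)%:R.
have e2_0 j : 0 < e2_ j by rewrite divr_gt0// ltr0n expn_gt0.
have pick j : exists ns : nat * seq nat, [/\ (N <= ns.1)%N,
    (((size ns.2)%:R * (2 ^+ ns.1) `^ (- s'))%:E <= (C * c)%:E * w j + (C * e2_ j)%:E)%E &
    forall t, A t -> G j (f t) -> exists2 k, k \in ns.2 & k%:R <= 2 ^+ ns.1 * t < k.+1%:R].
  have [Gj|Gj] := pselect (G j !=set0); last first.
    exists (N, [::]); split => //=; last by move=> t _ Gt; exfalso; apply: Gj; exists (f t).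
    by rewrite mul0r adde_ge0// ?mule_ge0// lee_fin mulr_ge0// ?ltW// mulr_gt0.
  have [u Gu] := Gj; have [r re /andP[r0 rN]] := diam_nonempty Gj (Gd j).
  have rr : 0 <= r <= (2 ^+ N) `^ (- alpha) by rewrite r0.
  have [n [Nn rn hn]] := dyadic_scale a0 s0 sh (e2_0 j) rr.
  have [sq szsq Hsq] := HC n (leq_trans n0N Nn) u.
  exists (n, sq); split => //=; last first.
    move=> t At Gt; apply: Hsq; first exact: AE.
    apply: le_trans rn; have := @mdist_le_diam _ _ (G j) r u (f t).
    by rewrite re => /(_ (lexx _) Gu Gt).
  rewrite /w; have /set0P -> := Gj; rewrite re poweR_EFin -EFinM -EFinD lee_fin.
  apply: (@le_trans _ _ (C * (2 ^+ n) `^ eta * (2 ^+ n) `^ (- s'))).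
    by rewrite ler_wpM2r ?powR_ge0.
  rewrite -!mulrA -mulrDr ler_wpM2l ?(ltW C0)//.
  by rewrite -powRD ?(gt_eqF (p0 n)) ?implybT// -opprB.
pose n_ j := (sval (cid (pick j))).1; pose sq_ j := (sval (cid (pick j))).2.
have nsP j : [/\ (N <= n_ j)%N,
    (((size (sq_ j))%:R * (2 ^+ n_ j) `^ (- s'))%:E <= (C * c)%:E * w j + (C * e2_ j)%:E)%E &
    forall t, A t -> G j (f t) -> exists2 k, k \in sq_ j & k%:R <= 2 ^+ n_ j * t < k.+1%:R].
  by rewrite /n_ /sq_; case: cid.
pose F j k : set R^o := [set t | [/\ (k < size (sq_ j))%N, A t &
  (nth 0%N (sq_ j) k)%:R <= 2 ^+ n_ j * t < (nth 0%N (sq_ j) k).+1%:R]].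
have Fd j k : (diam (F j k) <= ((2 ^+ n_ j)^-1)%:E)%E.
  apply: diam_le => x y [_ _ hx] [_ _ hy]; exact: (cell_mdist_le hx hy).
exists F, (fun j k => if (k < size (sq_ j))%N then ((2 ^+ n_ j) `^ (- s'))%:E else 0%E); split.
- move=> t At; have [j _ Gt] := AG _ (imageP f At); have [_ _ /(_ t At Gt)[k ks kt]] := nsP j.
  exists j => //; exists (index k (sq_ j)) => //; split => //; first by rewrite index_mem.
  by rewrite nth_index.
- move=> j k; apply: (le_trans (Fd j k)); rewrite lee_fin; apply: le_trans Nd.
  have [Nj _ _] := nsP j.
  by rewrite lef_pV2 ?posrE// ler_eXn2l ?ltr1n.
- by move=> j k; case: ifP => // _; rewrite lee_fin powR_ge0.
- move=> j k Fjk; have [t [ks _ _]] := Fjk; rewrite ks.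
  have [r -> /andP[r0 rn]] := diam_nonempty Fjk (Fd j k).
  rewrite poweR_EFin lee_fin.
  have -> : (2 ^+ n_ j) `^ (- s') = ((2 ^+ n_ j)^-1) `^ s'.
    by rewrite -powR_inv1 ?(ltW (p0 _))// -powRrM mulN1r.
  by apply: ge0_ler_powR; rewrite ?nnegrE ?invr_ge0 ?(ltW (p0 _)).
- under eq_eseriesr do rewrite nneseries_nat_cst ?powR_ge0//.
  apply: (@le_trans _ _ (\sum_(j <oo) ((C * c)%:E * w j + (C * e2_ j)%:E))%E).
    apply: lee_nneseries => [j _ _|j _]; last by have [] := nsP j.
    by rewrite lee_fin mulr_ge0// powR_ge0.
  have Cc : (0 <= (C * c)%:E)%E by rewrite lee_fin mulr_ge0// ltW.
  rewrite nneseriesD; [|by move=> j _; rewrite mule_ge0|by move=> j _; rewrite lee_fin mulr_ge0// ltW].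
  under [X in (_ + X)%E]eq_eseriesr do rewrite EFinM.
  rewrite !nneseriesZl//; [|by move=> j _; rewrite lee_fin ltW].
  have h1 := lee_wpmul2l Cc Ge.
  have C0' : (0 <= C%:E)%E by rewrite lee_fin ltW.
  have h2 := lee_wpmul2l C0' (epsilon_trick0 xpredT (ltW e20)).
  apply: (le_trans (leeD h1 h2)); rewrite -!EFinM -EFinD lee_fin /e1 /e2.
  rewrite le_eqVlt; apply/orP; left; apply/eqP; field; rewrite !gt_eqF//.
Qed.

Lemma covering_number_cells (R : realType) (Z : set R^o) (n : nat) (r : R) (K : seq nat) :
  (2 ^+ n)^-1 <= r / 2 ->
  (forall t, Z t -> exists2 k, k \in K & k%:R <= 2 ^+ n * t < k.+1%:R) ->
  (covering_number Z r Z <= (size K)%:R%:E)%E.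
Proof.
move=> nr ZK; pose cell (k : nat) (t : R) := k%:R <= 2 ^+ n * t < k.+1%:R.
pose p k := xget (0 : R) [set t | Z t /\ cell k t].
pose s : seq R^o := [seq p k | k <- K & `[< exists t, Z t /\ cell k t >]].
apply: (@le_trans _ _ (size s)%:R%:E).
  apply: covering_number_le_seq.
    move=> _ /mapP[k + ->]; rewrite mem_filter => /andP[/asboolP[t Zt] _].
    by rewrite /p; case: xgetP => [x _ []|/(_ t)].
  move=> t Zt; have [k kK kt] := ZK t Zt.
  have ex : exists t, Z t /\ cell k t by exists t.
  exists (p k).
    by apply: (map_f p); rewrite mem_filter kK andbT; exact/asboolP.
  rewrite /cball/= ?mdistRE; apply: le_trans nr; apply: (@cell_mdist_le _ n k) => //.
  by rewrite /p; case: xgetP => [x _ []//|/(_ t) []].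
rewrite lee_fin ler_nat size_map size_filter; exact: count_size.
Qed.

(** Balls of radius [2 ^ (- n * alpha)] covering [Y], with [2 / r] at most [2 ^ n]
    and of the same order, are pulled back to cells of length at most
    [r / 2]. *)
Lemma upper_minkowski_fibres (R : realType) (f : R -> R) (alpha eta g : R) (E : set R)
    (Z Y : set R^o) :
  0 < alpha -> sparse_fibres f alpha eta E -> Z `<=` E -> f @` Z `<=` Y ->
  (upper_minkowski_dim Y < g%:E)%E -> (upper_minkowski_dim Z <= (alpha * g + eta)%:E)%E.
Proof.
move=> a0 [C C0 [n0 HC]] ZE ZY /upper_minkowski_lt[r0 r00 Hr0].
have p0 i : 0 < 2 ^+ i :> R by rewrite exprn_gt0.
pose h := alpha * g + eta.
pose r1 : R := Num.min (Num.min 1 (2 / 2 ^+ n0)) (2 * (r0 / 2) `^ alpha^-1).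
have r10 : 0 < r1 by rewrite !lt_min ltr01 divr_gt0//= mulr_gt0// powR_gt0// divr_gt0.
apply: (@upper_minkowski_le _ _ _ (2 `^ (- g) * C * (2 `^ h + 4 `^ h)) _ r1) => //.
  by rewrite !mulr_gt0 ?addr_gt0 ?powR_gt0.
move=> r /andP[rp]; rewrite !lt_min => /andP[/andP[r_1 rn0] rr0].
have ex : exists n, 2 / r <= 2 ^+ n.
  exists (Num.truncn (2 / r)).+1; apply: (le_trans (ltW (truncnS_gt _))).
  by rewrite -natrX ler_nat ltnW// ltn_expl.
case: (ex_minnP ex) => -[|n'] hn minn.
  by exfalso; move: hn; rewrite expr0 ler_pdivrMr// mul1r; lra.
set n := n'.+1 in hn minn.
have n2 : 2 ^+ n <= 4 / r.
  have : 2 ^+ n' < 2 / r by rewrite ltNge; apply/negP => /minn; rewrite ltnn.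
  by rewrite /n exprS => h1; apply: (@le_trans _ _ (2 * (2 / r))); [rewrite ler_pM2l// ltW|lra].
have nn : (n0 <= n)%N.
  rewrite -(@ler_eXn2l R 2) ?ltr1n//; apply: le_trans hn.
  by rewrite ler_pdivlMr// mulrC -ler_pdivlMr// ltW.
pose rho := 2 * (2 ^+ n) `^ (- alpha); have rho0 : 0 < rho by rewrite mulr_gt0// powR_gt0.
have rhor : rho < r0.
  pose x := (r0 / 2) `^ alpha^-1.
  have x0 : 0 < x by rewrite powR_gt0// divr_gt0.
  have xa : x `^ alpha = r0 / 2 by rewrite powR_invK ?gt_eqF// divr_ge0// ltW.
  have -> : r0 = 2 * x `^ alpha by rewrite xa; field.
  have -> : rho = 2 * ((2 ^+ n)^-1) `^ alpha.
    by rewrite -powR_inv1 ?(ltW (p0 _))// -powRrM mulN1r.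
  rewrite ltr_pM2l//; apply: gt0_ltr_powR; rewrite ?nnegrE ?invr_ge0 ?(ltW x0) ?(ltW (p0 _))//.
  rewrite -[ltRHS]invrK ltf_pV2 ?posrE ?invr_gt0//; apply: lt_le_trans hn.
  by rewrite ltr_pdivlMr// mulrC ltr_pdivrMr.
have := Hr0 rho; rewrite rho0 rhor => /(_ isT) /covering_number_attained[q [c [qr Yc Ycov]]].
pose sq u := s2val (cid2 (HC n nn u)).
have szsq u : (size (sq u))%:R <= C * (2 ^+ n) `^ eta by rewrite /sq; case: cid2.
have Hsq u t : E t -> `|f t - u| <= (2 ^+ n) `^ (- alpha) ->
    exists2 k, k \in sq u & k%:R <= 2 ^+ n * t < k.+1%:R.
  by rewrite /sq; case: cid2 => s' ? hs' /=; exact: hs'.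
pose K := flatten [seq sq (c i) | i <- enum 'I_q].
have szK : (size K)%:R <= q%:R * (C * (2 ^+ n) `^ eta).
  rewrite /K -[in leRHS](size_enum_ord q).
  elim: (enum _) => [|i s IH] /=; first by rewrite mul0r.
  by rewrite size_cat natrD -[(size s).+1%:R]natr1 mulrDl mul1r addrC lerD.
apply: (@le_trans _ _ (size K)%:R%:E).
  apply: (@covering_number_cells _ _ n).
    by rewrite -[leRHS]invrK lef_pV2 ?posrE ?invr_gt0 ?divr_gt0// invf_div.
  move=> t Zt; have [i /=] := Ycov _ (ZY _ (imageP f Zt)).
  rewrite ?mdistRE /rho mulrAC mulfV// mul1r => ft.
  have [k kc kt] := Hsq _ _ (ZE _ Zt) ft; exists k => //.
  by apply/flattenP; exists (sq (c i)) => //; apply: (map_f (fun i => sq (c i))); rewrite mem_enum.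
rewrite lee_fin; apply: (le_trans szK).
apply: (@le_trans _ _ (rho `^ (- g) * (C * (2 ^+ n) `^ eta))).
  by rewrite ler_wpM2r// mulr_ge0 ?powR_ge0 ?(ltW C0).
have -> : rho `^ (- g) * (C * (2 ^+ n) `^ eta) = 2 `^ (- g) * C * (2 ^+ n) `^ h.
  rewrite /rho powRM ?powR_ge0// -powRrM mulrNN mulrACA.
  by rewrite -powRD ?(gt_eqF (p0 n)) ?implybT.
rewrite -!mulrA ler_wpM2l ?powR_ge0// ler_wpM2l ?(ltW C0)//.
have rE a : 0 < a -> (a / r) `^ h = a `^ h * r `^ (- h).
  move=> a00; rewrite powRM ?invr_ge0 ?(ltW a00) ?(ltW rp)//; congr (_ * _).
  by rewrite -powR_inv1 ?(ltW rp)// -powRrM mulN1r.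
have [h0|h0] := leP 0 h.
  apply: (@le_trans _ _ ((4 / r) `^ h)).
    by apply: ge0_ler_powR; rewrite ?nnegrE ?divr_ge0 ?(ltW rp) ?(ltW (p0 _)).
  by rewrite rE// ler_wpM2r ?powR_ge0// lerDr powR_ge0.
apply: (@le_trans _ _ ((2 / r) `^ h)).
  have hk y : y `^ h = (y `^ (- h))^-1 by rewrite powRN invrK.
  rewrite (hk (2 ^+ n)) (hk (2 / r)) lef_pV2 ?posrE ?powR_gt0 ?divr_gt0//.
  apply: ge0_ler_powR; rewrite ?nnegrE ?divr_ge0 ?(ltW rp) ?(ltW (p0 _)) ?oppr_ge0 ?(ltW h0)//.
by rewrite rE// ler_wpM2r ?powR_ge0// lerDl powR_ge0.
Qed.

(** * Dimensions of images under a good path *)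

Lemma lee_forall_gt (R : realType) (x u : \bar R) :
  (forall g : R, (u < g%:E)%E -> (x <= g%:E)%E) -> (x <= u)%E.
Proof.
case: u => [u| |] H.
- by apply/lee_addgt0Pr => e e0; rewrite -EFinD; apply: H; rewrite lte_fin ltrDl.
- exact: leey.
- case: x H => [x| |] H //; last by have := H 0 (ltNyr 0).
  by have := H (x - 1)%R (ltNyr _); rewrite lee_fin => h; exfalso; clear H; lra.
Qed.

(** Lets the Hölder exponent tend to [alpha] in the upper bounds. *)
Lemma exponent_choice (R : realType) (alpha g h : R) : 0 < alpha -> g / alpha < h ->
  exists2 b, 0 < b < alpha & g / b <= h.
Proof.
move=> a0; rewrite ltr_pdivrMr// => gh.
pose t := Num.min ((h * alpha - g) / (`|h| + 1)) (alpha / 2).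
have h1 : 0 < `|h| + 1 by rewrite ltr_wpDl.
have t0 : 0 < t by rewrite lt_min !divr_gt0// subr_gt0.
have ta : t <= alpha / 2 by rewrite ge_min lexx orbT.
have th : t * (`|h| + 1) <= h * alpha - g.
  by rewrite -ler_pdivlMr// ge_min lexx.
exists (alpha - t); first by apply/andP; split; lra.
rewrite ler_pdivrMr; last by lra.
have := ler_wpM2l (ltW t0) (ler_norm h); nra.
Qed.

Lemma hausdorff_null_sub (R : realType) (T : metricType R) (s : R) (A B : set T) :
  A `<=` B -> hausdorff_measure s B = 0%E -> hausdorff_measure s A = 0%E.
Proof.
move=> AB HB; apply: cover_hausdorff_null => e delta e0 d0.
have [F [BF Fd Fe]] := hausdorff_null_cover HB e0 d0.
exists F, (fun i => if F i != set0 then poweR (diam (F i)) s else 0%E); split => //.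
- exact: subset_trans BF.
- by move=> i; case: ifP => // _; exact: poweR_ge0.
- by move=> i /set0P ->.
Qed.

(** Two properties of a path that determine the dimensions of all images of
    subsets of [D]. *)
Section path_dimensions.
Variables (R : realType) (alpha : R) (f : R -> R) (D : set R).
Hypothesis alpha0 : 0 < alpha.
Hypothesis D01 : D `<=` `[0, 1].
Hypothesis holder : forall b, 0 < b < alpha -> exists2 K : R, 0 < K &
  forall s t, 0 <= s <= 1 -> 0 <= t <= 1 -> `|f t - f s| <= K * `|t - s| `^ b.
Hypothesis sparse : forall eta, 0 < eta -> exists2 E : nat -> set R,
  D = \bigcup_i E i & forall i, sparse_fibres f alpha eta (E i).

Let holderD (A : set R^o) b : A `<=` D -> 0 < b < alpha -> exists2 K : R, 0 < K &
  forall s t, A s -> A t -> `|f t - f s| <= K * `|t - s| `^ b.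
Proof.
move=> AD /holder[K K0 hK]; exists K => // s t As At.
by apply: hK; [have := D01 (AD _ As)|have := D01 (AD _ At)]; rewrite /= in_itv.
Qed.

Lemma hausdorff_dim_image (A : set R^o) : A `<=` D ->
  hausdorff_dim (f @` A : set R^o) = ((alpha^-1)%:E * hausdorff_dim A)%E.
Proof.
move=> AD; apply/eqP; rewrite eq_le; apply/andP; split.
  rewrite lee_pdivlMl//; apply: le_ereal_inf_tmp => _ [s [s0 Hs] <-].
  rewrite -lee_pdivlMl//; apply: lee_forall_gt => g; rewrite -EFinM lte_fin mulrC => sg.
  have [b b0a sb] := exponent_choice alpha0 sg.
  have [K K0 hK] := holderD AD b0a; have /andP[b0 _] := b0a.
  apply: (@le_trans _ _ (s / b)%:E); last by rewrite lee_fin.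
  apply: ereal_inf_lbound; exists (s / b) => //; split; first by rewrite divr_ge0// ltW.
  exact: hausdorff_null_image K0 b0 s0 hK Hs.
apply: le_ereal_inf_tmp => _ [s [s0 Hs] <-].
rewrite lee_pdivrMl// -EFinM; apply/lee_addgt0Pr => e e0; rewrite -EFinD.
apply: ereal_inf_lbound; exists (alpha * s + e) => //.
have s'0 : 0 <= alpha * s + e by rewrite addr_ge0 ?(ltW e0)// mulr_ge0// ltW.
split=> //; have [E DE hE] := sparse (divr_gt0 e0 (ltr0n _ 2)).
have -> : A = \bigcup_i (A `&` E i).
  by rewrite -setI_bigcupr -DE; apply/esym/setIidPl.
apply: hausdorff_null_bigcup => i.
apply: (hausdorff_null_fibres alpha0 s0 _ s'0 (hE i)) => //.
  by have := e0; rewrite mulrC; lra.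
by apply: hausdorff_null_sub Hs => _ [x [Ax _] <-]; exists x.
Qed.

Let upper_minkowski_path (A : set R^o) : A `<=` D ->
  (upper_minkowski_dim (f @` A : set R^o) <= (alpha^-1)%:E * upper_minkowski_dim A)%E.
Proof.
move=> AD; rewrite lee_pdivlMl//; apply: lee_forall_gt => g Ag.
rewrite -lee_pdivlMl//; apply: lee_forall_gt => h; rewrite -EFinM lte_fin mulrC => gh.
have [b b0a sb] := exponent_choice alpha0 gh.
have [K K0 hK] := holderD AD b0a; have /andP[b0 _] := b0a.
apply: (@le_trans _ _ (g / b)%:E); last by rewrite lee_fin.
exact: upper_minkowski_image K0 b0 hK Ag.
Qed.

(** For the lower bound, a countable cover [Y] of the image and the pieces [E]
    cut [A] into countably many sets [A `&` E i `&` f @^-1` Y j], to which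
    [upper_minkowski_fibres] applies. *)
Lemma packing_dim_image (A : set R^o) : A `<=` D ->
  packing_dim (f @` A : set R^o) = ((alpha^-1)%:E * packing_dim A)%E.
Proof.
move=> AD; apply/eqP; rewrite eq_le; apply/andP; split.
  rewrite lee_pdivlMl//; apply: le_ereal_inf_tmp => _ [F AF <-].
  rewrite -lee_pdivlMl//.
  apply: (@le_trans _ _ (ereal_sup (range (fun i => upper_minkowski_dim (f @` F i : set R^o))))).
    by apply: ereal_inf_lbound; exists (fun i => f @` F i) => //; rewrite AF image_bigcup.
  apply: ge_ereal_sup => _ [i _ <-].
  have FD : F i `<=` D by apply: subset_trans AD; rewrite AF; exact: bigcup_sup.
  apply: (le_trans (upper_minkowski_path FD)).
  rewrite lee_pmul2l//; first by apply: ereal_sup_ubound; exists i.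
  by rewrite lte_fin invr_gt0.
apply: le_ereal_inf_tmp => _ [Y AY <-].
rewrite lee_pdivrMl//; apply/lee_addgt0Pr => e e0.
have [E DE hE] := sparse e0.
have /card_esym/ppcard_eqP[p] := card_nat2.
pose Z k : set R^o := A `&` E (p k).1 `&` f @^-1` Y (p k).2.
apply: (@le_trans _ _ (ereal_sup (range (fun k => upper_minkowski_dim (Z k))))).
  apply: ereal_inf_lbound; exists Z => //.
  apply/seteqP; split=> [x Ax|x [k _ [[]]]//].
  have [j _ Yx] : (\bigcup_j Y j) (f x) by rewrite -AY; exists x.
  have [i _ Ex] : (\bigcup_i E i) x by rewrite -DE; exact: AD.
  by exists (p^-1%FUN (i, j)) => //; rewrite /Z invK ?inE.
apply: ge_ereal_sup => _ [k _ <-].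
apply: (@le_trans _ _ (alpha%:E * upper_minkowski_dim (Y (p k).2) + e%:E)%E); last first.
  rewrite leeD2r// lee_pmul2l//; first by apply: ereal_sup_ubound; exists (p k).2.
rewrite -leeBlDr// -lee_pdivrMl//; apply: lee_forall_gt => g Yg.
rewrite lee_pdivrMl// leeBlDr// -EFinM -EFinD.
apply: (upper_minkowski_fibres alpha0 (hE (p k).1) _ _ Yg).
- by move=> x [[]].
- by move=> _ [x [_ Yx] <-].
Qed.

End path_dimensions.

(** * Almost every path is good *)

(** Hölder continuity moves the visit of a fibre from a point of a cell to the
    left end of the cell, where the counting estimate applies. *)
Lemma count_sparse_fibres (R : realType) (f : R -> R) (alpha delta eta C : R) (n0 : nat) (E : set R^o) :
  0 < alpha < 1 -> 0 < delta <= alpha -> 6 * delta <= eta -> E `<=` `[0, 1] -> 0 <= C ->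
  (exists2 K : R, 0 < K & forall s t, 0 <= s <= 1 -> 0 <= t <= 1 ->
     `|f t - f s| <= K * `|t - s| `^ (alpha - delta / 2)) ->
  (forall n, (n0 <= n)%N -> forall i : nat, (i <= 2 * (2 ^ n) ^ 2)%N ->
    (count (fun k => `|f (k%:R / (2 ^ n)%:R) - (i%:R / (2 ^ n)%:R - (2 ^ n)%:R)| <=
              (2 ^+ n) `^ (- (alpha - delta)) / 2) (hit_list E (2 ^ n)))%:R <=
      C * (2 ^+ n) `^ (6 * delta)) ->
  sparse_fibres f alpha eta E.
Proof.
move=> /andP[a0 a1] /andP[d0 da] de E01 C0 [K K0 hK] hC.
pose m n : R := 2 ^+ n.
have m0 n : 0 < m n by rewrite exprn_gt0.
have m1 n : 1 <= m n by rewrite exprn_ege1// ler1n.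
have mE n : (2 ^ n)%:R = m n by rewrite natrX.
have b0 : 0 < alpha - delta / 2 by lra.
exists (C + 1); first by rewrite ltr_wpDl.
have K2 : 0 < (K + 2)^-1 / 2 by rewrite divr_gt0// invr_gt0; lra.
have [n1 _ hn1] := dyadic_powR_small n0 (divr_gt0 d0 (ltr0n R 2)) K2.
pose S : R := `|f 0| + K.
pose n2 := (Num.truncn (S + 1)).+1.
exists (maxn n0 (maxn n1 n2)) => n; rewrite !geq_max => /and3P[nn0 nn1 nn2] u.
have mS : S + 1 <= m n.
  apply: (le_trans (ltW (truncnS_gt _))); rewrite -mE ler_nat (leq_trans nn2)//.
  by rewrite ltnW// ltn_expl.
have small : (K + 2) * m n `^ (- (delta / 2)) <= 2^-1.
  have : m n `^ (- (delta / 2)) <= (2 ^+ n1) `^ (- (delta / 2)).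
    rewrite !powRN lef_pV2 ?posrE ?powR_gt0//.
    apply: ge0_ler_powR; rewrite ?nnegrE ?(ltW (m0 _)) ?divr_ge0 ?(ltW d0)//.
    by rewrite ler_eXn2l ?ltr1n.
  move=> /le_trans /(_ hn1) h; rewrite -ler_pdivlMl; last by lra.
  exact: h.
have m6 : 1 <= m n `^ eta.
  by rewrite -[leLHS](powRr0 (m n)); apply: ler_powR => //; lra.
have bnd (t : R) : E t -> 0 <= t <= 1 by move=> /E01; rewrite /= in_itv.
have [um|um] := leP `|u| (m n); last first.
  exists [::] => [|t Et ft]; first by rewrite mulr_ge0// ?powR_ge0// addr_ge0.
  exfalso; move: um; apply/negP; rewrite -leNgt; apply: le_trans mS.
  have t01 := bnd t Et; have /andP[t0 t1] := t01.
  have z01 : 0 <= (0 : R) <= 1 by rewrite lexx ler01.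
  have h1 : `|f t - f 0| <= K.
    apply: (le_trans (hK 0 t z01 t01)).
    rewrite subr0 ger0_norm// ler_piMr ?(ltW K0)//.
    apply: (@le_trans _ _ (1 `^ (alpha - delta / 2))); last by rewrite powR1.
    by apply: ge0_ler_powR; rewrite ?nnegrE ?(ltW b0).
  have h2 : m n `^ (- alpha) <= 1.
    by rewrite -[leRHS](powRr0 (m n)); apply: ler_powR => //; rewrite oppr_le0 ltW.
  have -> : u = f 0 + (f t - f 0) - (f t - u) by ring.
  apply: (le_trans (ler_normB _ _)); apply: lerD; last exact: le_trans ft h2.
  by apply: (le_trans (ler_normD _ _)); rewrite lerD2l.
move: um; rewrite ler_norml => /andP[um1 um2].
have x0 : 0 <= (u + m n) * m n by rewrite mulr_ge0 ?(ltW (m0 n))//; lra.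
pose i := Num.truncn ((u + m n) * m n).
have /andP[i1 i2] := truncn_itv x0; rewrite -/i in i1 i2.
have im : (i <= 2 * (2 ^ n) ^ 2)%N.
  rewrite -(ler_nat R) natrM natrX mE; apply: (le_trans i1).
  by rewrite expr2 mulrA ler_wpM2r ?(ltW (m0 n))//; lra.
pose y := i%:R / m n - m n.
have uy : `|u - y| <= (m n)^-1.
  have -> : u - y = ((u + m n) * m n - i%:R) / m n.
    by rewrite /y; field; rewrite gt_eqF.
  rewrite normrM (gtr0_norm (x := (m n)^-1)) ?invr_gt0// ler_piMl ?invr_ge0 ?(ltW (m0 n))//.
  by move: i2; rewrite -natr1 ler_norml => i2; apply/andP; split; lra.
pose near_y k := `|f (k%:R / (2 ^ n)%:R) - (i%:R / (2 ^ n)%:R - (2 ^ n)%:R)| <=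
  (2 ^+ n) `^ (- (alpha - delta)) / 2.
(* The cell of [0] is not counted by [hit_list] and is added separately. *)
exists (0%N :: [seq k <- hit_list E (2 ^ n) | near_y k]).
  rewrite /= size_filter -natr1 mulrDl mul1r; apply: lerD => //.
  apply: (le_trans (hC n nn0 i im)); rewrite ler_wpM2l//.
  exact: ler_powR.
move=> t Et ft; have t01 := bnd t Et; have /andP[t0 t1] := t01.
have /andP[k1 k2] := dyadic_itv n t0; have km := dyadic_le n t01.
set k := dyadic n t in k1 k2 km.
have kt : k%:R <= 2 ^+ n * t < k.+1%:R.
  by rewrite mulrC -ler_pdivrMr// k1 -ltr_pdivlMr.
exists k => //; rewrite inE; have [//|k0] := eqVneq k 0%N.
rewrite mem_filter mem_filter mem_rev mem_iota add1n ltnS km lt0n k0 /=.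
rewrite andbT; apply/andP; split; last first.
  by apply/asboolP; exists t => //; rewrite mE.
rewrite /near_y mE -/(m n) -/y.
have kt1 : `|f t - f (k%:R / m n)| <= K * m n `^ (- (alpha - delta / 2)).
  apply: (le_trans (hK _ _ _ t01)).
    by rewrite divr_ge0 ?(ltW (m0 n))//= (le_trans k1).
  rewrite ler_wpM2l ?(ltW K0)//.
  have -> : m n `^ (- (alpha - delta / 2)) = ((m n)^-1) `^ (alpha - delta / 2).
    by rewrite -(powR_inv1 (ltW (m0 n))) -powRrM mulN1r.
  apply: ge0_ler_powR; rewrite ?nnegrE ?invr_ge0 ?(ltW (m0 n)) ?(ltW b0)//.
  rewrite ger0_norm ?subr_ge0//.
  by move: k2; rewrite -natr1 mulrDl mul1r => /ltW; rewrite lerBlDl.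
have powE x : x <= - (alpha - delta / 2) ->
    m n `^ x <= m n `^ (- (delta / 2)) * m n `^ (- (alpha - delta)).
  move=> hx; rewrite -powRD ?(gt_eqF (m0 n)) ?implybT//; apply: ler_powR => //.
  lra.
have e1 := powE _ (lexx _).
have e2 : m n `^ (- alpha) <= m n `^ (- (delta / 2)) * m n `^ (- (alpha - delta)).
  by apply: powE; lra.
have e3 : (m n)^-1 <= m n `^ (- (delta / 2)) * m n `^ (- (alpha - delta)).
  by rewrite -(powR_inv1 (ltW (m0 n))); apply: powE; lra.
have -> : f (k%:R / m n) - y = - (f t - f (k%:R / m n)) + (f t - u) + (u - y) by ring.
apply: (le_trans (ler_normD _ _)); apply: (le_trans (lerD (ler_normD _ _) (lexx _))).
rewrite normrN.
have w0 : 0 <= m n `^ (- (alpha - delta)) by exact: powR_ge0.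
have := ler_wpM2r w0 small.
have := ler_wpM2l (ltW K0) e1.
rewrite -/(m n) in ft.
lra.
Qed.

Lemma mod_assouad_pieces (R : realType) (D : set R^o) (alpha eps g : R) :
  (mod_assouad_dim D <= alpha%:E)%E -> 0 < eps < 1 -> alpha < g ->
  exists2 F : nat -> set R^o, D = \bigcup_i F i &
    forall i, (assouad_dim_eps eps (F i) < g%:E)%E.
Proof.
move=> hdim e01 ag.
have : (mod_assouad_dim_eps eps D < g%:E)%E.
  apply: (@le_lt_trans _ _ alpha%:E); last by rewrite lte_fin.
  by apply: le_trans hdim; apply: ereal_sup_ubound; exists eps.
move=> /ereal_inf_lt[_ [F DF <-] Fg]; exists F => // i.
by apply: le_lt_trans Fg; apply: ereal_sup_ubound; exists i.
Qed.

Lemma fbm_holder_ae d (T : measurableType d) (R : realType) (P : probability T R)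
    (alpha : R) (B : R -> {RV P >-> R}) :
  0 < alpha < 1 -> fractional_brownian_motion01 P alpha B ->
  {ae P, forall w, forall b, 0 < b < alpha -> exists2 K : R, 0 < K &
    forall s t, 0 <= s <= 1 -> 0 <= t <= 1 -> `|B t w - B s w| <= K * `|t - s| `^ b}.
Proof.
move=> /andP[a0 a1] hB.
pose beta (j : nat) := alpha - alpha / j.+2%:R.
have ba j : beta j < alpha by rewrite gtrBl divr_gt0.
have b0 j : 0 < beta j by rewrite subr_gt0 ltr_pdivrMr// ltr_pMr// ltr1n.
have H : {ae P, forall w, forall j, exists n0, forall n, (n0 <= n)%N -> forall k : nat, (k < 2 ^ n)%N ->
    `|B (k.+1%:R / 2 ^+ n) w - B (k%:R / 2 ^+ n) w| <= (2 ^+ n) `^ (- beta j)}.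
  by apply/ae_foralln => j; exact: (fbm_dyadic_increments a0 hB (ba j)).
apply: filterS2 H (fbm_continuous hB) => w Hw cw b /andP[bp ba'].
have [j jb] : exists j, b <= beta j.
  exists (Num.truncn (alpha / (alpha - b))).
  have ab : 0 < alpha - b by rewrite subr_gt0.
  rewrite /beta lerBrDr -lerBrDl ler_pdivrMr// [leRHS]mulrC -ler_pdivrMr//.
  by apply: (le_trans (ltW (truncnS_gt _))); rewrite ler_nat leqnSn.
have [n0 hn0] := Hw j.
have [K K0 hK] := dyadic_increments_holder (f := fun t => B t w) (b0 j) cw hn0.
exists (K + 1); first by rewrite ltr_wpDl.
move=> s t s01 t01; apply: (le_trans (hK s t s01 t01)).
have [->|st] := eqVneq s t.
  by rewrite subrr normr0 !powR0 ?gt_eqF// !mulr0.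
have h0 : 0 < `|t - s| by rewrite normr_gt0 subr_eq0 eq_sym.
have h1 : `|t - s| <= 1.
  move: s01 t01 => /andP[? ?] /andP[? ?]; rewrite ler_norml; apply/andP; split; lra.
apply: ler_pM => //; rewrite ?powR_ge0//; first by rewrite lerDl.
by apply: ger_powR => //; rewrite h0.
Qed.

(** One decomposition of [D] for each [delta = alpha / (j + 2)], so that only
    countably many almost sure events are intersected. *)
Lemma fbm_sparse_fibres_ae d (T : measurableType d) (R : realType) (P : probability T R)
    (alpha : R) (B : R -> {RV P >-> R}) (D : set R^o) :
  0 < alpha < 1 -> fractional_brownian_motion01 P alpha B -> D `<=` `[0, 1] ->
  (mod_assouad_dim D <= alpha%:E)%E ->
  {ae P, forall w, forall eta, 0 < eta -> exists2 E : nat -> set R,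
    D = \bigcup_i E i & forall i, sparse_fibres (fun t => B t w) alpha eta (E i)}.
Proof.
move=> a01 hB D01 hdim; have /andP[a0 a1] := a01.
pose delta (j : nat) := alpha / j.+2%:R.
have d0 j : 0 < delta j by rewrite divr_gt0.
have da j : delta j <= alpha by rewrite ler_pdivrMr// ler_peMr ?(ltW a0)// ler1n.
have d01 j : 0 < delta j < 1 by rewrite d0 (le_lt_trans (da j)).
have pieces j : exists2 F : nat -> set R^o, D = \bigcup_i F i &
    forall i, (assouad_dim_eps (delta j) (F i) < (alpha + delta j)%:E)%E.
  by apply: (mod_assouad_pieces hdim (d01 j)); rewrite ltrDl.
pose F j := s2val (cid2 (pieces j)).
have DF j : D = \bigcup_i F j i by rewrite /F; case: cid2.
have dF j i : (assouad_dim_eps (delta j) (F j i) < (alpha + delta j)%:E)%E.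
  by rewrite /F; case: cid2.
have H : {ae P, forall w, forall j i, exists2 C : R, 0 <= C & exists n0, forall n, (n0 <= n)%N ->
    forall l : nat, (l <= 2 * (2 ^ n) ^ 2)%N ->
    (count (fun k => `|B (k%:R / (2 ^ n)%:R) w - (l%:R / (2 ^ n)%:R - (2 ^ n)%:R)| <=
              (2 ^+ n) `^ (- (alpha - delta j)) / 2) (hit_list (F j i) (2 ^ n)))%:R <=
      C * (2 ^+ n) `^ (6 * delta j)}.
  apply/ae_foralln => j; apply/ae_foralln => i.
  have [C C0 hC] := fbm_count_ae a01 hB (d01 j) (da j) (dF j i).
  by apply: filterS hC => w hw; exists C.
apply: filterS2 H (fbm_holder_ae a01 hB) => w Hw Kw eta eta0.
have [j je] : exists j, 6 * delta j <= eta.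
  exists (Num.truncn (6 * alpha / eta)).
  rewrite mulrA ler_pdivrMr// [leRHS]mulrC -ler_pdivrMr//.
  by apply: (le_trans (ltW (truncnS_gt _))); rewrite ler_nat leqnSn.
exists (F j) => // i; have [C C0 [n0 hC]] := Hw j i.
apply: (@count_sparse_fibres _ _ alpha (delta j) eta C n0) => //.
- by rewrite d0 da.
- by apply: subset_trans D01; rewrite (DF j); exact: bigcup_sup.
- by apply: Kw; have := d0 j; have := da j; move=> h1 h2; apply/andP; split; lra.
Qed.

Theorem theorem1p7 (R : realType) (d : measure_display) (T : measurableType d)
    (P : probability T R) (alpha : R) (halpha : 0 < alpha < 1)
    (B : R -> {RV P >-> R}) (hB : fractional_brownian_motion01 P alpha B)
    (D : set R^o) (hD : D `<=` `[0, 1])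
    (hdim : (mod_assouad_dim D <= alpha%:E)%E) :
  {ae P, forall w, forall A : set R^o, A `<=` D ->
    hausdorff_dim ([set B t w | t in A] : set R^o) =
      ((alpha^-1)%:E * hausdorff_dim A)%E} /\
  {ae P, forall w, forall A : set R^o, A `<=` D ->
    packing_dim ([set B t w | t in A] : set R^o) =
      ((alpha^-1)%:E * packing_dim A)%E}.
Proof.
have /andP[a0 _] := halpha.
have holder := fbm_holder_ae halpha hB.
have sparse := fbm_sparse_fibres_ae halpha hB hD hdim.
split; apply: filterS2 holder sparse => w Kw Sw A AD.
- exact: (hausdorff_dim_image a0 hD Kw Sw AD).
- exact: (packing_dim_image a0 hD Kw Sw AD).
Qed.
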